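(* For an infinite cardinal $\kappa\le\mathfrak{c}$ let $\mathbf{seq}_\kappa(\mathcal{M})$ be the collection of all Tukey classes of $\mathbf{seq}(M)$ where $M$ is separable metrizable of cardinality $\kappa$. If $\mathbf{seq}(M)$ is in $\mathbf{seq}_\mu(\mathcal{M})$ (with $|M|=\mu$) and $\mathbf{seq}(N)$ is in $\mathbf{seq}_\nu(\mathcal{M})$ (with $|N|=\nu$), where $\mu<\nu$, then $\mathbf{seq}(M)<_T\mathbf{seq}(N)$. Case $\kappa=\aleph_0$: the Tukey classes in $\mathbf{seq}_\kappa(\mathcal{M})$ are parametrized by $\Delta+1$: they are the classes of $\mathbf{seq}(M(\lambda,\mu))$, for $(\lambda,\mu)\in\Delta$, and one additional class $\mathbf{seq}(N)$. Here $\mathbf{seq}(M(\lambda,\mu))=_T(\omega^\omega,\le_\infty)\times(\lambda,=)+(\mu,=)$; $\mathbf{seq}(N)=_T(\omega^\omega,\le_\infty)\times(\omega,=)$ is an upper bound of all $\mathbf{seq}(M(\lambda,\mu))$; and $(\lambda,\mu)\succeq(\lambda',\mu')$ if and only if $\mathbf{seq}(M(\lambda,\mu))\ge_T\mathbf{seq}(M(\lambda',\mu'))$. Case $\mathrm{cof}(\kappa)\neq\omega$: there is a unique Tukey class in $\mathbf{seq}_\kappa(\mathcal{M})$, with type $P(\kappa)\times(\kappa,=)$. Case $\kappa=\aleph_\alpha>\aleph_0$ and $\mathrm{cof}(\kappa)=\omega$: the Tukey classes in $\mathbf{seq}_\kappa(\mathcal{M})$ are parametrized by $\Delta+(\alpha+1)$: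 they are the classes of $\mathbf{seq}(M(\lambda,\mu))$, for $(\lambda,\mu)\in\Delta$, and additional classes $\mathbf{seq}(N_\beta)$ for $\beta\le\alpha$. Here $\mathbf{seq}(M(\lambda,\mu))=_T P(\kappa)\times(\lambda,=)+Q(\kappa)\times(\mu,=)+S(\kappa)$, $\mathbf{seq}(N_\beta)=_T P(\kappa)\times(\aleph_\beta,=)+S(\kappa)$ for $\beta<\alpha$, and $\mathbf{seq}(N_\alpha)=_T P(\kappa)\times(\kappa,=)$. Moreover $\alpha\ge\beta\ge\gamma$ implies $\mathbf{seq}(N_\beta)\ge_T\mathbf{seq}(N_\gamma)$; $\mathbf{seq}(N_0)$ is an upper bound of all $\mathbf{seq}(M(\lambda,\mu))$; and $(\lambda,\mu)\succeq(\lambda',\mu')$ implies $\mathbf{seq}(M(\lambda,\mu))\ge_T\mathbf{seq}(M(\lambda',\mu'))$.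
   Context: $\Delta=\{(\lambda,\mu):0\le\lambda<\omega,\ \mu\le\omega\}$, partially ordered by: $(\lambda,\mu)\succeq(\lambda',\mu')$ iff $\lambda\ge\lambda'$ and $\lambda+\mu\ge\lambda'+\mu'$ (cardinal addition). ''Parametrized'' means that the listed types are all realized and every class is one of them; in the last case ($\kappa>\aleph_0$ of countable cofinality) the paper does not assert that the listed classes are pairwise distinct. In the different cases the spaces $M(\lambda,\mu)$, $N$, $N_\beta$ are separable metrizable of cardinality $\kappa$ (depending on $\kappa$). A relation is a triple $\mathbf{A}=(A_-,A_+,A)$ of sets $A_-,A_+$ and a binary predicate $xAy$ for $x\in A_-$, $y\in A_+$; $(A',A)$ abbreviates $(A',A',A)$. A (Tukey) morphism from $\mathbf{A}$ to $\mathbf{B}$ is a pair $(\psi_-,\phi_+)$ of functions $\psi_-:B_-\to A_-$, $\phi_+:A_+\to B_+$ such that $\psi_-(b)\,A\,a$ implies $b\,B\,\phi_+(a)$ for all $b\in B_-$, $a\in A_+$. Write $\mathbf{A}\ge_T\mathbf{B}$ if there is such a morphism; by convention $\mathbf{A}\ge_T\mathbf{B}$ also holds whenever $B_-=\emptyset$. $\mathbf{A}=_T\mathbf{B}$ means $\mathbf{A}\ge_T\mathbf{B}$ and $\mathbf{B}\ge_T\mathbf{A}$; Tukey classes are $=_T$-classes; $\mathbf{A}<_T\mathbf{B}$ means $\mathbf{B}\ge_T\mathbf{A}$ and $\mathbf{A}\not\ge_T\mathbf{B}$. $\mathbf{A}\times\mathbf{B}=(A_-\times B_-,A_+\times B_+,A\times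 B)$, predicate coordinatewise. The sum $\sum_{i}\mathbf{A}_i$ (binary: $\mathbf{A}+\mathbf{B}$) has as first and second entries the disjoint unions of the $(A_i)_-$ and of the $(A_i)_+$, with $x$ related to $y$ iff for some $i$, $x\in(A_i)_-$, $y\in(A_i)_+$ and $xA_iy$. For a cardinal $\lambda$, $(\lambda,=)$ is equality on $\lambda$. For $f,g\in\omega^\omega$, $f\le_\infty g$ means $f(n)\le g(n)$ for infinitely many $n$. For a space $X$: $\mathrm{NC}(X)$ is the set of non-closed subsets; $\mathrm{CS}^+(X)=\{e(\omega+1): e \text{ an embedding of the space }\omega+1\text{ into }X\}$; $S\,(\neg c)\,T$ means $S\cap T$ is not closed in $T$; $\mathbf{seq}(X)=(\mathrm{NC}(X),\mathrm{CS}^+(X),\neg c)$. For a sequence of cardinals $(\kappa_n)_n$, $\left(\prod_n[\kappa_n]^{<\omega}\right)_\infty$ is the set of sequences $(F_n)_{n\in\omega}$, $F_n$ a finite subset of $\kappa_n$, with $F_n\neq\emptyset$ for infinitely many $n$; $(F_n)_n\,i_\infty\,(G_n)_n$ means $F_n\cap G_n\neq\emptyset$ for infinitely many $n$. $P(\kappa)=\left((([\kappa]^{<\omega})^\omega)_\infty,i_\infty\right)$ (all $\kappa_n=\kappa$). For uncountable $\kappa$ with $\mathrm{cof}(\kappa)=\omega$, fix a strictly increasing sequence $(\kappa_n)_n$ of cardinals below $\kappa$ with supremum $\kappa$, and let $Q(\kappa)=\left(\left(\prod_n[\kappa_n]^{<\omega}\right)_\infty,i_\infty\right)$ and $S(\kappa)=\sum_n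 P(\kappa_n)\times(\kappa_n,=)$ (up to $=_T$ the choice of $(\kappa_n)_n$ does not matter). $\mathfrak{c}$ is the cardinality of the continuum. *)

(* Defs.v *)
From HB Require Import structures.
From mathcomp Require Import all_boot all_order all_algebra.
From mathcomp Require Import all_classical all_reals all_analysis.
From mathcomp Require wochoice.

Set Implicit Arguments.
Unset Strict Implicit.
Unset Printing Implicit Defensive.

Import Order.TTheory.

Local Open Scope classical_set_scope.
Local Open Scope card_scope.

(* There is no type of cardinals: a cardinal is given by a type [K] standing for
   the cardinality of [[set: K]], compared through [#<=] and [#=]. *)

Definition card_lt T U (A : set T) (B : set U) : Prop :=
  A #<= B /\ ~ (B #<= A).

(* [le] makes [K] order isomorphic to the initial ordinal of its cardinality. *)
Definition initial_well_order (K : Type) (le : rel K) : Prop :=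
  wochoice.well_order le /\
  forall x, card_lt [set y | le y x /\ y <> x] [set: K].

Definition cofinal (K : Type) (le : rel K) (C : set K) : Prop :=
  forall x, exists2 y, C y & le x y.

(* cof(K) = L: the least cardinality of a cofinal subset of the initial ordinal
   of K is L. *)
Definition has_cof (K L : Type) : Prop :=
  exists le : rel K, [/\ initial_well_order le,
    exists2 C, cofinal le C & C #= [set: L] &
    forall C, cofinal le C -> [set: L] #<= C].

(* Transfinite recursion along a well-order: aleph_b is the least infinite
   cardinal above all the aleph_c with c < b. *)
Definition aleph_family (A : Type) (le : rel A) (aleph : A -> Type) : Prop :=
  forall b, [/\ infinite_set [set: aleph b],
    forall c, le c b -> c <> b -> card_lt [set: aleph c] [set: aleph b] &
    forall T : Type, infinite_set [set: T] ->
      (forall c, le c b -> c <> b -> card_lt [set: aleph c] [set: T]) ->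
      [set: aleph b] #<= [set: T]].

(* A strictly increasing sequence of cardinals below K with supremum K. *)
Definition cardinals_increasing_to (K : Type) (Kn : nat -> Type) : Prop :=
  [/\ forall n, card_lt [set: Kn n] [set: Kn n.+1],
      forall n, card_lt [set: Kn n] [set: K] &
      forall T : Type, (forall n, [set: Kn n] #<= [set: T]) ->
        [set: K] #<= [set: T]].

(* The ordinal omega + 1: [Some n] is the natural number n, [None] is omega. *)
Definition omega_succ : Type := option nat.

HB.instance Definition _ := Choice.on omega_succ.

Definition omega_le (x y : omega_succ) : bool :=
  match x, y with
  | _, None => true
  | None, Some _ => false
  | Some m, Some n => (m <= n)%N
  end.

Fact omega_le_anti : antisymmetric omega_le.
Proof. by move=> [m|] [n|] //= /anti_leq ->. Qed.

Fact omega_le_trans : transitive omega_le.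
Proof. by move=> [n|] [m|] [p|] //=; exact: leq_trans. Qed.

Fact omega_le_total : total omega_le.
Proof. by move=> [m|] [n|] //=; exact: leq_total. Qed.

HB.instance Definition _ :=
  @Order.isOrder.Build Order.default_display omega_succ omega_le
    (fun x y => (y != x) && omega_le x y) _ _
    (fun _ _ => erefl) (fun _ _ => erefl) (fun _ _ => erefl)
    omega_le_anti omega_le_trans omega_le_total.

Definition omega_add (l : nat) (m : omega_succ) : omega_succ := omap (addn l) m.

Definition omega_card (m : omega_succ) : Type :=
  if m is Some k then 'I_k else nat.

Definition Delta : Type := nat * omega_succ.

Definition Delta_ge (p q : Delta) : Prop :=
  (q.1 <= p.1)%N /\ (omega_add q.1 q.2 <= omega_add p.1 p.2)%O.

Record trel : Type := Trel {
  tminus : Type;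
  tplus : Type;
  tpred : tminus -> tplus -> Prop }.

Declare Scope trel_scope.
Delimit Scope trel_scope with trel.
Bind Scope trel_scope with trel.

Definition tukey_morphism (A B : trel)
    (psi : tminus B -> tminus A) (phi : tplus A -> tplus B) : Prop :=
  forall b a, tpred (psi b) a -> tpred b (phi a).

(* The first disjunct is the convention for B_- empty. *)
Definition tukey_ge (A B : trel) : Prop :=
  (tminus B -> False) \/ exists psi phi, @tukey_morphism A B psi phi.

Definition tukey_eq (A B : trel) : Prop := tukey_ge A B /\ tukey_ge B A.

Definition tukey_lt (A B : trel) : Prop := tukey_ge B A /\ ~ tukey_ge A B.

Definition tukey_class (A : trel) : trel -> Prop := tukey_eq A.

Definition trel_prod (A B : trel) : trel :=
  @Trel (tminus A * tminus B) (tplus A * tplus B)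
    (fun x y => tpred x.1 y.1 /\ tpred x.2 y.2).

Definition trel_add (A B : trel) : trel :=
  @Trel (tminus A + tminus B) (tplus A + tplus B)
    (fun x y => match x, y with
      | inl a, inl a' => tpred a a'
      | inr b, inr b' => tpred b b'
      | _, _ => False
      end).

Definition trel_sum (I : Type) (A : I -> trel) : trel :=
  @Trel {i & tminus (A i)} {i & tplus (A i)}
    (fun x y => exists i (a : tminus (A i)) (a' : tplus (A i)),
      [/\ x = existT _ i a, y = existT _ i a' & tpred a a']).

Notation "A * B" := (trel_prod A B) : trel_scope.
Notation "A + B" := (trel_add A B) : trel_scope.

Definition trel_eq (K : Type) : trel := @Trel K K eq.

Definition trel_le_infty : trel :=
  @Trel (nat -> nat) (nat -> nat)
    (fun f g => infinite_set [set n | (f n <= g n)%N]).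

(* The sequences in prod_n [Kn n]^{<omega} with infinitely many nonempty terms. *)
Definition fin_seqs (Kn : nat -> Type) : Type :=
  {F : forall n, set (Kn n) |
    (forall n, finite_set (F n)) /\ infinite_set [set n | F n !=set0]}.

Definition meet_infty (Kn : nat -> Type) (F G : fin_seqs Kn) : Prop :=
  infinite_set [set n | sval F n `&` sval G n !=set0].

Definition trelQ (Kn : nat -> Type) : trel :=
  @Trel (fin_seqs Kn) (fin_seqs Kn) (@meet_infty Kn).

Definition trelP (K : Type) : trel := trelQ (fun=> K).

Definition trelS (Kn : nat -> Type) : trel :=
  trel_sum (fun n => trelP (Kn n) * trel_eq (Kn n))%trel.

Definition is_embedding (X Y : topologicalType) (e : X -> Y) : Prop :=
  injective e /\
  forall U : set X, open U <-> exists2 V : set Y, open V & e @^-1` V = U.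

Definition NC (X : topologicalType) : Type := {S : set X | ~ closed S}.

Definition CSplus (X : topologicalType) : Type :=
  {T : set X | exists2 e : order_topology omega_succ -> X,
                 is_embedding e & T = range e}.

Definition not_closed_in (X : topologicalType) (S T : set X) : Prop :=
  ~ closed (S `&` T : set (subspace T)).

Definition seqT (X : topologicalType) : trel :=
  @Trel (NC X) (CSplus X) (fun S T => not_closed_in (sval S) (sval T)).

Definition separable (X : topologicalType) : Prop :=
  exists2 D : set X, countable D & dense D.

Definition homeomorphic (X Y : topologicalType) : Prop :=
  exists (f : X -> Y) (g : Y -> X),
    [/\ cancel f g, cancel g f, continuous f & continuous g].

Definition metrizable (R : realType) (X : topologicalType) : Prop :=
  exists Y : metricType R, homeomorphic X Y.

Definition sep_metrizable_of_card (R : realType) (K : Type)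
    (X : topologicalType) : Prop :=
  [/\ separable X, metrizable R X & [set: X] #= [set: K]].

(* The collection of the Tukey classes of the spaces of cardinality K; a class
   is the predicate of its members. *)
Definition seq_classes (R : realType) (K : Type) (C : trel -> Prop) : Prop :=
  exists2 X : topologicalType,
    sep_metrizable_of_card R K X & C = tukey_class (seqT X).

(* Main.v *)
(* At a non-isolated point x of a separable metrizable space fix a decreasing base
   (V_n) of neighbourhoods.  A set accumulating at x may be thinned to a set with
   finite trace on every shell A_n = V_n \ V_(n+1), and a sequence converging to x
   has finite traces as well; hence seq(X) is the sum over the non-isolated points
   of the relations (prod_n [A_n]^(<omega))_infty.  The type of such a relation
   depends only on how large the |A_n| are infinitely often.

   Let kappa = |X|.  A point has type P(kappa) as soon as infinitely many shells have
   size kappa; if all its neighbourhoods have size kappa but almost all its shells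
   are smaller it has type Q(kappa) (type 1 if kappa is countable), and there are
   only countably many such points.  The remaining points form an open set U, and
   they contribute S(kappa) if |U| = kappa.  If there are kappa points of the first
   kind they absorb everything; this is the case when cof(kappa) <> omega.

   In a sum of directed relations a Tukey morphism is injective on components, which
   gives the non-comparisons.  Spaces with prescribed numbers of points of the two
   kinds are obtained from sets of branches of the tree of finite sequences, by
   attaching at each node discrete sums of smaller spaces. *)
Require Import Defs.
From mathcomp Require Import all_boot all_order all_algebra.
From mathcomp Require Import all_classical all_reals all_analysis.
From mathcomp Require wochoice.
From HB Require Import structures.
From mathcomp Require Import zify.

Set Implicit Arguments.
Unset Strict Implicit.
Unset Printing Implicit Defensive.

Local Open Scope classical_set_scope.
Local Open Scope card_scope.

(** * Cardinal arithmetic *)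

(** Every relation of the theorem is brought to one shape, a sum over an index type of relations
    [trelQ]. The relation $(\omega^\omega,\le_\infty)$ becomes [trelP nat], the type 1 becomes
    [trelP unit], and a product with $(\lambda,=)$ becomes a sum of $\lambda$ copies. To prove a
    comparison it then suffices to inject the smaller index type into the larger one so that each
    component goes to one at least as large. Conversely, a morphism gives only an injection of index
    types; that countably many components of type 1 cannot replace one component $P(\omega)$ needs a
    diagonal argument.

    In the case $\mathrm{cof}(\kappa)\neq\omega$ the cofinality acts through a single fact: among
    countably many pieces covering $\kappa$, one has size $\kappa$. When
    $\mathrm{cof}(\kappa)=\omega$, the remaining points must be matched with the index set of
    $S(\kappa)$ so that the $\kappa_n$ of each component is respected: from above by basic open sets
    assigned distinct levels $n$, from below by cutting these points into countably many slices of
    size $\kappa$. *)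

Lemma card_le_injP T U (A : set T) (B : set U) :
  (A #<= B) <-> exists f : A -> B, injective f.
Proof.
split=> [/card_leP/injfunPex[f _ finj]|[f finj]].
  by exists f => x y; apply: finj; rewrite in_setE.
by apply/card_leP/injfunPex; exists f => // x y _ _; exact: finj.
Qed.

(** An injection given as a relation requires no default value, so empty sets need no separate
    treatment. *)
Lemma card_le_rel T U (A : set T) (B : set U) (R : T -> U -> Prop) :
  (forall x, A x -> exists2 y, B y & R x y) ->
  (forall x x' y, A x -> A x' -> B y -> R x y -> R x' y -> x = x') -> A #<= B.
Proof.
move=> tot inj.
have /choice[f fP] (x : A) : exists y : B, R (val x) (val y).
  have [y By Rxy] := tot _ (set_valP x).
  by exists (SigSub (mem_set By)).
apply/card_le_injP; exists f => x x' e; apply/val_inj.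
apply: (inj _ _ (val (f x'))); do ?exact: set_valP; last exact: fP.
by rewrite -e.
Qed.

Lemma card_le_fun T U (A : set T) (B : set U) :
  A #<= B -> A !=set0 -> exists2 f : T -> U, set_fun A B f & set_inj A f.
Proof.
move=> /card_le_injP[f finj] [a Aa].
exists (fun x => if pselect (A x) is left Ax then val (f (SigSub (mem_set Ax)))
          else val (f (SigSub (mem_set Aa)))).
  by move=> x Ax /=; case: pselect => // ?; exact: set_valP.
move=> x y /set_mem Ax /set_mem Ay /=; case: pselect => // Ax'; case: pselect => // Ay'.
by move=> /val_inj/finj[].
Qed.

Lemma card_leTT T U :
  ([set: T] #<= [set: U]) <-> exists f : T -> U, injective f.
Proof.
split=> [TU|[f finj]]; last first.
  apply: (@card_le_rel _ _ _ _ (fun x y => y = f x)) => [x _|x x' y _ _ _ -> /finj//].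
  by exists (f x).
have [[x _]|] := pselect ([set: T] !=set0).
  have [f _ finj] := card_le_fun TU (ex_intro _ x I).
  by exists f => y z; apply: finj; rewrite in_setE.
move=> T0; have F (t : T) : False by apply: T0; exists t.
by exists (fun t => False_rect _ (F t)) => t; case: (F t).
Qed.

(** Zorn's lemma for partial injections: a maximal one exhausts [A] or [B], since otherwise a pair
    of missed points extends it. *)
Lemma card_le_total T U (A : set T) (B : set U) : A #<= B \/ B #<= A.
Proof.
pose P (G : set (T * U)) := [/\ G `<=` A `*` B,
  (forall x y y', G (x, y) -> G (x, y') -> y = y') &
  (forall x x' y, G (x, y) -> G (x', y) -> x = x')].
have [F FP totF|G [[GAB Gf Gi] Gmax]] := @Zorn_bigcup _ P.
  split.
  - by move=> p [G /FP[+ _ _] Gp]; apply.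
  - move=> x y y' [G FG Gxy] [G' FG' Gxy'].
    have [s|s] := totF _ _ FG FG'.
    + by have [_ f _] := FP _ FG'; apply: f Gxy'; exact: s.
    + by have [_ f _] := FP _ FG; apply: f Gxy _; exact: s.
  - move=> x x' y [G FG Gxy] [G' FG' Gxy'].
    have [s|s] := totF _ _ FG FG'.
    + by have [_ _ f] := FP _ FG'; apply: f Gxy'; exact: s.
    + by have [_ _ f] := FP _ FG; apply: f Gxy _; exact: s.
have [Adom|] := pselect (forall x, A x -> exists y, G (x, y)).
  left; apply: (@card_le_rel _ _ _ _ (fun x y => G (x, y))).
    by move=> x /Adom[y Gxy]; exists y => //; have [] := GAB _ Gxy.
  by move=> x x' y _ _ _; exact: Gi.
have [Bdom _|] := pselect (forall y, B y -> exists x, G (x, y)).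
  right; apply: (@card_le_rel _ _ _ _ (fun y x => G (x, y))).
    by move=> y /Bdom[x Gxy]; exists x => //; have [] := GAB _ Gxy.
  by move=> y y' x _ _ _; exact: Gf.
move=> /existsNP[y /not_implyP[By /forallNP Gy]].
move=> /existsNP[x /not_implyP[Ax /forallNP Gx]].
case: (Gmax (G `|` [set (x, y)])).
  split; first by left.
  by move=> /(_ (x, y)) s; apply: (Gy x); apply: s; right.
split.
- by move=> p [/GAB//|->].
- move=> x1 y1 y2 [G1|/pair_equal_spec[-> ->]] [G2|/pair_equal_spec[e1 e2]]; rewrite ?e2 //.
  + exact: Gf G1 G2.
  + by move: G1; rewrite e1 => /Gx.
  + by case: (Gx _ G2).
- move=> x1 x2 y1 [G1|/pair_equal_spec[-> ->]] [G2|/pair_equal_spec[e1 e2]]; rewrite ?e1 //.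
  + exact: Gi G1 G2.
  + by move: G1; rewrite e2 => /Gy.
  + by case: (Gy _ G2).
Qed.

(** Zorn's lemma for graphs [G] of injections of $D\times\omega$ into $D$, where $D$ is [dom G], a
    subset of [A]. A maximal $D$ misses only finitely many points of [A]: an infinite sequence
    outside it could be added together with its own pairing function. *)
Lemma card_setM_nat T (A : set T) : infinite_set A -> A `*` [set: nat] #<= A.
Proof.
move=> Ainf.
pose dom (G : set (T * nat * T)) := [set x | exists n y, G (x, n, y)].
pose P (G : set (T * nat * T)) := [/\ dom G `<=` A,
  (forall x n y, G (x, n, y) -> dom G y),
  (forall x n, dom G x -> exists y, G (x, n, y)) &
  (forall x n x' n' y, G (x, n, y) -> G (x', n', y) -> x = x' /\ n = n')].
have domS G G' : G `<=` G' -> dom G `<=` dom G'.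
  by move=> s x [n [y /s]]; exists n, y.
have [F FP totF|G [[GA Gr Gd Gi] Gmax]] := @Zorn_bigcup _ P.
  have dF G : F G -> dom G `<=` dom (\bigcup_(X in F) X).
    by move=> FG; apply: domS; exact: bigcup_sup.
  split.
  - by move=> x [n [y [G FG Gx]]]; have [s _ _ _] := FP _ FG; apply: s; exists n, y.
  - by move=> x n y [G FG Gx]; have [_ s _ _] := FP _ FG; apply: (dF _ FG); exact: s Gx.
  - move=> x n [m [y [G FG Gx]]]; have [_ _ s _] := FP _ FG.
    by have [z Gz] := s x n (ex_intro _ m (ex_intro _ y Gx)); exists z, G.
  - move=> x n x' n' y [G FG Gx] [G' FG' Gx'].
    have [s|s] := totF _ _ FG FG'.
    + by have [_ _ _ f] := FP _ FG'; apply: f Gx'; exact: s.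
    + by have [_ _ _ f] := FP _ FG; apply: f Gx _; exact: s.
have fin : finite_set (A `\` dom G).
  apply: contrapT => /infiniteP/card_le_fun[|u uA uinj]; first by exists 0.
  have {uA}uA n : A (u n) /\ ~ dom G (u n) by exact: uA.
  have {}uinj n m : u n = u m -> n = m by apply: uinj; rewrite in_setE.
  pose H := [set p | exists i (n : nat), p = (u i, n, u (pickle (i, n)))].
  have dH x : dom H x -> exists i, x = u i.
    by move=> [n [y [i [m [-> _ _]]]]]; exists i.
  have dHu i : dom H (u i) by exists 0, (u (pickle (i, 0))), i, 0.
  have dGH x : dom (G `|` H) x -> dom G x \/ dom H x.
    by move=> [n [y [g|h]]]; [left|right]; exists n, y.
  case: (Gmax (G `|` H)).
    split; first by left.
    move=> /(_ (u 0, 0, u (pickle (0, 0)))) s.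
    have [_] := uA 0; apply; exists 0, (u (pickle (0, 0))).
    by apply: s; right; exists 0, 0.
  split.
  - by move=> x /dGH[/GA//|/dH[i ->]]; have [] := uA i.
  - move=> x n y [g|[i [m [_ _ ->]]]]; first by apply: (domS G); [left|exact: Gr g].
    by apply: (domS H); [right|exact: dHu].
  - move=> x n /dGH[/(Gd _ n)[y g]|/dH[i ->]]; first by exists y; left.
    by exists (u (pickle (i, n))); right; exists i, n.
  - move=> x n x' n' y [g|[i [m [-> -> ->]]]] [g'|[i' [m' [ex en e]]]]; rewrite ?ex ?en.
    + exact: Gi g g'.
    + by have [_] := uA (pickle (i', m')); rewrite -e; case; exact: Gr g.
    + by have [_] := uA (pickle (i, m)); case; exact: Gr g'.
    + by have /(pcan_inj pickleK)[-> ->] := uinj _ _ e.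
have dinf : infinite_set (dom G).
  move=> dfin; apply: Ainf; apply: (@sub_finite_set _ _ ((A `\` dom G) `|` dom G)).
    by move=> x Ax; have [|] := pselect (dom G x); [right|left].
  by rewrite finite_setU.
have [u ud uinj] := card_le_fun ((infiniteP _).1 dinf) (ex_intro _ 0 I).
have {}uinj n m : u n = u m -> n = m by apply: uinj; rewrite in_setE.
have [x0 [n0 [y0 g0]]] : dom G !=set0 by exact: infinite_setN0.
have [v vinj] : exists v : T -> nat, forall x y,
    (A `\` dom G) x -> (A `\` dom G) y -> v x = v y -> x = y.
  have /countable_injP[v vinj] := finite_set_countable fin.
  by exists v => x y Ax Ay; apply: vinj; rewrite in_setE.
(* The even copies carry [dom G]; the finite remainder goes to copy number 1 of the terms of a
   sequence [u] in [dom G]. *)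
pose R (p : T * nat) y := (dom G p.1 /\ G (p.1, p.2.*2, y)) \/
  ((A `\` dom G) p.1 /\ G (u (pickle (v p.1, p.2)), 1, y)).
apply: (@card_le_rel _ _ _ _ R).
  move=> [x n] [/= Ax _].
  have [dx|dx] := pselect (dom G x).
    by have [y g] := Gd x n.*2 dx; exists y; [apply: GA; exact: Gr g|left].
  have [y g] := Gd (u (pickle (v x, n))) 1 (ud _ I).
  by exists y; [apply: GA; exact: Gr g|right].
move=> [x n] [x' n'] y _ _ _ [[/= d g]|[/= d g]] [[/= d' g']|[/= d' g']].
- by have [-> /double_inj->] := Gi _ _ _ _ _ g g'.
- by have [_ e] := Gi _ _ _ _ _ g g'; lia.
- by have [_ e] := Gi _ _ _ _ _ g g'; lia.
- have [/uinj/(pcan_inj pickleK)[e ->] _] := Gi _ _ _ _ _ g g'.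
  by rewrite (vinj _ _ d d' e).
Qed.

Lemma card_le_bigcup T U (F : nat -> set T) (C : set U) :
  infinite_set C -> (forall n, F n #<= C) -> \bigcup_n F n #<= C.
Proof.
move=> Cinf FC; apply: card_le_trans (card_setM_nat Cinf).
have /choice[f fP] n : exists R : T -> U -> Prop,
    (forall x, F n x -> exists2 y, C y & R x y) /\
    (forall x x' y, F n x -> F n x' -> R x y -> R x' y -> x = x').
  have [F0|F0] := pselect (F n !=set0); last first.
    exists (fun _ _ => False); split=> [x Fx|x x' y Fx]; by case: F0; exists x.
  have [f fF finj] := card_le_fun (FC n) F0.
  exists (fun x y => y = f x); split=> [x /fF|x x' y Fx Fx' ->]; first by exists (f x).
  by apply: finj; rewrite in_setE.
apply: (@card_le_rel _ _ _ _ (fun x p => F p.2 x /\ f p.2 x p.1)).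
  move=> x [n _ Fx]; have [+ _] := fP n => /(_ _ Fx)[y Cy fxy].
  by exists (y, n).
move=> x x' [y n] _ _ _ /= [Fx r] [Fx' r']; have [_] := fP n.
exact: (fun h => h _ _ _ Fx Fx' r r').
Qed.

Lemma card_le_setU T U (A B : set T) (C : set U) :
  infinite_set C -> A #<= C -> B #<= C -> A `|` B #<= C.
Proof.
move=> Cinf AC BC; rewrite -bigcup2E; apply: card_le_bigcup => // n.
by case: n => [|[|n]] //=.
Qed.

(** The larger of the two sets bounds the union if it is infinite; if it is finite, so is the
    union. *)
Lemma not_card_le_setU T U (A B : set T) (K : set U) : infinite_set K ->
  ~ (K #<= A) -> ~ (K #<= B) -> ~ (K #<= A `|` B).
Proof.
move=> Kinf; wlog: A B / A #<= B => [hw|AB] KA KB.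
  have [AB|BA] := card_le_total A B; first exact: hw.
  by rewrite setUC; apply: hw.
have [Bfin|Binf] := pselect (finite_set B).
  move=> /card_le_finite/(_ _)/Kinf; apply.
  by rewrite finite_setU; split=> //; exact: card_le_finite Bfin.
by move=> /card_le_trans/(_ (card_le_setU Binf AB (card_lexx _))).
Qed.

Lemma not_card_le_bigcup_lt T U (F : nat -> set T) (K : set U) n : infinite_set K ->
  (forall i, (i < n)%N -> ~ (K #<= F i)) -> ~ (K #<= \bigcup_(i in `I_n) F i).
Proof.
move=> Kinf; elim: n => [|n IH] KF.
  rewrite II0 bigcup_set0 => /card_le_finite/(_ (finite_set0 _)).
  exact: Kinf.
rewrite IIS bigcup_setU bigcup_set1; apply: not_card_le_setU => //; last exact: KF.
by apply: IH => i ni; apply: KF; exact: ltnW.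
Qed.

(** * Tukey morphisms and sums of relations *)

(** Proof irrelevance makes the transport along a proof of [i = i] trivial, for any index type. *)
Lemma existT_inj (I : Type) (P : I -> Type) (i : I) (x y : P i) :
  existT P i x = existT P i y -> x = y.
Proof.
have gen (s t : {i & P i}) : s = t ->
    exists p : projT1 s = projT1 t, eq_rect _ P (projT2 s) _ p = projT2 t.
  by move=> ->; exists erefl.
move=> /gen[/= p <-].
by rewrite (Prop_irrelevance p erefl).
Qed.

(** A bound is sought for each [a] separately, and choice recovers [phi]. Having an element of
    [tminus B] at hand during this search absorbs the convention for an empty first entry. *)
Lemma tukey_geP A B : tukey_ge A B <->
  exists psi : tminus B -> tminus A, forall a, tminus B ->
    exists b', forall b, tpred (psi b) a -> tpred b b'.
Proof.
split=> [[B0|[psi [phi psiphi]]]|[psi psiP]].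
- by exists (fun b => False_rect _ (B0 b)) => a b; case: (B0 b).
- by exists psi => a _; exists (phi a) => b; exact: psiphi.
- have [[b0]|B0] := pselect (inhabited (tminus B)); last by left => b; apply: B0.
  have /choice[phi phiP] a : exists b', forall b, tpred (psi b) a -> tpred b b'.
    exact: psiP.
  by right; exists psi, phi => b a; exact: phiP.
Qed.

Lemma tukey_ge_refl A : tukey_ge A A.
Proof. by right; exists id, id. Qed.

Lemma tukey_ge_trans B A C : tukey_ge A B -> tukey_ge B C -> tukey_ge A C.
Proof.
move=> [B0|[f [g fg]]] [C0|[f' [g' fg']]]; try by left.
- by left=> c; apply: B0; exact: f' c.
- by right; exists (f \o f'), (g' \o g) => c a /fg/fg'.
Qed.

Lemma tukey_eq_refl A : tukey_eq A A.
Proof. by split; exact: tukey_ge_refl. Qed.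

Lemma tukey_eq_sym A B : tukey_eq A B -> tukey_eq B A.
Proof. by case. Qed.

Lemma tukey_eq_trans B A C : tukey_eq A B -> tukey_eq B C -> tukey_eq A C.
Proof.
by move=> [? ?] [? ?]; split; exact: (@tukey_ge_trans B).
Qed.

Lemma tukey_class_eq A B : tukey_eq A B -> tukey_class A = tukey_class B.
Proof.
move=> AB; apply/funext => C; apply/propext; split.
  by apply: tukey_eq_trans; exact: tukey_eq_sym.
exact: tukey_eq_trans.
Qed.

Lemma trel_sum_predE I (A : I -> trel) i (a : tminus (A i)) (a' : tplus (A i)) :
  @tpred (trel_sum A) (existT _ i a) (existT _ i a') <-> tpred a a'.
Proof.
split=> [[j [b [b' [e e' r]]]]|h]; last by exists i, a, a'.
have /= ij : i = j := f_equal (@projT1 _ _) e.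
move: b b' e e' r; rewrite -{}ij => b b'.
by move=> /(@existT_inj _ (fun i => tminus (A i)))<- /(@existT_inj _ (fun i => tplus (A i)))<-.
Qed.

Lemma trel_sum_pred_idx I (A : I -> trel) (x : tminus (trel_sum A)) (y : tplus (trel_sum A)) :
  tpred x y -> projT1 x = projT1 y.
Proof. by move=> [i [a [a' [-> ->]]]]. Qed.

(** Injectivity of [h] determines the component into which [phi] must send a bound. Over an index
    that [psi] never reaches nothing is asked, and the last hypothesis supplies an arbitrary
    value. *)
Lemma trel_sum_ge I J (A : I -> trel) (B : J -> trel) (h : J -> I) :
  injective h -> (forall j, tukey_ge (A (h j)) (B j)) ->
  (forall j, inhabited (tplus (B j))) ->
  tukey_ge (trel_sum A) (trel_sum B).
Proof.
move=> hinj AB B0; apply/tukey_geP.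
pose psi j := projT1 (cid ((tukey_geP _ _).1 (AB j))).
have psiP j : forall a, tminus (B j) ->
    exists b', forall b, tpred (psi j b) a -> tpred b b'.
  by rewrite /psi; case: cid.
exists (fun b => existT _ (h (projT1 b)) (psi _ (projT2 b))).
move=> [i a] [j0 b0].
have [[j [e b1]]|nex] := pselect (exists j, h j = i /\ inhabited (tminus (B j))).
  case: b1 => b1; case: _ / e a => a.
  have [b' b'P] := psiP j a b1.
  exists (existT _ j b') => -[j' b] r.
  have e : j' = j by exact: hinj (trel_sum_pred_idx r).
  by subst j'; move: r => /trel_sum_predE/b'P ?; exact/trel_sum_predE.
have [b'] := B0 j0; exists (existT _ j0 b') => -[j b] /trel_sum_pred_idx/= e.
by case: nex; exists j; split=> //; exists.
Qed.

Lemma trel_sum_eq I J (A : I -> trel) (B : J -> trel) (h : J -> I) :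
  bijective h -> (forall j, tukey_eq (A (h j)) (B j)) ->
  (forall j, inhabited (tplus (B j))) -> (forall i, inhabited (tplus (A i))) ->
  tukey_eq (trel_sum A) (trel_sum B).
Proof.
move=> [g hg gh] AB B0 A0; split.
  by apply: (trel_sum_ge (can_inj hg)) => // j; have [] := AB j.
by apply: (trel_sum_ge (can_inj gh)) => // i; have [_] := AB (g i); rewrite gh.
Qed.

(** Turns the products with $(\lambda,=)$ into sums, to which the comparison of sums by components
    applies. *)
Lemma trel_prod_eqE A I : tukey_eq (A * trel_eq I)%trel (trel_sum (fun _ : I => A)).
Proof.
split; right.
  exists (fun x => (projT2 x, projT1 x)), 
    (fun y => existT (fun=> tplus A) y.2 y.1).
  by move=> [i a] [a' i'] [/= r e]; case: _ / e; exact/trel_sum_predE.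
exists (fun x => existT (fun=> tminus A) x.2 x.1), (fun y => (projT2 y, projT1 y)).
move=> [a i] [i' a'] /= /[dup]/trel_sum_pred_idx/= e.
by case: _ / e => /trel_sum_predE.
Qed.

Definition either I J T (f : I -> T) (g : J -> T) (x : I + J) : T :=
  match x with inl i => f i | inr j => g j end.

Lemma trel_add_sumE I J (A : I -> trel) (B : J -> trel) :
  tukey_eq (trel_sum A + trel_sum B)%trel (trel_sum (either A B)).
Proof.
pose to1 (x : tminus (trel_sum A) + tminus (trel_sum B)) : tminus (trel_sum (either A B)) :=
  match x with
  | inl a => existT (fun i => tminus (either A B i)) (inl (projT1 a)) (projT2 a)
  | inr a => existT (fun i => tminus (either A B i)) (inr (projT1 a)) (projT2 a)
  end.
pose to2 (x : tplus (trel_sum A) + tplus (trel_sum B)) : tplus (trel_sum (either A B)) :=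
  match x with
  | inl a => existT (fun i => tplus (either A B i)) (inl (projT1 a)) (projT2 a)
  | inr a => existT (fun i => tplus (either A B i)) (inr (projT1 a)) (projT2 a)
  end.
have to1s x : exists y, to1 y = x.
  by case: x => -[i|j] a; [exists (inl (existT _ i a))|exists (inr (existT _ j a))].
have to2s x : exists y, to2 y = x.
  by case: x => -[i|j] a; [exists (inl (existT _ i a))|exists (inr (existT _ j a))].
have toP x y : tpred (to1 x) (to2 y) <-> @tpred (trel_sum A + trel_sum B)%trel x y.
  case: x => -[i a]; case: y => -[j b] /=; split => //.
  - move=> r; have /= [e] := trel_sum_pred_idx r; subst j.
    have r' := (@trel_sum_predE _ (either A B) (inl i) a b).1 r.
    exact: (@trel_sum_predE _ A i a b).2 r'.
  - move=> r; have /= e := @trel_sum_pred_idx _ A _ _ r; subst j.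
    have r' := (@trel_sum_predE _ A i a b).1 r.
    exact: (@trel_sum_predE _ (either A B) (inl i) a b).2 r'.
  - by move=> r; have := trel_sum_pred_idx r.
  - by move=> r; have := trel_sum_pred_idx r.
  - move=> r; have /= [e] := trel_sum_pred_idx r; subst j.
    have r' := (@trel_sum_predE _ (either A B) (inr i) a b).1 r.
    exact: (@trel_sum_predE _ B i a b).2 r'.
  - move=> r; have /= e := @trel_sum_pred_idx _ B _ _ r; subst j.
    have r' := (@trel_sum_predE _ B i a b).1 r.
    exact: (@trel_sum_predE _ (either A B) (inr i) a b).2 r'.
have /choice[f1 f1K] := to1s; have /choice[f2 f2K] := to2s.
split; right.
  by exists f1, to2 => b a r; rewrite -[b]f1K; exact/toP.
by exists to1, f2 => b a r; apply/toP; rewrite f2K.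
Qed.

Lemma tukey_ge_add A B A' B' :
  (tminus A' -> inhabited (tplus A')) -> (tminus B' -> inhabited (tplus B')) ->
  tukey_ge A A' -> tukey_ge B B' -> tukey_ge (A + B)%trel (A' + B')%trel.
Proof.
move=> gA gB /tukey_geP[f fP] /tukey_geP[g gP]; apply/tukey_geP.
exists (fun x => match x with inl a => inl (f a) | inr b => inr (g b) end).
have dflt : (tminus A' + tminus B')%type -> exists y : tplus A' + tplus B', True.
  by move=> [/gA[x]|/gB[x]]; [exists (inl x)|exists (inr x)].
move=> [a|b] xy.
- have [[a0]|n0] := pselect (inhabited (tminus A')).
    by have [a' a'P] := fP a a0; exists (inl a') => -[x|x] //=; exact: a'P.
  by have [y _] := dflt xy; exists y => -[x|x] //=; case: n0.
- have [[a0]|n0] := pselect (inhabited (tminus B')).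
    by have [a' a'P] := gP b a0; exists (inr a') => -[x|x] //=; exact: a'P.
  by have [y _] := dflt xy; exists y => -[x|x] //=; case: n0.
Qed.

Lemma tukey_eq_add A B A' B' :
  (tminus A -> inhabited (tplus A)) -> (tminus B -> inhabited (tplus B)) ->
  (tminus A' -> inhabited (tplus A')) -> (tminus B' -> inhabited (tplus B')) ->
  tukey_eq A A' -> tukey_eq B B' -> tukey_eq (A + B)%trel (A' + B')%trel.
Proof. by move=> ? ? ? ? [? ?] [? ?]; split; exact: tukey_ge_add. Qed.

(* A common bound of the two images is sent by [phi] into a single component. *)
Lemma trel_sum_ge_inj I J (A : I -> trel) (B : J -> trel) :
  (forall i (x y : tminus (A i)), exists z, tpred x z /\ tpred y z) ->
  (forall psi phi, @tukey_morphism (trel_sum A) (trel_sum B) psi phi ->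
    forall b b' : tminus (trel_sum B),
    projT1 (psi b) = projT1 (psi b') -> projT1 b = projT1 b').
Proof.
move=> dir psi phi mor b b'.
have := mor b; have := mor b'.
case: (psi b) => i x; case: (psi b') => i' x' h' h /= e.
case: _ / e x' h' => x' h'.
have [z [xz x'z]] := dir i x x'.
have /h/trel_sum_pred_idx-> := (trel_sum_predE x z).2 xz.
by have /h'/trel_sum_pred_idx-> := (trel_sum_predE x' z).2 x'z.
Qed.

(** * The relations of sequences of finite sets *)

Lemma infinite_natP (S : set nat) :
  infinite_set S <-> forall K, exists2 n, (K <= n)%N & S n.
Proof.
split=> [Sinf K|SP Sfin].
  apply: contrapT => nex; apply: Sinf; apply: (sub_finite_set _ (finite_II K)).
  by move=> n Sn /=; rewrite ltnNge; apply/negP => Kn; apply: nex; exists n.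
have /finite_seqP[X SX] := Sfin.
have [n Kn Sn] := SP (\max_(i <- X) i).+1.
have : n \in X by move: Sn; rewrite SX.
by move=> /(@leq_bigmax_seq _ _ xpredT id) => /(_ isT); rewrite leqNgt Kn.
Qed.

Lemma finite_nat_bound (S : set nat) :
  finite_set S -> exists K, forall n, S n -> (n < K)%N.
Proof.
move=> Sfin; apply: contrapT => nex; move: Sfin; apply/infinite_natP => K.
have /existsNP[n /not_implyP[Sn /negP]] : ~ (forall n, S n -> (n < K)%N).
  by move=> h; apply: nex; exists K.
by rewrite -leqNgt; exists n.
Qed.

Definition fin_seqs_of (A : nat -> Type) (F : forall n, set (A n))
    (F_fin_inf : (forall n, finite_set (F n)) /\ infinite_set [set n | F n !=set0]) :
    fin_seqs A :=
  exist _ F F_fin_inf.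

Lemma fin_seqs_inhabited (A : nat -> Type) :
  infinite_set [set n | [set: A n] !=set0] -> inhabited (fin_seqs A).
Proof.
move=> Ainf.
have F n : exists S : set (A n), finite_set S /\ ([set: A n] !=set0 -> S !=set0).
  have [[a _]|?] := pselect ([set: A n] !=set0); last by exists set0.
  by exists [set a]; split=> [|_]; [exact: finite_set1|exists a].
exists; exists (fun n => projT1 (cid (F n))); split=> [n|]; first by have [] := projT2 (cid (F n)).
by apply: sub_infinite_set Ainf => n An; have [_] := projT2 (cid (F n)); exact.
Qed.

(** The termwise union is a common bound. This is the directedness that [trel_sum_ge_inj] asks of
    the components. *)
Lemma fin_seqs_common (A : nat -> Type) (x y : fin_seqs A) :
  exists z, meet_infty x z /\ meet_infty y z.
Proof.
have [fx ix] := svalP x; have [fy iy] := svalP y.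
have zP : (forall n, finite_set (sval x n `|` sval y n)) /\
    infinite_set [set n | sval x n `|` sval y n !=set0].
  split=> [n|]; first by rewrite finite_setU.
  by apply: sub_infinite_set ix => n [a ?]; exists a; left.
exists (fin_seqs_of zP); split.
  by apply: sub_infinite_set ix => n [a ?]; exists a; split=> //; left.
by apply: sub_infinite_set iy => n [a ?]; exists a; split=> //; right.
Qed.

(** Sets are pushed forward along injections of [B n] into [A (m n)] and bounds are pulled back.
    Because [n <= m n], only finitely many [n] land on a given index, so the images stay finite, and
    they occupy infinitely many indices. *)
Lemma trelQ_ge (A B : nat -> Type) (m : nat -> nat) (N : nat) :
  (forall n, (n <= m n)%N) ->
  (forall n, (N <= n)%N -> [set: B n] #<= [set: A (m n)]) ->
  tukey_ge (trelQ A) (trelQ B).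
Proof.
move=> mge BA.
pose h n (p : (N <= n)%N) := projT1 (cid ((card_leTT _ _).1 (BA n p))).
have hinj n p : injective (@h n p) by rewrite /h; case: cid.
pose im (F : forall n, set (B n)) n : set {j & A j} :=
  [set s | exists (p : (N <= n)%N) b, F n b /\ s = existT A (m n) (h n p b)].
pose psi (F : forall n, set (B n)) j : set (A j) :=
  [set y | exists n, im F n (existT A j y)].
have psi_fin F : (forall n, finite_set (F n)) -> forall j, finite_set (psi F j).
  move=> Ffin j; apply: (@card_le_finite _ _ _ (\bigcup_(n in `I_j.+1) im F n)).
    apply: (@card_le_rel _ _ _ _ (fun y s => s = existT A j y)).
      move=> y [n imy]; exists (existT A j y) => //; exists n => //.
      have [p [b [_ e]]] := imy.
      have -> : j = m n := congr1 (@projT1 nat A) e.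
      by rewrite /= ltnS.
    by move=> y y' s _ _ _ -> /(@existT_inj nat A).
  apply: bigcup_finite; first exact: finite_II.
  move=> n _; have [p|np] := pselect (N <= n)%N; last first.
    by apply: (sub_finite_set _ (finite_set0 _)) => s [p].
  apply: (sub_finite_set _ (finite_image (fun b => existT A (m n) (h n p b)) (Ffin n))).
  move=> s [p' [b [Fb ->]]]; exists b => //.
  by rewrite (Prop_irrelevance p p').
have psi_inf F : infinite_set [set n | F n !=set0] ->
    infinite_set [set j | psi F j !=set0].
  move=> /infinite_natP Finf; apply/infinite_natP => K.
  have [n + [b Fb]] := Finf (maxn K N); rewrite geq_max => /andP[Kn Nn].
  exists (m n); first by apply: leq_trans Kn _; exact: mge.
  by exists (h n Nn b), n, Nn, b.
apply/tukey_geP.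
exists (fun F : fin_seqs B => fin_seqs_of
   (conj (psi_fin _ (svalP F).1) (psi_inf _ (svalP F).2))).
move=> G F0.
pose phi n : set (B n) := [set b | exists p : (N <= n)%N, sval G (m n) (h n p b)].
have phi_fin n : finite_set (phi n).
  apply: (@card_le_finite _ _ _ (sval G (m n))); last exact: (svalP G).1.
  apply: (@card_le_rel _ _ _ _ (fun b y => exists p, y = h n p b)).
    by move=> b [p Gb]; exists (h n p b) => //; exists p.
  by move=> b b' y _ _ _ [p ->] [p']; rewrite (Prop_irrelevance p p') => /hinj.
have phiP (F : fin_seqs B) : infinite_set [set n | psi (sval F) n `&` sval G n !=set0] ->
    infinite_set [set n | sval F n `&` phi n !=set0].
  move=> /infinite_natP meet; apply/infinite_natP => K.
  (* An index [j = m n] beyond all [m i] with [i < K] can only come from some [n >= K]. *)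
  have [j jK [y [[n [p [b [Fb e]]]] Gy]]] := meet (\max_(i < K) m i).+1.
  have ej : j = m n := congr1 (@projT1 nat A) e.
  exists n.
    rewrite leqNgt; apply/negP => nK.
    have := leq_bigmax (F := fun i : 'I_K => m i) (Ordinal nK).
    by rewrite leqNgt /= -ej jK.
  exists b; split=> //; exists p.
  have : (fun s : {j & A j} => sval G (projT1 s) (projT2 s)) (existT A j y) by [].
  by rewrite e.
(* If the pulled-back sequence is almost everywhere empty, no image meets [G] infinitely often and
   any value will do. *)
have [phi_inf|phi_nin] := pselect (infinite_set [set n | phi n !=set0]); last first.
  exists F0 => F /phiP h'; case: phi_nin; apply: sub_infinite_set h'.
  by move=> n [b [_ ?]]; exists b.
by exists (fin_seqs_of (conj phi_fin phi_inf)) => F /phiP.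
Qed.

Lemma trelQ_geP (A : nat -> Type) (K : Type) :
  (forall N, exists2 n, (N <= n)%N & [set: K] #<= [set: A n]) ->
  tukey_ge (trelQ A) (trelP K).
Proof.
move=> AK; have /choice[m mP] n : exists m, (n <= m)%N /\ [set: K] #<= [set: A m].
  by have [m ? ?] := AK n; exists m.
by apply: (@trelQ_ge _ _ m 0) => n; [have [] := mP n|move=> _; have [] := mP n].
Qed.

Lemma trelQ_Pge (A : nat -> Type) (K : Type) (N : nat) :
  (forall n, (N <= n)%N -> [set: A n] #<= [set: K]) ->
  tukey_ge (trelP K) (trelQ A).
Proof. by move=> AK; exact: (@trelQ_ge (fun=> K) A id N). Qed.

(** The whole sets [A n] with [n >= N] form one sequence that meets every element infinitely often.
    Such a universal bound puts the relation below type 1, represented by [trelP unit]. *)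
Lemma trelQ_finite (A : nat -> Type) (N : nat) :
  (forall n, (N <= n)%N -> finite_set [set: A n]) ->
  tukey_ge (trelP unit) (trelQ A).
Proof.
move=> Afin; apply/tukey_geP.
have psi_fin (F : fin_seqs A) : (forall n, finite_set [set _ : unit | sval F n !=set0]) /\
    infinite_set [set n | [set _ : unit | sval F n !=set0] !=set0].
  split=> [n|]; first exact: finite_finset.
  by apply: sub_infinite_set (svalP F).2 => n F0; exists tt.
exists (fun F => fin_seqs_of (psi_fin F)) => G0 F0.
pose G n : set (A n) := [set _ | (N <= n)%N].
have GP (F : fin_seqs A) : infinite_set [set n | sval F n `&` G n !=set0].
  apply/infinite_natP => K; have /infinite_natP Finf := (svalP F).2.
  have [n + [b Fb]] := Finf (maxn K N); rewrite geq_max => /andP[Kn Nn].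
  by exists n => //; exists b.
have Gfin : (forall n, finite_set (G n)) /\ infinite_set [set n | G n !=set0].
  split=> [n|].
    have [Nn|Nn] := pselect (N <= n)%N; first exact: sub_finite_set (Afin _ Nn).
    by apply: sub_finite_set (finite_set0 _) => x /Nn.
  by apply: sub_infinite_set (GP F0) => n [b [_ ?]]; exists b.
by exists (fin_seqs_of Gfin) => F _; exact: GP.
Qed.

(** In [trelP unit] the constant sequence [u] meets every element, so only the index of a component
    matters. *)
Lemma trel_eq_sumE J : tukey_eq (trel_eq J) (trel_sum (fun _ : J => trelP unit)).
Proof.
have uP : (forall n : nat, finite_set [set: unit]) /\
    infinite_set [set n : nat | [set: unit] !=set0].
  split=> [n|]; first exact: finite_finset.
  by apply/infinite_natP => K; exists K => //; exists tt.
pose u := fin_seqs_of uP.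
split; right.
  exists (fun x => projT1 x), (fun j => existT _ j u) => -[i F] j /= ij.
  subst j; apply: (@trel_sum_predE _ (fun=> trelP unit) i F u).2.
  by apply: sub_infinite_set (svalP F).2 => n [b ?]; exists b.
exists (fun j => existT _ j u), (fun x => projT1 x) => j [i F].
by move=> /trel_sum_pred_idx/=.
Qed.

(* A partial function [f] with infinite domain is replaced by the total function
   sending [n] to [f d], for some [d >= n] in the domain; a bound [g n] for it is
   among the values of [g] up to [d], and so is available at [d]. *)
Lemma trel_le_inftyE : tukey_eq trel_le_infty (trelP nat).
Proof.
split; apply/tukey_geP.
  have /choice[psi psiP] (F : fin_seqs (fun=> nat)) : exists f : nat -> nat,
      forall n, exists2 d, (n <= d)%N & sval F d (f n).
    have /infinite_natP Finf := (svalP F).2.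
    have /choice[f fP] n : exists v, exists2 d, (n <= d)%N & sval F d v.
      by have [d nd [v Fv]] := Finf n; exists v, d.
    by exists f.
  exists psi => g _.
  have GP : (forall n, finite_set `I_(\max_(i < n.+1) g i).+1) /\
      infinite_set [set n | `I_(\max_(i < n.+1) g i).+1 !=set0].
    split=> [n|]; first exact: finite_II.
    by apply/infinite_natP => K; exists K => //; exists 0.
  exists (fin_seqs_of GP) => F /infinite_natP r; apply/infinite_natP => K.
  have [n Kn /= fg] := r K; have [d nd Fd] := psiP F n.
  exists d; first exact: leq_trans nd.
  exists (psi F n); split => //=; rewrite ltnS; apply: (leq_trans fg).
  have nd' : (n < d.+1)%N by [].
  exact: (leq_bigmax (F := fun i : 'I_d.+1 => g i) (Ordinal nd')).
have psiP (f : nat -> nat) : (forall n, finite_set [set f n]) /\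
    infinite_set [set n | [set f n] !=set0].
  split=> [n|]; first exact: finite_set1.
  by apply/infinite_natP => K; exists K => //; exists (f K).
exists (fun f => fin_seqs_of (psiP f)) => G _.
have /choice[g gP] n := finite_nat_bound ((svalP G).1 n).
exists g => f; apply: sub_infinite_set => n [_ [/= -> Gf]].
by apply: ltnW; exact: gP.
Qed.

(** * Convergent sequences and local types *)

Lemma omega_succ_ltSS m n : ((Some m : omega_succ) < (Some n : omega_succ))%O = (m < n)%N.
Proof.
rewrite /Order.lt /= ltn_neqAle; congr (_ && _).
by rewrite eq_sym; congr (~~ _); apply/eqP/eqP => [[->]//|->].
Qed.

Lemma omega_succ_ltN (x : omega_succ) : ((None : omega_succ) < x)%O = false.
Proof. by case: x. Qed.

Lemma omega_succ_nbhs_Some n (U : set (order_topology omega_succ)) :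
  U (Some n) -> nbhs (Some n : order_topology omega_succ) U.
Proof.
move=> Un; rewrite itv_nbhsE; case: n Un => [|n] Un.
  exists `]-oo, (Some 1 : omega_succ)[%O; first by split.
  move=> -[k|] /=; rewrite in_itv /=; last by rewrite omega_succ_ltN.
  by rewrite omega_succ_ltSS ltnS leqn0 => /eqP ->.
exists `](Some n : omega_succ), (Some n.+2 : omega_succ)[%O.
  by split => //; rewrite in_itv /= !omega_succ_ltSS !ltnS !leqnn.
move=> -[k|] /=; rewrite in_itv /= ?omega_succ_ltN ?andbF// !omega_succ_ltSS !ltnS.
by rewrite -eqn_leq => /eqP <-.
Qed.

Lemma omega_succ_nbhs_None (U : set (order_topology omega_succ)) :
  nbhs (None : order_topology omega_succ) U <->
  U None /\ exists K, forall n, (K <= n)%N -> U (Some n).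
Proof.
split=> [nU|[UN [K UK]]].
  split; first exact: (nbhs_singleton nU).
  move: nU; rewrite itv_nbhsE => -[[l r] [lr]].
  rewrite itv_boundlr => /andP[lN Nr] sU.
  have [K KP] : exists K, forall n, (K <= n)%N -> (l <= BLeft (Some n : omega_succ))%O.
    move: lr lN; clear; case: l => [b [k|]|[]] //; last by exists 0.
      move=> _ _; exists k.+1 => n kn.
      by case: b; rewrite bnd_simp ?[(_ <= _)%O]ltnW // omega_succ_ltSS.
    by case: b => //; case: r => [[] ?|[]].
  exists K => n Kn; apply: sU; rewrite /= itv_boundlr KP //=.
  by case: r Nr {lr} => [[] [k|]|[]].
rewrite itv_nbhsE; exists `](Some K : omega_succ), +oo[%O.
  by split => //; rewrite in_itv.
by move=> -[n|] //=; rewrite in_itv /= andbT => /andP[_ /= Kn]; exact: UK.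
Qed.

Section ConvergentSequences.
Variable X : topologicalType.
Hypothesis X2 : hausdorff_space X.
Implicit Types (x y p : X) (U V S : set X).

Lemma hausdorff_finite_closed (A : set X) : finite_set A -> closed A.
Proof.
exact: (@accessible_finite_set_closed X).1 (hausdorff_accessible X2) A.
Qed.

Lemma hausdorff_nbhs_setC (A : set X) x : finite_set A -> ~ A x -> nbhs x (~` A).
Proof.
move=> Afin Ax; apply: open_nbhs_nbhs; split; last exact: Ax.
by apply: closed_openC; exact: hausdorff_finite_closed.
Qed.

Lemma hausdorff_sep x y : x <> y ->
  exists U V, [/\ nbhs x U, nbhs y V & forall z, U z -> V z -> False].
Proof.
move=> xy; have := X2; rewrite open_hausdorff => /(_ x y).
case=> [|[U V] /= [xU yV] [oU oV /eqP UV0]]; first exact/eqP.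
exists U, V; split.
- by apply: open_nbhs_nbhs; split=> //; exact: set_mem.
- by apply: open_nbhs_nbhs; split=> //; exact: set_mem.
- by move=> z Uz Vz; have : (U `&` V) z by []; rewrite UV0.
Qed.

Lemma embedding_cvg (e : order_topology omega_succ -> X) U : is_embedding e ->
  nbhs (e None) U -> exists K, forall n, (K <= n)%N -> U (e (Some n)).
Proof.
move=> [_ eopen] /nbhs_interior nU.
have /nbhs_singleton Ue := nU.
have oU : open (e @^-1` U°) by apply/eopen; exists U° => //; exact: open_interior.
have /omega_succ_nbhs_None[_ [K KP]] :
    nbhs (None : order_topology omega_succ) (e @^-1` U°).
  by apply: open_nbhs_nbhs; split.
by exists K => n /KP/interior_subset.
Qed.

Lemma embedding_isolated (e : order_topology omega_succ -> X) n : is_embedding e ->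
  exists2 V, nbhs (e (Some n)) V & forall o, V (e o) -> o = Some n.
Proof.
move=> [_ eopen].
have : open ([set Some n] : set (order_topology omega_succ)).
  by rewrite openE => _ ->; exact: omega_succ_nbhs_Some.
move=> /eopen[V oV eV]; exists V; last by move=> o Vo; have : (e @^-1` V) o by []; rewrite eV.
by apply: open_nbhs_nbhs; split=> //; have : (e @^-1` V) (Some n) by rewrite eV.
Qed.

(** A closure point missing from the trace of [S] cannot be one of the terms, which are isolated in
    the range; so it is the limit. Removing finitely many terms does not affect the closure at the
    limit, hence infinitely many terms lie in [S]. *)
Lemma not_closed_in_range (e : order_topology omega_succ -> X) S : is_embedding e ->
  not_closed_in S (range e) <->
  ~ S (e None) /\ infinite_set [set n | S (e (Some n))].
Proof.
move=> emb; split=> [|[SN /infinite_natP Sinf] cl]; last first.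
  suff : (S `&` range e) (e None) by case.
  apply: cl => W; have Te : range e (e None) by exists None.
  move=> /(nbhs_subspace_ex _ Te)[V nV WV].
  have [K KP] := embedding_cvg emb nV.
  have [n Kn Sn] := Sinf K.
  have : (V `&` range e) (e (Some n)) by split; [exact: KP|exists (Some n)].
  by rewrite -WV => -[We ?]; exists (e (Some n)).
move=> ncl; have [p [clp Dp]] : exists p : X,
    @closure (subspace (range e)) (S `&` range e) p /\ ~ (S `&` range e) p.
  by have /existsNP[p /not_implyP[clp Dp]] := ncl; exists p.
(* The topology of [subspace] makes the points outside the given set isolated, so they add nothing
   to the closure. *)
have Tp : range e p.
  apply: contrapT => Tp; apply: Dp.
  have [|q [Dq <-] //] := clp [set p].
  by have := @nbhs_subspace_out _ (range e) p Tp; rewrite /nbhs /= => <-.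
have Sp : ~ S p by move=> Sp; exact: Dp.
have clp' U : nbhs p U -> exists o, U (e o) /\ S (e o).
  move=> nU; have [|q [qST Uq]] := clp U.
    by apply: (nbhs_subspace_ex U Tp).2; exists U.
  by have [Sq [ o _ eo]] := qST; exists o; rewrite eo.
case: Tp => -[n|] _ ep.
  have [V nV Vn] := embedding_isolated n emb.
  have [|o [/Vn -> /=]] := clp' V; first by rewrite -ep.
  by rewrite ep.
rewrite ep; split=> //; apply/infinite_natP => K.
have [|o [Uo So]] := clp' (~` [set e (Some n) | n in `I_K]).
  apply: hausdorff_nbhs_setC; first exact/finite_image/finite_II.
  by move=> [n _]; rewrite -ep => /emb.1.
case: o Uo So => [n|]; last by rewrite ep.
move=> Un Sn; exists n => //; rewrite leqNgt; apply/negP => nK.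
by apply: Un; exists n.
Qed.

Definition seq_emb (u : nat -> X) x (o : order_topology omega_succ) : X :=
  if o is Some n then u n else x.

Lemma seq_emb_embedding (u : nat -> X) x :
  injective u -> (forall n, u n <> x) ->
  (forall U, nbhs x U -> exists K, forall n, (K <= n)%N -> U (u n)) ->
  is_embedding (seq_emb u x).
Proof.
move=> uinj ux ucvg; set e := seq_emb u x.
have einj : injective e.
  by move=> [m|] [n|] //= => [/uinj ->|/ux|/esym/ux].
split=> // U; split; last first.
  move=> [V oV <-]; rewrite openE => -[n|] Vo; first exact: omega_succ_nbhs_Some.
  apply/omega_succ_nbhs_None; split=> //.
  by apply: (ucvg V); apply: open_nbhs_nbhs.
(* The image of the complement of [U] is closed: it is finite if [U] contains the limit, and
   otherwise it is part of a convergent sequence together with the limit. *)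
move=> oU; exists (~` (e @` (~` U))); last first.
  apply/seteqP; split=> o /=; first by move=> h; apply: contrapT => Uo; apply: h; exists o.
  by move=> Uo [ o' Uo' /einj eo]; apply: Uo'; rewrite eo.
apply: closed_openC; have [UN|UN] := pselect (U None).
  apply: hausdorff_finite_closed; apply: finite_image.
  have /omega_succ_nbhs_None[_ [K KP]] : nbhs (None : order_topology omega_succ) U.
    by apply: open_nbhs_nbhs.
  apply: (sub_finite_set _ (finite_image Some (finite_II K))) => -[n|] Un //.
  exists n => //=; rewrite ltnNge; apply/negP => Kn; exact/Un/KP.
move=> p clp; apply: contrapT => np.
have xp : x <> p by move=> xp; apply: np; exists None.
have [Wx [Wp [nWx nWp dis]]] := hausdorff_sep xp.
have [K KP] := ucvg _ nWx.
pose A := (e @` (~` U)) `&` (u @` `I_K).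
have nA : nbhs p (~` A).
  apply: hausdorff_nbhs_setC; last by case.
  exact/finite_setIr/finite_image/finite_II.
have [q [[ o Uo eo] [Wpq Aq]]] := clp _ (filterI nWp nA).
case: o Uo eo => [n|] Un en.
  have [nK|Kn] := ltnP n K.
    by apply: Aq; split; [exists (Some n)|exists n].
  by apply: (dis q) => //; rewrite -en; exact: KP.
by apply: (dis q) => //; rewrite -en; exact: nbhs_singleton.
Qed.

End ConvergentSequences.

(** * Shells around a point and the decomposition of seq(X) into local relations *)

Definition countable_base (X : topologicalType) (B : nat -> set X) : Prop :=
  (forall k, open (B k)) /\
  (forall x U, nbhs x U -> exists2 k, B k x & B k `<=` U).

(** The implication stands for [B m] if [x] lies in it and for the whole space otherwise, so this is
    the intersection of the [B m] around [x] with [m < n]. *)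
Fixpoint base_nbhs (X : Type) (B : nat -> set X) (x : X) (n : nat) : set X :=
  if n is m.+1 then base_nbhs B x m `&` [set y | B m x -> B m y] else setT.

Definition shell (X : Type) (B : nat -> set X) (x : X) (n : nat) : set X :=
  base_nbhs B x n `\` base_nbhs B x n.+1.

Definition accumulation (X : Type) (B : nat -> set X) (x : X) : Prop :=
  forall n, exists2 y, base_nbhs B x n y & y <> x.

Definition shells (X : Type) (B : nat -> set X) (x : X) (n : nat) : Type :=
  set_type (shell B x n).

Section Shells.
Variables (X : topologicalType) (B : nat -> set X).
Hypotheses (X2 : hausdorff_space X) (Bbase : countable_base B).
Implicit Types (x y : X) (S : set X).
Local Notation V := (base_nbhs B).

Lemma base_nbhs_self x n : V x n x.
Proof. by elim: n => [|n IH] /=. Qed.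

Lemma base_nbhs_open x n : open (V x n).
Proof.
elim: n => [|n IH]; first exact: openT.
apply: openI => //; have [Bx|Bx] := pselect (B n x).
  have -> : [set y | B n x -> B n y] = B n.
    by apply/seteqP; split=> y //=; exact.
  exact: Bbase.1.
have -> : [set y | B n x -> B n y] = setT by apply/seteqP; split=> y //= _ /Bx.
exact: openT.
Qed.

Lemma base_nbhs_nbhs x n : nbhs x (V x n).
Proof.
by apply: open_nbhs_nbhs; split; [exact: base_nbhs_open|exact: base_nbhs_self].
Qed.

Lemma base_nbhs_sub x m n : (m <= n)%N -> V x n `<=` V x m.
Proof.
elim: n => [|n IH]; first by rewrite leqn0 => /eqP ->.
by rewrite leq_eqVlt => /predU1P[->//|/IH nm] y [/nm].
Qed.

Lemma base_nbhs_base x U : nbhs x U -> exists n, V x n `<=` U.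
Proof.
move=> /Bbase.2[k Bx BU]; exists k.+1 => y [_ /(_ Bx)]; exact: BU.
Qed.

Lemma base_nbhs_sep x y : x <> y ->
  exists n, forall z, V x n z -> V y n z -> False.
Proof.
move=> /(hausdorff_sep X2)[U [W [/base_nbhs_base[n nU] /base_nbhs_base[m mW] UW]]].
exists (maxn n m) => z zx zy; apply: (UW z).
  by apply: nU; apply: base_nbhs_sub zx; rewrite leq_maxl.
by apply: mW; apply: base_nbhs_sub zy; rewrite leq_maxr.
Qed.

Lemma shell_disj x n m y : shell B x n y -> shell B x m y -> n = m.
Proof.
move=> [Vn nVn] [Vm nVm]; case: (ltngtP n m) => // [nm|mn].
  by case: nVn; exact: base_nbhs_sub nm _ Vm.
by case: nVm; exact: base_nbhs_sub mn _ Vn.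
Qed.

Lemma shell_neq x n y : shell B x n y -> y <> x.
Proof. by move=> [_ nV] yx; apply: nV; rewrite yx; exact: base_nbhs_self. Qed.

Lemma shell_exists x y k : V x k y -> y <> x -> exists2 n, (k <= n)%N & shell B x n y.
Proof.
move=> Vk yx; have [n nVn] : exists n, ~ V x n y.
  have [n nP] := base_nbhs_sep (nesym yx).
  by exists n => /nP; apply; exact: base_nbhs_self.
elim: n nVn => [|n IH] nVn; first by case: nVn.
have [Vn|/IH//] := pselect (V x n y).
exists n => //; rewrite leqNgt; apply/negP => nk.
by apply: nVn; exact: base_nbhs_sub nk _ Vk.
Qed.

Lemma shell_index_finite x (A : set X) : finite_set A ->
  finite_set [set n | exists2 y, A y & shell B x n y].
Proof.
apply: card_le_finite; apply: (@card_le_rel _ _ _ _ (fun n y => shell B x n y)).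
  by move=> n [y Ay sy]; exists y.
by move=> n m y _ _ _; exact: shell_disj.
Qed.

Lemma shell_index_infinite x (A : set X) :
  (forall n, exists2 y, A y /\ y <> x & V x n y) ->
  infinite_set [set n | exists2 y, A y & shell B x n y].
Proof.
move=> Acl; apply/infinite_natP => K; have [y [Ay yx] Vy] := Acl K.
by have [n Kn sy] := shell_exists Vy yx; exists n => //; exists y.
Qed.

Lemma shells_finite_union x (F : fin_seqs (shells B x)) N :
  finite_set [set y | exists n (z : shells B x n), [/\ (n < N)%N, sval F n z & y = val z]].
Proof.
apply: (@sub_finite_set _ _ (\bigcup_(n in `I_N) (val @` (sval F n : set (shells B x n))))).
  by move=> y [n [z [nN Fz ->]]]; exists n => //; exists z.
apply: bigcup_finite; first exact: finite_II.
by move=> n _; apply: finite_image; exact: (svalP F).1.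
Qed.

Lemma fin_seqs_selector x (A : set X) :
  infinite_set [set n | exists2 y, A y & shell B x n y] ->
  exists F : fin_seqs (shells B x), forall n z, sval F n z -> A (val z).
Proof.
move=> Ainf.
have H n : exists F : set (shells B x n), [/\ finite_set F,
    forall z, F z -> A (val z) &
    (exists2 y, A y & shell B x n y) -> F !=set0].
  have [[y Ay sy]|nex] := pselect (exists2 y, A y & shell B x n y); last first.
    by exists set0; split.
  exists [set SigSub (mem_set sy)]; split; first exact: finite_set1.
    by move=> _ ->.
  by move=> _; exists (SigSub (mem_set sy)).
have FP : (forall n, finite_set (projT1 (cid (H n)))) /\
    infinite_set [set n | projT1 (cid (H n)) !=set0].
  split=> [n|]; first by have [] := projT2 (cid (H n)).
  by apply: sub_infinite_set Ainf => n An; have [_ _] := projT2 (cid (H n)); exact.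
exists (fin_seqs_of FP) => n z /=.
by have [_ FA _] := projT2 (cid (H n)); exact: FA.
Qed.

(** The points listed by [G] are infinitely many, but finitely many on each shell. Hence they are
    countable and each neighbourhood of [x] omits finitely many of them, so any injective
    enumeration converges to [x]. *)
Lemma fin_seqs_range x (G : fin_seqs (shells B x)) :
  exists u : nat -> X,
    [/\ injective u, is_embedding (seq_emb u x) &
      forall n z, sval G n z -> exists i, u i = val z].
Proof.
pose T0 : set X := [set y | exists n (z : shells B x n), sval G n z /\ y = val z].
have T0E : T0 = \bigcup_n (val @` (sval G n : set (shells B x n))).
  apply/seteqP; split=> y [n].
    by move=> [z [Gz ->]]; exists n => //; exists z.
  by move=> _ [z Gz <-]; exists n, z.
have T0shell y : T0 y -> exists n, shell B x n y.
  by move=> [n [z [_ ->]]]; exists n; exact: set_valP.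
have T0inf : infinite_set T0.
  move=> /(shell_index_finite x); apply: sub_infinite_set (svalP G).2.
  by move=> n [z Gz]; exists (val z); [exists n, z|exact: set_valP].
have /card_bijP[f [g fg gf]] : [set: nat] #= T0.
  apply: Cantor_Bernstein; first exact/infiniteP.
  rewrite T0E; apply: bigcup_countable => // n _.
  by apply/finite_set_countable/finite_image; exact: (svalP G).1.
pose u n := val (f (SigSub (mem_set (I : [set: nat] n)))).
have uT0 n : T0 (u n) by exact: set_valP.
have uinj : injective u.
  by move=> n m /val_inj/(can_inj fg)/(congr1 val).
have uonto y : T0 y -> exists i, u i = y.
  move=> Ty; exists (val (g (SigSub (mem_set Ty)))); rewrite /u.
  transitivity (val (f (g (SigSub (mem_set Ty))))); last by rewrite gf.
  by congr (val (f _)); exact: val_inj.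
exists u; split=> //; last by move=> n z Gz; apply: uonto; exists n, z.
apply: seq_emb_embedding => // [n|U /base_nbhs_base[N NU]].
  by have [k /shell_neq] := T0shell _ (uT0 n).
have /finite_nat_bound[K KP] : finite_set [set i | ~ V x N (u i)].
  apply: card_le_finite (shells_finite_union G N).
  apply: (@card_le_rel _ _ _ _ (fun i y => y = u i)).
    move=> i nV; exists (u i) => //; have [n [z [Gz uz]]] := uT0 i.
    exists n, z; split=> //; rewrite ltnNge; apply/negP => Nn; apply: nV.
    by rewrite uz; apply: base_nbhs_sub Nn _ _; have [] := set_valP z.
  by move=> i j y _ _ _ -> /uinj.
exists K => n Kn; apply: NU; apply: contrapT => /KP.
by rewrite ltnNge Kn.
Qed.

Definition local_sum : trel :=
  trel_sum (fun p : {x | accumulation B x} => trelQ (shells B (sval p))).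

Lemma local_sum_ge : tukey_ge local_sum (seqT X).
Proof.
(* The chosen closure point stays outside [S]; this is what later makes [S] non-closed in a sequence
   converging to it. *)
have /choice[psi psiP] (S : NC X) : exists s : tminus local_sum,
    ~ sval S (sval (projT1 s)) /\ forall n z, sval (projT2 s) n z -> sval S (val z).
  have /existsNP[x /not_implyP[clx Sx]] := svalP S.
  have clS n : exists2 y, sval S y /\ y <> x & V x n y.
    have [y [Sy Vy]] := clx _ (base_nbhs_nbhs x n).
    by exists y => //; split=> // yx; apply: Sx; rewrite -yx.
  have accx : accumulation B x by move=> n; have [y [_ yx] Vy] := clS n; exists y.
  have [F FS] := fin_seqs_selector (shell_index_infinite clS).
  by exists (existT _ (exist _ x accx) F).
apply/tukey_geP; exists psi => -[p G] _.
have [u [uinj uemb uonto]] := fin_seqs_range G.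
exists (exist _ (range (seq_emb u (sval p))) (ex_intro2 _ _ _ uemb erefl)) => S.
have [] := psiP S; case: (psi S) => q F Sq FS r.
have /= qp := trel_sum_pred_idx r; subst q.
have {}r := (@trel_sum_predE _ (fun p : {x | accumulation B x} => trelQ (shells B (sval p))) p F G).1 r.
apply/(not_closed_in_range X2 _ uemb); split=> // Sfin; apply: r.
apply: sub_finite_set (shell_index_finite (sval p) (finite_image u Sfin)).
move=> n [z [Fz Gz]]; have [i ui] := uonto _ _ Gz.
exists (val z); last exact: set_valP.
by exists i => //=; rewrite ui; exact: FS Fz.
Qed.

Lemma seqT_ge_local_sum : tukey_ge (seqT X) local_sum.
Proof.
pose psi (s : tminus local_sum) : set X :=
  [set y | exists n z, sval (projT2 s) n z /\ y = val z].
have psiP s : ~ closed (psi s).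
  case: s => p F cl; suff : psi (existT _ p F) (sval p).
    by move=> [n [z [_ /esym]]]; apply: shell_neq; exact: set_valP z.
  apply: cl => U /base_nbhs_base[N NU].
  have /infinite_natP/(_ N)[n Nn [z Fz]] := (svalP F).2.
  exists (val z); split; first by exists n, z.
  by apply: NU; apply: base_nbhs_sub Nn _ _; have [] := set_valP z.
apply/tukey_geP; exists (fun s => exist _ (psi s) (psiP s)) => -[T [e emb TE]] _.
subst T; set t := e None.
have conv := embedding_cvg emb (base_nbhs_nbhs t _).
have et n : e (Some n) <> t by move=> /emb.1.
have cle n : exists2 y, (range e) y /\ y <> t & V t n y.
  have [K KP] := conv n; exists (e (Some K)); last exact: KP.
  by split=> //; exists (Some K).
have acct : accumulation B t by move=> n; have [y [_ yt] Vy] := cle n; exists y.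
pose G n : set (shells B t n) := [set z | range e (val z)].
have GP : (forall n, finite_set (G n)) /\ infinite_set [set n | G n !=set0].
  split=> [n|]; last first.
    apply: sub_infinite_set (shell_index_infinite cle) => n [y ey sy].
    by exists (SigSub (mem_set sy)).
  have [K KP] := conv n.+1.
  apply: card_le_finite (finite_image (e \o Some) (finite_II K)).
  apply: (@card_le_rel _ _ _ _ (fun z y => y = val z)); last first.
    by move=> z z' y _ _ _ -> /val_inj.
  move=> z Gz; exists (val z) => //; have [Vz nVz] := set_valP z.
  case: Gz => -[m|] _ em; last first.
    by case: nVz; rewrite -em; exact: base_nbhs_self.
  exists m => //=; rewrite ltnNge; apply/negP => /KP.
  by rewrite em; exact: nVz.
exists (existT _ (exist _ t acct) (fin_seqs_of GP)) => -[p F] /=.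
move=> /(not_closed_in_range X2 _ emb)[psit psiinf].
have fin N : finite_set [set m | exists n (z : shells B (sval p) n),
    [/\ (n < N)%N, sval F n z & e (Some m) = val z]].
  apply: card_le_finite (shells_finite_union F N).
  apply: (@card_le_rel _ _ _ _ (fun m y => y = e (Some m))).
    by move=> m [n [z [nN Fz ez]]]; exists (e (Some m)) => //; exists n, z.
  by move=> m m' y _ _ _ -> /emb.1[].
(* If the base point of [F] and the limit [t] had disjoint neighbourhoods of order [N], the tail of
   [e] could meet [F] only on the shells before [N], that is, finitely often. *)
have pt : sval p = t.
  apply: contrapT => /base_nbhs_sep[N NP]; have [K KP] := conv N.
  apply: psiinf; apply: (@sub_finite_set _ _ (`I_K `|` _) _ _); last first.
    rewrite finite_setU; split; [exact: finite_II|exact: (fin N)].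
  move=> m [n [z [Fz ez]]]; have [mK|Km] := ltnP m K; first by left.
  right; exists n, z; split=> //; rewrite ltnNge; apply/negP => Nn.
  apply: (NP (e (Some m))); last exact: KP.
  by rewrite ez; apply: base_nbhs_sub Nn _ _; have [] := set_valP z.
have pe : p = exist _ t acct by case: p {F psit psiinf fin} pt => p acc /= pt; exact: eq_exist.
subst p; apply/(@trel_sum_predE _ (fun p : {x | accumulation B x} => trelQ (shells B (sval p)))).
move=> /finite_nat_bound[N NP]; apply: psiinf; apply: sub_finite_set (fin N).
move=> m [n [z [Fz ez]]]; exists n, z; split=> //; apply: NP.
by exists z; split=> //; exists (Some m).
Qed.

Lemma seqT_local_sum : tukey_eq (seqT X) local_sum.
Proof. by split; [exact: seqT_ge_local_sum|exact: local_sum_ge]. Qed.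

End Shells.

(** * Points with large neighbourhoods *)

Lemma finite_card_le T U (A : set T) (C : set U) :
  finite_set A -> infinite_set C -> A #<= C.
Proof.
by move=> Afin Cinf; have [//|/card_le_finite/(_ Afin)] := card_le_total A C.
Qed.

Lemma card_eq_sig T (P : T -> Prop) : [set: {x | P x}] #= [set x | P x].
Proof.
apply: Cantor_Bernstein.
  apply: (@card_le_rel _ _ _ _ (fun s x => x = sval s)).
    by move=> s _; exists (sval s) => //; exact: svalP s.
  by move=> [x Px] [y Py] z _ _ _ /= -> e; exact: eq_exist.
apply: (@card_le_rel _ _ _ _ (fun x s => x = sval s)).
  by move=> x Px; exists (exist _ x Px).
by move=> x y s _ _ _ -> ->.
Qed.

Lemma trel_sum_ge_card I J (A : I -> trel) (B : J -> trel) :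
  (forall i (x y : tminus (A i)), exists z, tpred x z /\ tpred y z) ->
  (forall j, inhabited (tminus (B j))) ->
  tukey_ge (trel_sum A) (trel_sum B) -> [set: J] #<= [set: I].
Proof.
move=> Adir B0 AB; apply/card_leTT.
have b0 j : exists b : tminus (B j), True by have [b] := B0 j; exists b.
pose b j := projT1 (cid (b0 j)).
case: AB => [J0|[psi [phi mor]]].
  by exists (fun j => False_rect _ (J0 (existT _ j (b j)))) => j; case: (J0 (existT _ j (b j))).
exists (fun j => projT1 (psi (existT _ j (b j)))) => j j' e.
exact: (trel_sum_ge_inj Adir mor e).
Qed.

Section FullPoints.
Variables (X : topologicalType) (B : nat -> set X).
Hypotheses (X2 : hausdorff_space X) (Bbase : countable_base B).
Implicit Types (x y : X).
Local Notation V := (base_nbhs B).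

(* Full points turn out to be those of type P(K); heavy points that are not full
   have type Q(K), or type 1 when K is countable. *)
Definition heavy_pts (K : Type) : set X := [set x | forall n, [set: K] #<= V x n].

Definition full_pts (K : Type) : set X :=
  [set x | forall n, exists m, [set: K] #<= V x n `\` V x m].

Lemma base_nbhs_shells x N :
  V x N = [set x] `|` \bigcup_n (if (N <= n)%N then shell B x n else set0).
Proof.
apply/seteqP; split=> y.
  have [->|yx] := pselect (y = x); first by left.
  move=> /(shell_exists X2 Bbase)/(_ yx)[n Nn sy]; right; exists n => //.
  by rewrite Nn.
move=> [->|[n _]]; first exact: base_nbhs_self.
by case: ifP => // Nn [Vy _]; exact: base_nbhs_sub Vy.
Qed.

Lemma full_pts_heavy K x : full_pts K x -> heavy_pts K x.
Proof.
move=> xf n; have [m Km] := xf n; apply: card_le_trans Km _.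
exact: card_le_setD.
Qed.

Lemma heavy_accumulation K x : infinite_set [set: K] -> heavy_pts K x -> accumulation B x.
Proof.
move=> Kinf xh n; apply: contrapT => nex; apply: Kinf.
apply: card_le_finite (xh n) _; apply: (sub_finite_set _ (finite_set1 x)) => y Vy.
by apply: contrapT => yx; apply: nex; exists y.
Qed.

(** The difference of two neighbourhoods is a finite union of shells, so one of these already has
    size [K], whatever the cofinality. *)
Lemma full_pts_shell K x N : infinite_set [set: K] -> full_pts K x ->
  exists2 n, (N <= n)%N & [set: K] #<= shell B x n.
Proof.
move=> Kinf /(_ N)[m]; apply: contraPP => nex.
have sub : V x N `\` V x m `<=`
    \bigcup_(i in `I_m) (if (N <= i)%N then shell B x i else set0).
  move=> y [VN Vm]; have yx : y <> x by move=> yx; apply: Vm; rewrite yx; exact: base_nbhs_self.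
  have [n Nn sy] := shell_exists X2 Bbase VN yx.
  exists n => /=; last by rewrite Nn.
  by rewrite ltnNge; apply/negP => mn; apply: Vm; apply: base_nbhs_sub mn _ _; case: sy.
move=> /card_le_trans/(_ (subset_card_le sub)).
apply: not_card_le_bigcup_lt => // i im; case: ifP => Ni.
  by move=> Ks; apply: nex; exists i.
by move=> /card_le_finite/(_ (finite_set0 _)).
Qed.

Lemma shells_leP (T : Type) (A : set T) x n : (shell B x n #<= A) = ([set: shells B x n] #<= A).
Proof. by rewrite /shells (card_le_eql (card_setT _)). Qed.

Lemma shells_geP (T : Type) (A : set T) x n : (A #<= shell B x n) = (A #<= [set: shells B x n]).
Proof. by rewrite /shells (card_le_eqr (card_setT _)). Qed.

Lemma accumulation_inhabited x : accumulation B x -> inhabited (fin_seqs (shells B x)).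
Proof.
move=> accx; apply: fin_seqs_inhabited.
have := @shell_index_infinite _ _ X2 Bbase x setT.
move=> h; apply: sub_infinite_set (h _) => [n [y _ sy]|n].
  by exists (SigSub (mem_set sy)).
by have [y Vy yx] := accx n; exists y.
Qed.

(** Otherwise a neighbourhood would be [x] together with countably many shells of size at most
    [L]. *)
Lemma shell_infinitely_large (L : Type) x : infinite_set [set: L] ->
  (forall n, ~ (V x n #<= [set: L])) ->
  forall N, exists2 n, (N <= n)%N & [set: L] #<= shell B x n.
Proof.
move=> Linf Vx N; apply: contrapT => nex; apply: (Vx N).
rewrite base_nbhs_shells; apply: card_le_setU => //.
  by apply: finite_card_le => //; exact: finite_set1.
apply: card_le_bigcup => // n; case: ifP => // Nn.
by have [//|Ln] := card_le_total (shell B x n) [set: L]; case: nex; exists n.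
Qed.

(** Such points are covered by the basic open sets of size at most [L], and these are countably
    many. *)
Lemma light_pts_le (L : Type) : infinite_set [set: L] ->
  [set x | exists n, V x n #<= [set: L]] #<= [set: L].
Proof.
move=> Linf; pose F k := if pselect (B k #<= [set: L]) then B k else set0.
have FL k : F k #<= [set: L] by rewrite /F; case: pselect.
apply: card_le_trans (subset_card_le _) (card_le_bigcup Linf FL).
move=> x [n VL]; have [k Bx BV] := Bbase.2 _ _ (base_nbhs_nbhs Bbase x n).
exists k => //; rewrite /F; case: pselect => //; case.
exact: card_le_trans (subset_card_le BV) VL.
Qed.

(** There are at most [K] components, and all shells have size at most [K], so each component is
    below $P(K)$. This makes $P(K)\times(K,=)$ the top type for size [K]. *)
Lemma sum_trelP_ge_seqT (K : Type) : [set: X] #<= [set: K] ->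
  tukey_ge (trel_sum (fun _ : K => trelP K)) (seqT X).
Proof.
move=> XK; apply: tukey_ge_trans (local_sum_ge X2 Bbase).
have /card_leTT[h hinj] := XK.
apply: (@trel_sum_ge _ _ (fun=> trelP K) _ (fun p => h (sval p))).
- by move=> [x ax] [y ay] /hinj /= xy; exact: eq_exist.
- move=> p; apply: (@trelQ_Pge _ _ 0) => n _; rewrite -shells_leP.
  exact: card_le_trans (card_leT _) XK.
- by move=> [x ax]; exact: accumulation_inhabited.
Qed.

Lemma seqT_full (K : Type) : infinite_set [set: K] -> [set: X] #<= [set: K] ->
  [set: K] #<= full_pts K -> tukey_eq (seqT X) (trelP K * trel_eq K)%trel.
Proof.
move=> Kinf XK Kfull.
apply: (@tukey_eq_trans (trel_sum (fun _ : K => trelP K))); last exact/tukey_eq_sym/trel_prod_eqE.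
split; last exact: sum_trelP_ge_seqT.
apply: tukey_ge_trans (seqT_ge_local_sum X2 Bbase) _.
have [h hfull hinj] := card_le_fun Kfull (infinite_setN0 Kinf).
have hacc k : accumulation B (h k).
  by apply: (heavy_accumulation Kinf); apply: full_pts_heavy; exact: hfull.
apply: (@trel_sum_ge _ _ _ _ (fun k => exist _ (h k) (hacc k))).
- by move=> k l [/hinj]; apply; rewrite in_setE.
- move=> k; apply: trelQ_geP => N.
  by have [n Nn Ks] := full_pts_shell N Kinf (hfull k I); exists n => //; rewrite -shells_geP.
- move=> k; apply: fin_seqs_inhabited; apply/infinite_natP => n.
  by exists n => //; exact: infinite_setN0.
Qed.

(** The points that are not heavy lie in a countable union of basic sets into which [K] does not
    inject, so [K] heavy points remain. Around a heavy [x] the punctured neighbourhood is the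
    increasing union of the differences [V x n] minus [V x m]; one of them has size [K], so [x] is
    full. *)
Lemma full_pts_regular (K : Type) : infinite_set [set: K] -> [set: K] #<= [set: X] ->
  (forall F : nat -> set X, [set: K] #<= \bigcup_n F n -> exists n, [set: K] #<= F n) ->
  [set: K] #<= full_pts K.
Proof.
move=> Kinf KX Kreg; suff hf : heavy_pts K `<=` full_pts K.
  apply: card_le_trans (subset_card_le hf); apply: contrapT => nh.
  pose F k := if pselect ([set: K] #<= B k) then set0 else B k.
  have nF : ~ ([set: K] #<= \bigcup_k F k).
    move=> /Kreg[k]; rewrite /F; case: pselect => [_|//] /=.
    by move=> /card_le_finite/(_ (finite_set0 _)).
  have := not_card_le_setU Kinf nh nF; apply.
  suff -> : heavy_pts K `|` \bigcup_k F k = setT by [].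
  apply/seteqP; split=> // x _; have [xh|/existsNP[n Kn]] := pselect (heavy_pts K x); first by left.
  right; have [k Bx BV] := Bbase.2 _ _ (base_nbhs_nbhs Bbase x n).
  exists k => //; rewrite /F; case: pselect => // KB; case: Kn.
  exact: card_le_trans KB (subset_card_le BV).
move=> x xh n; apply: Kreg; apply: contrapT => nK.
have nx : ~ ([set: K] #<= [set x]).
  by move=> /card_le_finite/(_ (finite_set1 _)).
have := not_card_le_setU Kinf nK nx; apply.
apply: card_le_trans (xh n) (subset_card_le _) => y Vy.
have [->|yx] := pselect (y = x); [by right|left].
have [m Vm] := base_nbhs_sep X2 Bbase (nesym yx).
by exists m => //; split=> // Vmy; apply: (Vm y) => //; exact: base_nbhs_self.
Qed.

End FullPoints.

(** * The type of a space whose cardinality has cofinality omega *)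

Lemma card_sumT_le I J U (C : set U) : infinite_set C ->
  [set: I] #<= C -> [set: J] #<= C -> [set: I + J] #<= C.
Proof.
move=> Cinf IC JC.
have -> : [set: I + J] = (inl @` [set: I]) `|` (inr @` [set: J]).
  by apply/seteqP; split=> // -[i|j] _; [left; exists i|right; exists j].
apply: card_le_setU => //; [apply: card_le_trans IC|apply: card_le_trans JC];
  exact: card_image_le.
Qed.

Lemma not_card_sumT_le I J U (K : set U) : infinite_set K ->
  ~ (K #<= [set: I]) -> ~ (K #<= [set: J]) -> ~ (K #<= [set: I + J]).
Proof.
move=> Kinf KI KJ.
have -> : [set: I + J] = (inl @` [set: I]) `|` (inr @` [set: J]).
  by apply/seteqP; split=> // -[i|j] _; [left; exists i|right; exists j].
apply: not_card_le_setU => // Kc; [apply: KI|apply: KJ]; apply: card_le_trans Kc _;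
  exact: card_image_le.
Qed.

Lemma card_sigT_le (F : nat -> Type) U (C : set U) : infinite_set C ->
  (forall n, [set: F n] #<= C) -> [set: {n & F n}] #<= C.
Proof.
move=> Cinf FC.
have -> : [set: {n & F n}] = \bigcup_n (existT F n @` [set: F n]).
  by apply/seteqP; split=> // -[n a] _; exists n => //; exists a.
by apply: card_le_bigcup => // n; apply: card_le_trans (FC n); exact: card_image_le.
Qed.

Lemma trelP_inhabited T : [set: T] !=set0 -> inhabited (tplus (trelP T)).
Proof.
by move=> T0; apply: fin_seqs_inhabited; apply/infinite_natP => n; exists n.
Qed.

Lemma trelP_ge (K L : Type) : [set: L] #<= [set: K] -> tukey_ge (trelP K) (trelP L).
Proof. by move=> LK; apply: (@trelQ_Pge _ _ 0). Qed.

Section Forms.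
Variables (K : Type) (Kn : nat -> Type).
Hypotheses (Kinf : infinite_set [set: K]) (Kinc : cardinals_increasing_to K Kn).

Lemma Kn_le n : [set: Kn n] #<= [set: K].
Proof. by have [_ /(_ n)[]] := Kinc. Qed.

Lemma Kn_small n : ~ ([set: K] #<= [set: Kn n]).
Proof. by have [_ /(_ n)[]] := Kinc. Qed.

Lemma Kn_mono m n : (m <= n)%N -> [set: Kn m] #<= [set: Kn n].
Proof.
elim: n => [|n IH]; first by rewrite leqn0 => /eqP ->.
rewrite leq_eqVlt => /predU1P[->//|/IH mn]; apply: card_le_trans mn _.
by have [/(_ n)[]] := Kinc.
Qed.

Lemma small_le_Kn T (A : set T) : ~ ([set: K] #<= A) -> exists n, A #<= [set: Kn n].
Proof.
move=> KA; apply: contrapT => /forallNP An; apply: KA.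
have [_ _ /(_ A)] := Kinc; rewrite (card_le_eqr (card_setT A)); apply=> n.
rewrite (card_le_eqr (card_setT A)).
by have [/An|] := card_le_total A [set: Kn n].
Qed.

Lemma Kn_neq0 n : [set: Kn n.+1] !=set0.
Proof.
have [/(_ n)[_ nle] _ _] := Kinc; apply: contrapT => /nonemptyPn e; apply: nle.
by rewrite e; exact: card_ge0.
Qed.

(** The normal form of $P(\kappa)\times I+Q(\kappa)\times J+S(\kappa)$ as a single sum; the last
    summand of the index type enumerates the components $P(\kappa_n)$ of $S(\kappa)$, each taken
    $\kappa_n$ times. *)
Definition tform (I J : Type) : (I + J) + {n & Kn n} -> trel :=
  either (either (fun=> trelP K) (fun=> trelQ Kn)) (fun s => trelP (Kn (projT1 s))).

Lemma form_inhabited I J x : inhabited (tplus (@tform I J x)).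
Proof.
case: x => [[i|j]|[n k]] /=.
- exact/trelP_inhabited/infinite_setN0.
- apply: fin_seqs_inhabited; apply/infinite_natP => n.
  by exists n.+1 => //; exact: Kn_neq0.
- by apply: trelP_inhabited; exists k.
Qed.

Lemma trelP_ge_trelQ : tukey_ge (trelP K) (trelQ Kn).
Proof. by apply: (@trelQ_Pge _ _ 0) => n _; exact: Kn_le. Qed.

Lemma trelSE : tukey_eq (trelS Kn) (trel_sum (fun s : {n & Kn n} => trelP (Kn (projT1 s)))).
Proof.
split; right.
  exists (fun x => existT (fun n => fin_seqs (fun=> Kn n) * Kn n)%type
    (projT1 (projT1 x)) (projT2 x, projT2 (projT1 x))).
  exists (fun y => existT (fun s : {n & Kn n} => fin_seqs (fun=> Kn (projT1 s)))
    (existT _ (projT1 y) (projT2 y).2) (projT2 y).1).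
  move=> [[n k] F] [n' [G k']] r; have /= e := trel_sum_pred_idx r; subst n'.
  have /= [FG kk] := (@trel_sum_predE _ (fun n => trelP (Kn n) * trel_eq (Kn n))%trel n (F, k) (G, k')).1 r.
  subst k'; exact: (@trel_sum_predE _ (fun s : {n & Kn n} => trelP (Kn (projT1 s))) (existT _ n k) F G).2.
exists (fun y => existT (fun s : {n & Kn n} => fin_seqs (fun=> Kn (projT1 s)))
    (existT _ (projT1 y) (projT2 y).2) (projT2 y).1).
exists (fun x => existT (fun n => fin_seqs (fun=> Kn n) * Kn n)%type
    (projT1 (projT1 x)) (projT2 x, projT2 (projT1 x))).
move=> [n [F k]] [[n' k'] G] r; have /= e := trel_sum_pred_idx r.
have /= en := f_equal (@projT1 _ _) e; subst n'.
have /= ek := @existT_inj _ _ _ _ _ e; subst k'.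
have FG := (@trel_sum_predE _ (fun s : {n & Kn n} => trelP (Kn (projT1 s))) (existT _ n k) F G).1 r.
exact: (@trel_sum_predE _ (fun n => trelP (Kn n) * trel_eq (Kn n))%trel n (F, k) (G, k)).2.
Qed.

Lemma formE I J :
  tukey_eq (trelP K * trel_eq I + trelQ Kn * trel_eq J + trelS Kn)%trel
    (trel_sum (@tform I J)).
Proof.
apply: (@tukey_eq_trans (trel_sum (either (fun _ : I => trelP K) (fun _ : J => trelQ Kn))
   + trel_sum (fun s : {n & Kn n} => trelP (Kn (projT1 s))))%trel); last exact: trel_add_sumE.
apply: tukey_eq_add.
- by move=> x; exists; exact: x.
- by move=> x; exists; exact: x.
- by move=> [[i|j] F]; exists; [exists (inl i)|exists (inr j)]; exact: F.
- by move=> x; exists; exact: x.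
- apply: (@tukey_eq_trans (trel_sum (fun _ : I => trelP K) +
      trel_sum (fun _ : J => trelQ Kn))%trel); last exact: trel_add_sumE.
  by apply: tukey_eq_add; do ?[by move=> x; exists; exact: x | exact: trel_prod_eqE].
- exact: trelSE.
Qed.

Lemma form_noQ_E I :
  tukey_eq (trelP K * trel_eq I + trelS Kn)%trel (trel_sum (@tform I void)).
Proof.
apply: (@tukey_eq_trans (trel_sum (fun _ : I => trelP K)
   + trel_sum (fun s : {n & Kn n} => trelP (Kn (projT1 s))))%trel).
  by apply: tukey_eq_add; do ?[by move=> x; exists; exact: x | exact: trel_prod_eqE|exact: trelSE].
apply: tukey_eq_trans (trel_add_sumE _ _) _.
have bij : bijective (fun x : (I + void) + {n & Kn n} => match x with
    inl (inl i) => inl i | inl (inr v) => match v with end | inr s => inr s end).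
  exists (fun x : I + {n & Kn n} => match x with inl i => inl (inl i) | inr s => inr s end).
    by move=> [[i|[]]|s].
  by move=> [i|s].
apply: (trel_sum_eq bij).
- by move=> [[i|[]]|s]; exact: tukey_eq_refl.
- exact: form_inhabited.
- by move=> [i|s]; [exact: (form_inhabited (inl (inl i) : (I + void) + _))
    |exact: (form_inhabited (inr s : (I + void) + _))].
Qed.

(** A component $Q(\kappa)$ may be sent to a $P(\kappa)$, which dominates it, but a $P(\kappa)$ must
    go to a $P(\kappa)$; hence the condition on [inl]. *)
Lemma form_ge I J I' J' (h : I' + J' -> I + J) : injective h ->
  (forall i', exists i, h (inl i') = inl i) ->
  tukey_ge (trel_sum (@tform I J)) (trel_sum (@tform I' J')).
Proof.
move=> hinj hI.
apply: (@trel_sum_ge _ _ _ _ (fun x : (I' + J') + {n & Kn n} => match x with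
   inl y => inl (h y) | inr s => inr s end)).
- by move=> [x|s] [y|t] // [] => [/hinj->|->].
- move=> [[i'|j']|s] /=.
  + by have [i ->] := hI i'; exact: tukey_ge_refl.
  + by case: (h _) => ?; [exact: trelP_ge_trelQ|exact: tukey_ge_refl].
  + exact: tukey_ge_refl.
- exact: form_inhabited.
Qed.

End Forms.

(** * Heavy points that are not full *)

Section HeavyPoints.
Variables (X : topologicalType) (B : nat -> set X).
Hypotheses (X2 : hausdorff_space X) (Bbase : countable_base B).
Variables (K : Type).
Hypotheses (Kinf : infinite_set [set: K]).
Implicit Types (x y : X).
Local Notation V := (base_nbhs B).
Local Notation full := (full_pts B K).
Local Notation heavy := (heavy_pts B K).

Lemma heavy_not_fullP x : (heavy `\` full) x ->
  exists N, forall m, ~ ([set: K] #<= V x N `\` V x m).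
Proof.
move=> [_ nf]; apply: contrapT => /forallNP h; apply: nf => n.
by have /existsNP[m /contrapT Km] := h n; exists m.
Qed.

(** Another heavy point near [x] would have a neighbourhood of size [K] inside [V x N] and away from
    some [V x m], so the difference of these two would have size [K]. *)
Lemma heavy_not_full_isolated x : (heavy `\` full) x ->
  exists N, forall y, V x N y -> heavy y -> y = x.
Proof.
move=> /heavy_not_fullP[N NP]; exists N => y Vy hy; apply: contrapT => yx.
have [n sep] := base_nbhs_sep X2 Bbase yx.
have [j jV] := base_nbhs_base Bbase (open_nbhs_nbhs (conj (base_nbhs_open Bbase x N) Vy)).
apply: (NP n); apply: card_le_trans (hy (maxn n j)) (subset_card_le _) => z Vz.
split; first by apply: jV; apply: base_nbhs_sub Vz; rewrite leq_maxr.
by apply: (sep z); apply: base_nbhs_sub Vz; rewrite leq_maxl.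
Qed.

(** A basic open set containing [x] and no other heavy point identifies [x]. *)
Lemma heavy_not_full_countable : countable (heavy `\` full).
Proof.
apply: (@card_le_rel _ _ _ _ (fun x k => B k x /\ forall y, B k y -> heavy y -> y = x)).
  move=> x bx; have [N NP] := heavy_not_full_isolated bx.
  have [k Bx BV] := Bbase.2 _ _ (base_nbhs_nbhs Bbase x N).
  by exists k => //; split=> // y /BV; exact: NP.
by move=> x y k [hx _] [hy _] _ [Bx kx] [By ky]; exact: ky.
Qed.

End HeavyPoints.

Section CofinalityOmega.
Variables (X : topologicalType) (B : nat -> set X).
Hypotheses (X2 : hausdorff_space X) (Bbase : countable_base B).
Variables (K : Type) (Kn : nat -> Type).
Hypotheses (Kinf : infinite_set [set: K]) (Kinc : cardinals_increasing_to K Kn).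
Hypothesis Kunc : ~ ([set: K] #<= [set: nat]).
Implicit Types (x y : X).
Local Notation V := (base_nbhs B).
Local Notation full := (full_pts B K).
Local Notation heavy := (heavy_pts B K).

(** A [Kn n] may be finite. Adding [nat] makes it infinite, as the absorption lemmas require, and
    keeps it below the uncountable [K]. *)
Lemma Kn_nat_infinite n : infinite_set [set: Kn n + nat].
Proof. by apply/infiniteP/card_leTT; exists inr => x y []. Qed.

Lemma Kn_nat_small n : ~ ([set: K] #<= [set: Kn n + nat]).
Proof. by apply: not_card_sumT_le => //; exact: (Kn_small Kinc). Qed.

Lemma Kn_le_nat n : [set: Kn n] #<= [set: Kn n + nat].
Proof. by apply/card_leTT; exists inl => x y []. Qed.

(** From below: if all shells from [k] on were at most [Kn k], then [V x k] would be smaller than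
    [K]. From above: from [N] on each shell is smaller than [K], hence bounded by some [Kn m], and
    [m] may be increased so that [trelQ_ge] applies. *)
Lemma heavy_not_full_eq x : (heavy `\` full) x ->
  tukey_eq (trelQ (shells B x)) (trelQ Kn).
Proof.
move=> bx; have [N NP] := heavy_not_fullP bx; split.
  have /choice[m mP] k : exists m, (k <= m)%N /\ [set: Kn k] #<= shell B x m.
    apply: contrapT => nex; apply: (@Kn_nat_small k); apply: card_le_trans (bx.1 k) _.
    rewrite (base_nbhs_shells X2 Bbase); apply: card_le_setU; first exact: Kn_nat_infinite.
      by apply: finite_card_le; [exact: finite_set1|exact: Kn_nat_infinite].
    apply: card_le_bigcup; first exact: Kn_nat_infinite.
    move=> n; case: ifP => // kn; apply: card_le_trans (Kn_le_nat k).
    have [//|Ks] := card_le_total (shell B x n) [set: Kn k].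
    by case: nex; exists n.
  apply: (@trelQ_ge _ _ m 0) => n; first by have [] := mP n.
  by move=> _; rewrite -shells_geP; have [] := mP n.
have /choice[m mP] n : exists m, (n <= m)%N /\ ((N <= n)%N -> shell B x n #<= [set: Kn m]).
  have [Nn|nN] := leqP N n; last by exists n.
  have [|k sk] := @small_le_Kn _ _ Kinc _ (shell B x n).
    move=> Ks; apply: (NP n.+1); apply: card_le_trans Ks (subset_card_le _).
    by move=> y [Vy nVy]; split=> //; exact: base_nbhs_sub Nn _ Vy.
  exists (maxn n k); split=> [|_]; first exact: leq_maxl.
  by apply: card_le_trans sk _; apply: (Kn_mono Kinc); exact: leq_maxr.
apply: (@trelQ_ge _ _ m N) => n; first by have [] := mP n.
by rewrite -shells_leP; have [] := mP n.
Qed.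

(** A light point lies in a basic set [B k] smaller than [K], which injects into [Kn (m k)].
    Distinct [k] are given distinct levels [m k], so the level recovers [k] and the injections
    combine into one. The shells inside [B k] obey the same bound. *)
Lemma light_upper : exists2 g : {x | ~ heavy x} -> {n & Kn n},
  injective g & forall p, tukey_ge (trelP (Kn (projT1 (g p)))) (trelQ (shells B (sval p))).
Proof.
have /choice[m' m'P] k : exists m, ~ ([set: K] #<= B k) -> B k #<= [set: Kn m].
  have [KB|/(small_le_Kn Kinc)[m Bm]] := pselect ([set: K] #<= B k); last by exists m.
  by exists 0.
(* Adding 1 to each term makes [m] strictly increasing while it still dominates [m']. *)
pose m k := \sum_(i < k.+1) (m' i).+1.
have m'm k : (m' k <= m k)%N.
  by rewrite /m big_ord_recr /=; apply: leq_trans (leq_addl _ _); exact: leqnSn.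
have mS k : (m k < m k.+1)%N.
  by rewrite /m [X in (_ < X)%N]big_ord_recr /=; rewrite -[X in (X < _)%N]addn0 ltn_add2l.
have minj : injective m.
  by apply: incn_inj; apply: leq_mono; apply: homo_ltn => //; exact: ltn_trans.
have Bm k : ~ ([set: K] #<= B k) -> B k #<= [set: Kn (m k)].
  by move=> /m'P Bm; apply: card_le_trans Bm _; exact: (Kn_mono Kinc).
(* The default value is taken in [Kn 1], as [Kn 0] may be empty. *)
have [s0 _] := Kn_neq0 Kinc 0.
have /choice[f fP] k : exists f : X -> {n & Kn n}, ~ ([set: K] #<= B k) ->
    (forall x, B k x -> projT1 (f x) = m k) /\
    (forall x y, B k x -> B k y -> f x = f y -> x = y).
  have [KB|KB] := pselect ([set: K] #<= B k); first by exists (fun=> existT _ 1 s0).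
  have [B0|B0] := pselect (B k !=set0); last first.
    by exists (fun=> existT _ 1 s0) => _; split=> [x Bx|x y Bx]; case: B0; exists x.
  have [h _ hinj] := card_le_fun (Bm _ KB) B0.
  exists (fun x => existT _ (m k) (h x)) => _; split=> // x y Bx By e.
  by apply: hinj; rewrite ?in_setE //; exact: (@existT_inj nat Kn) e.
have H (p : {x | ~ heavy x}) : exists k, B k (sval p) /\ ~ ([set: K] #<= B k).
  case: p => x /= /existsNP[n Vn].
  have [k Bx BV] := Bbase.2 _ _ (base_nbhs_nbhs Bbase x n).
  by exists k; split=> // KB; apply: Vn; exact: card_le_trans KB (subset_card_le BV).
have /choice[k kP] := H.
exists (fun p => f (k p) (sval p)).
  move=> p q e; have [Bp Kp] := kP p; have [Bq Kq] := kP q.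
  have [fp pinj] := fP _ Kp; have [fq _] := fP _ Kq.
  have kk : k p = k q by apply: minj; rewrite -(fp _ Bp) e fq.
  have : sval p = sval q by apply: pinj => //; rewrite -?kk // in Bq e *; rewrite kk.
  by case: p q {e Bp Kp Bq Kq fp pinj fq kk} => x xl [y yl] /= xy; exact: eq_exist.
move=> p; have [Bp Kp] := kP p; have [fp pinj] := fP _ Kp.
rewrite fp //; have [k0 Bk0] : exists N, V (sval p) N `<=` B (k p).
  by apply: base_nbhs_base => //; apply: open_nbhs_nbhs; split=> //; exact: Bbase.1.
apply: (@trelQ_Pge _ _ k0) => n k0n; rewrite -shells_leP.
apply: card_le_trans (Bm _ Kp); apply: subset_card_le => y [Vy _].
by apply: Bk0; exact: base_nbhs_sub k0n _ Vy.
Qed.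

(** An injection of $U\times\omega$ into the set $U$ of light points yields disjoint slices of size
    at least [K], one for each [n]. At most [Kn n + nat] points of the space have a neighbourhood of
    that size or less, so [K] points of the slice have only larger ones, and [Kn n] of them are
    chosen. *)
Lemma light_lower : [set: K] #<= ~` heavy ->
  exists2 g : {n & Kn n} -> X, injective g & forall s, ~ heavy (g s) /\
    forall i, ~ (V (g s) i #<= [set: Kn (projT1 s) + nat]).
Proof.
move=> KU; have Uinf : infinite_set (~` heavy) by apply: contra_not Kinf; exact: card_le_finite KU.
have [e eU einj] := card_le_fun (card_setM_nat Uinf)
  (ex_intro _ (projT1 (cid (infinite_setN0 Uinf)), 0) (conj (projT2 (cid (infinite_setN0 Uinf))) I)).
have {}einj u v n k : ~ heavy u -> ~ heavy v -> e (u, n) = e (v, k) -> u = v /\ n = k.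
  by move=> hu hv euv; have [-> ->] : (u, n) = (v, k) by apply: einj => //; rewrite in_setE.
have fex n : exists f : Kn n -> X, injective f /\ forall j,
    [/\ ~ heavy (f j), exists2 u, ~ heavy u & f j = e (u, n) &
     forall i, ~ (V (f j) i #<= [set: Kn n + nat])].
  pose S := [set y | exists2 u, ~ heavy u & y = e (u, n)].
  pose E := [set y | forall i, ~ (V y i #<= [set: Kn n + nat])].
  have KS : [set: K] #<= S.
    apply: card_le_trans KU _; apply: (@card_le_rel _ _ _ _ (fun u y => y = e (u, n))).
      by move=> u hu; exists (e (u, n)) => //; exists u.
    by move=> u v y hu hv _ -> /einj[].
  have KSE : [set: K] #<= S `&` E.
    apply: contrapT => nSE.
    have nL : ~ ([set: K] #<= [set x | exists i, V x i #<= [set: Kn n + nat]]).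
      move=> KL; apply: (@Kn_nat_small n); apply: card_le_trans KL _.
      by apply: light_pts_le => //; exact: Kn_nat_infinite.
    apply: (not_card_le_setU Kinf nSE nL); apply: card_le_trans KS (subset_card_le _).
    move=> y Sy; have [Ey|/existsNP[i /contrapT Vi]] := pselect (E y); first by left.
    by right; exists i.
  have /card_le_injP[f finj] := card_le_trans (Kn_le Kinc n) KSE.
  exists (fun j => val (f (SigSub (mem_set (I : [set: Kn n] j))))); split.
    by move=> j j' /val_inj/finj/(congr1 val).
  move=> j; have [[u hu yu] Ey] := set_valP (f (SigSub (mem_set (I : [set: Kn n] j)))).
  split=> //; last by exists u.
  by rewrite yu; apply: (eU (u, n)).
pose f n := projT1 (cid (fex n)).
have finj n : injective (f n) by have [] := projT2 (cid (fex n)).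
have fP n j : [/\ ~ heavy (f n j), exists2 u, ~ heavy u & f n j = e (u, n) &
     forall i, ~ (V (f n j) i #<= [set: Kn n + nat])].
  by have [_] := projT2 (cid (fex n)); exact.
exists (fun s => f (projT1 s) (projT2 s)).
  move=> [n j] [n' j'] /= ff.
  have [_ [u hu fu] _] := fP n j; have [_ [u' hu' fu'] _] := fP n' j'.
  have [_ nn] : u = u' /\ n = n' by apply: einj => //; rewrite -fu ff.
  by subst n'; rewrite (finj _ _ _ ff).
by move=> [n j]; have [] := fP n j.
Qed.

Theorem seqT_cof_omega I J : [set: X] #= [set: K] -> ~ ([set: K] #<= full) ->
  full #= [set: I] -> heavy `\` full #= [set: J] ->
  tukey_eq (seqT X) (trel_sum (@tform K Kn I J)).
Proof.
move=> /card_eqPle[XK KX] nfull /card_eqPle[fullI Ifull] /card_eqPle[bJ Jb].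
apply: (@tukey_eq_trans (local_sum B)); first exact: seqT_local_sum.
have full_heavy := @full_pts_heavy X B K.
split.
  have /card_le_injP[fI fIinj] := Ifull; have /card_le_injP[fJ fJinj] := Jb.
  have [fS fSinj fSP] : exists2 g : {n & Kn n} -> X, injective g & forall s, ~ heavy (g s) /\
    forall i, ~ (V (g s) i #<= [set: Kn (projT1 s) + nat]).
    (* The light points have size [K], because [K] injects neither into the full points nor into the
       countable set of the other heavy points. *)
    apply: light_lower; apply: contrapT => nlight.
    have nb : ~ ([set: K] #<= heavy `\` full).
      move=> Kb; apply: Kunc; apply: card_le_trans Kb _.
      exact: heavy_not_full_countable.
    apply: (not_card_le_setU Kinf (not_card_le_setU Kinf nfull nb) nlight).
    apply: card_le_trans KX (subset_card_le _) => x _.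
    have [fx|fx] := pselect (full x); first by left; left.
    by have [hx|hx] := pselect (heavy x); [left; right|right].
  pose h0 (x : (I + J) + {n & Kn n}) : X := match x with
    | inl (inl i) => val (fI (SigSub (mem_set (Logic.I : [set: I] i))))
    | inl (inr j) => val (fJ (SigSub (mem_set (Logic.I : [set: J] j))))
    | inr s => fS s end.
  have hI i : full (h0 (inl (inl i))) by exact: set_valP.
  have hJ j : (heavy `\` full) (h0 (inl (inr j))) by exact: set_valP.
  have hS s : ~ heavy (h0 (inr s)) by have [] := fSP s.
  have Sacc s n : exists2 m, (n <= m)%N & [set: Kn (projT1 s) + nat] #<= shell B (fS s) m.
    by apply: shell_infinitely_large => //; [exact: Kn_nat_infinite|exact: (fSP s).2].
  have hacc w : accumulation B (h0 w).
    move: w => [[i|j]|s].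
    - exact: (heavy_accumulation Kinf) (full_heavy _ (hI i)).
    - exact: (heavy_accumulation Kinf) (hJ j).1.
    - move=> n; have [m nm ms] := Sacc s n.
      have [y [Vy nVy]] : shell B (fS s) m !=set0.
        apply: infinite_setN0 => /(card_le_finite ms); exact: Kn_nat_infinite.
      exists y; first exact: base_nbhs_sub nm _ Vy.
      by apply: (@shell_neq _ B _ m); split.
  apply: (@trel_sum_ge _ _ _ _ (fun w => exist _ (h0 w) (hacc w))).
  - move=> w w' [] e; move: w w' e => [[i|j]|s] [[i'|j']|s'] e.
    + by move: e => /val_inj/fIinj/(congr1 val)/= ->.
    + by have := hJ j'; rewrite -e => -[_]; case; exact: hI.
    + by case: (hS s'); rewrite -e; exact: full_heavy (hI i).
    + by have := hJ j; rewrite e => -[_]; case; exact: hI.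
    + by move: e => /val_inj/fJinj/(congr1 val)/= ->.
    + by case: (hS s'); rewrite -e; exact: (hJ j).1.
    + by case: (hS s); rewrite e; exact: full_heavy (hI i').
    + by case: (hS s); rewrite e; exact: (hJ j').1.
    + by rewrite (fSinj _ _ e).
  - move=> [[i|j]|s].
    + apply: trelQ_geP => N; have [n Nn Ks] := full_pts_shell X2 Bbase N Kinf (hI i).
      by exists n => //; rewrite -shells_geP.
    + by have [] := heavy_not_full_eq (hJ j).
    + apply: trelQ_geP => N; have [n Nn Ks] := Sacc s N.
      by exists n => //; rewrite -shells_geP; exact: card_le_trans (Kn_le_nat _) Ks.
  - exact: form_inhabited.
have /card_leTT[gI gIinj] : [set: {x | full x}] #<= [set: I].
  by rewrite (card_le_eql (card_eq_sig _)).
have /card_leTT[gJ gJinj] : [set: {x | (heavy `\` full) x}] #<= [set: J].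
  by rewrite (card_le_eql (card_eq_sig _)).
have [gS gSinj gSP] := light_upper.
pose h (p : {x | accumulation B x}) : (I + J) + {n & Kn n} :=
  match pselect (full (sval p)) with
  | left f => inl (inl (gI (exist _ (sval p) f)))
  | right nf => match pselect (heavy (sval p)) with
    | left hv => inl (inr (gJ (exist _ (sval p) (conj hv nf))))
    | right nh => inr (gS (exist _ (sval p) nh))
    end
  end.
apply: (@trel_sum_ge _ _ _ _ h).
- move=> p q hpq; suff : sval p = sval q by case: p q {hpq} => x xl [y yl] /= xy; exact: eq_exist.
  move: hpq; rewrite /h.
  case: (pselect (full (sval p))) => [fp|fp]; case: (pselect (full (sval q))) => [fq|fq] //.
  + by move=> [/gIinj[]].
  + by case: pselect.
  + by case: pselect.
  + case: (pselect (heavy (sval p))) => [hp|hp]; case: (pselect (heavy (sval q))) => [hq|hq] //.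
      by move=> [/gJinj[]].
    by move=> [/gSinj[]].
- move=> p; rewrite /h; case: pselect => [fp|fp] /=.
    apply: (@trelQ_Pge _ _ 0) => n _; rewrite -shells_leP.
    exact: card_le_trans (card_leT _) XK.
  case: pselect => [hp|hp] /=; last exact: gSP (exist _ (sval p) hp).
  by have [] := heavy_not_full_eq (conj hp fp).
- by move=> [x ax]; exact: accumulation_inhabited.
Qed.

End CofinalityOmega.

(** * Countable spaces *)

Lemma nat_setT_infinite : infinite_set [set: nat].
Proof. by apply/infiniteP. Qed.

Definition cform (I J : Type) : I + J -> trel :=
  either (fun=> trelP nat) (fun=> trelP unit).

Lemma cform_inhabited I J x : inhabited (tplus (@cform I J x)).
Proof. by case: x => [i|j]; apply: trelP_inhabited; [exists 0|exists tt]. Qed.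

Lemma trelP_nat_unit : tukey_ge (trelP nat) (trelP unit).
Proof. by apply: trelP_ge; apply/card_leTT; exists (fun=> 0) => -[] []. Qed.

Lemma cform_ge I J I' J' (h : I' + J' -> I + J) : injective h ->
  (forall i', exists i, h (inl i') = inl i) ->
  tukey_ge (trel_sum (@cform I J)) (trel_sum (@cform I' J')).
Proof.
move=> hinj hI; apply: (trel_sum_ge hinj); last exact: cform_inhabited.
move=> [i'|j']; first by have [i ->] := hI i'; exact: tukey_ge_refl.
by case: (h _) => ?; [exact: trelP_nat_unit|exact: tukey_ge_refl].
Qed.

Lemma cformE I J :
  tukey_eq (trel_le_infty * trel_eq I + trel_eq J)%trel (trel_sum (@cform I J)).
Proof.
apply: (@tukey_eq_trans (trel_sum (fun _ : I => trelP nat) + trel_sum (fun _ : J => trelP unit))%trel);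
  last exact: trel_add_sumE.
apply: tukey_eq_add; do ?by move=> x; exists; exact: x.
  apply: tukey_eq_trans (trel_prod_eqE _ _) _.
  apply: (@trel_sum_eq _ _ _ _ id).
  - by exists id.
  - by move=> _; exact: trel_le_inftyE.
  - by move=> _; apply: trelP_inhabited; exists 0.
  - by move=> _; exists; exact: id.
exact: trel_eq_sumE.
Qed.

(** Diagonalization: the only element of [F] at [n] lies above all elements of [G k] at [n] for
    every [k <= n], so [F] and [G k] can meet only before [k]. *)
Lemma meet_infty_undominated (G : nat -> fin_seqs (fun=> nat)) :
  exists F : fin_seqs (fun=> nat), forall k, ~ meet_infty F (G k).
Proof.
have /choice[b bP] (p : nat * nat) : exists b, forall v, sval (G p.1) p.2 v -> (v < b)%N.
  exact: finite_nat_bound ((svalP (G p.1)).1 p.2).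
have FP : (forall n, finite_set [set \max_(k < n.+1) b (nat_of_ord k, n)]) /\
    infinite_set [set n | [set \max_(k < n.+1) b (nat_of_ord k, n)] !=set0].
  split=> [n|]; first exact: finite_set1.
  by apply/infinite_natP => n; exists n => //; exists (\max_(k < n.+1) b (nat_of_ord k, n)).
exists (fin_seqs_of FP) => k /infinite_natP/(_ k)[n kn [v [/= -> /(bP (k, n)) /=]]].
have kn' : (k < n.+1)%N by [].
by rewrite ltnNge (leq_bigmax (F := fun k : 'I_n.+1 => b (nat_of_ord k, n)) (Ordinal kn')).
Qed.

(** Some element of each component [l] must be sent to a component $P(\omega)$. Otherwise all of
    them go to components of type 1, and the values of [phi] at the countably many universal bounds
    [a j] would dominate $P(\omega)$, against the diagonal argument. Distinct [l] use distinct
    components by directedness. *)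
Lemma cform_ge_sum_le I J L : countable [set: J] ->
  tukey_ge (trel_sum (@cform I J)) (trel_sum (fun _ : L => trelP nat)) ->
  [set: L] #<= [set: I].
Proof.
move=> /card_leTT[c cinj] IJL.
have [F0] : inhabited (fin_seqs (fun=> nat)) by apply: trelP_inhabited; exists 0.
case: IJL => [L0|[psi [phi mor]]].
  by apply/card_leTT; exists (fun l => False_rect _ (L0 (existT _ l F0))) => l; case: (L0 (existT _ l F0)).
have UP : (forall n : nat, finite_set [set: unit]) /\
    infinite_set [set n : nat | [set: unit] !=set0].
  split=> [n|]; first exact: finite_finset.
  by apply/infinite_natP => n; exists n => //; exists tt.
pose a j : tplus (trel_sum (@cform I J)) :=
  existT (fun x => tplus (@cform I J x)) (inr j) (fin_seqs_of UP).
have inI l : exists F i, projT1 (psi (existT _ l F)) = inl i.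
  apply: contrapT => nex.
  have /choice[G GP] k : exists G : fin_seqs (fun=> nat), forall j, c j = k ->
      G = projT2 (phi (a j)).
    have [[j cj]|nj] := pselect (exists j, c j = k); last by exists F0 => j cj; case: nj; exists j.
    by exists (projT2 (phi (a j))) => j'; rewrite -cj => /cinj ->.
  have [F Fbad] := meet_infty_undominated G.
  have nexF : ~ exists i, projT1 (psi (existT (fun=> tminus (trelP nat)) l F)) = inl i.
    by move=> [i e]; apply: nex; exists F, i.
  have := mor (existT _ l F); case: (psi _) nexF => -[i U nex' _|j U _ morF].
    by apply: nex'; exists i.
  have UU : @tpred (trel_sum (@cform I J)) (existT _ (inr j) U) (a j).
    apply: (@trel_sum_predE _ (@cform I J) (inr j) U (fin_seqs_of UP)).2.
    by apply: sub_infinite_set (svalP U).2 => n [u ?]; exists u.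
  have := morF _ UU; have := GP (c j) j erefl; have := Fbad (c j).
  case: (phi (a j)) => l' G' nm GG r; apply: nm; rewrite GG /=.
  have /= e := trel_sum_pred_idx r; subst l'.
  exact: (@trel_sum_predE _ (fun _ : L => trelP nat) l F G').1 r.
apply: (@card_le_rel _ _ _ _ (fun l i => exists F, projT1 (psi (existT _ l F)) = inl i)).
  by move=> l _; have [F [i e]] := inI l; exists i => //; exists F.
move=> l l' i _ _ _ [F e] [F' e'].
apply: (@trel_sum_ge_inj _ _ _ _ _ _ _ mor (existT _ l F) (existT _ l' F')).
  by move=> [i1|j1] x y; exact: fin_seqs_common.
by rewrite e e'.
Qed.

Lemma cform_ge_card I J I' J' :
  tukey_ge (trel_sum (@cform I J)) (trel_sum (@cform I' J')) ->
  [set: I' + J'] #<= [set: I + J].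
Proof.
apply: trel_sum_ge_card; first by move=> [i|j] x y; exact: fin_seqs_common.
by move=> x; have := cform_inhabited x; case: x.
Qed.

Section CountableSpace.
Variables (X : topologicalType) (B : nat -> set X).
Hypotheses (X2 : hausdorff_space X) (Bbase : countable_base B).
Hypothesis Xcount : [set: X] #<= [set: nat].
Local Notation V := (base_nbhs B).
Local Notation full := (full_pts B nat).
Local Notation heavy := (heavy_pts B nat).

(** An accumulation point meets infinitely many shells inside any neighbourhood. Hence a countable
    space has no light accumulation points and its type has no analogue of $S(\kappa)$. *)
Lemma accumulation_heavy x : accumulation B x -> heavy x.
Proof.
move=> accx n; apply/infiniteP => Vfin.
have := @shell_index_infinite _ _ X2 Bbase x (V x n); apply; last first.
  exact: shell_index_finite.
move=> k; have [y Vy yx] := accx (maxn n k); exists y.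
  by split=> //; apply: base_nbhs_sub Vy; exact: leq_maxl.
by apply: base_nbhs_sub Vy; exact: leq_maxr.
Qed.

(** Here the shells are finite from some index on, so a single sequence bounds everything. *)
Lemma heavy_not_full_unit x : (heavy `\` full) x ->
  tukey_eq (trelQ (shells B x)) (trelP unit).
Proof.
move=> bx; split.
  apply: trelQ_geP => N.
  have accx := heavy_accumulation nat_setT_infinite bx.1.
  have [y Vy yx] := accx N; have [n Nn sy] := shell_exists X2 Bbase Vy yx.
  exists n => //; rewrite -shells_geP.
  by apply: (@card_le_rel _ _ _ _ (fun _ z => z = y)) => [u _|[] []//]; exists y.
have [N NP] := heavy_not_fullP bx; apply: (@trelQ_finite _ N) => n Nn.
rewrite /shells (eq_finite_set (card_setT _)); apply/finite_setPn => Ks.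
apply: (NP n.+1); apply: card_le_trans Ks (subset_card_le _).
by move=> y [Vy nVy]; split=> //; exact: base_nbhs_sub Nn _ Vy.
Qed.

Theorem seqT_countable I J : full #= [set: I] -> heavy `\` full #= [set: J] ->
  tukey_eq (seqT X) (trel_sum (@cform I J)).
Proof.
move=> /card_eqPle[fullI Ifull] /card_eqPle[bJ Jb].
apply: (@tukey_eq_trans (local_sum B)); first exact: seqT_local_sum.
have full_heavy := @full_pts_heavy X B nat.
have natinf := nat_setT_infinite.
split.
  have /card_le_injP[fI fIinj] := Ifull; have /card_le_injP[fJ fJinj] := Jb.
  pose h0 (w : I + J) : X := match w with
    | inl i => val (fI (SigSub (mem_set (Logic.I : [set: I] i))))
    | inr j => val (fJ (SigSub (mem_set (Logic.I : [set: J] j)))) end.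
  have hI i : full (h0 (inl i)) by exact: set_valP.
  have hJ j : (heavy `\` full) (h0 (inr j)) by exact: set_valP.
  have hacc w : accumulation B (h0 w).
    apply: (heavy_accumulation natinf); move: w => [i|j].
      exact: full_heavy (hI i).
    exact: (hJ j).1.
  apply: (@trel_sum_ge _ _ _ _ (fun w => exist _ (h0 w) (hacc w))).
  - move=> w w' [] e; move: w w' e => [i|j] [i'|j'] e.
    + by move: e => /val_inj/fIinj/(congr1 val)/= ->.
    + by have := hJ j'; rewrite -e => -[_]; case; exact: hI.
    + by have := hJ j; rewrite e => -[_]; case; exact: hI.
    + by move: e => /val_inj/fJinj/(congr1 val)/= ->.
  - move=> [i|j].
    + apply: trelQ_geP => N; have [n Nn Ks] := full_pts_shell X2 Bbase N natinf (hI i).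
      by exists n => //; rewrite -shells_geP.
    + by have [] := heavy_not_full_unit (hJ j).
  - exact: cform_inhabited.
have /card_leTT[gI gIinj] : [set: {x | full x}] #<= [set: I].
  by rewrite (card_le_eql (card_eq_sig _)).
have /card_leTT[gJ gJinj] : [set: {x | (heavy `\` full) x}] #<= [set: J].
  by rewrite (card_le_eql (card_eq_sig _)).
pose h (p : {x | accumulation B x}) : I + J :=
  match pselect (full (sval p)) with
  | left f => inl (gI (exist _ (sval p) f))
  | right nf => inr (gJ (exist _ (sval p) (conj (accumulation_heavy (svalP p)) nf)))
  end.
apply: (@trel_sum_ge _ _ _ _ h).
- move=> p q hpq; suff : sval p = sval q by case: p q {hpq} => x xl [y yl] /= xy; exact: eq_exist.
  move: hpq; rewrite /h.
  case: (pselect (full (sval p))) => [fp|fp]; case: (pselect (full (sval q))) => [fq|fq] //.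
  + by move=> [/gIinj[]].
  + by move=> [/gJinj[]].
- move=> p; rewrite /h; case: pselect => [fp|fp] /=.
    apply: (@trelQ_Pge _ _ 0) => n _; rewrite -shells_leP.
    exact: card_le_trans (card_leT _) Xcount.
  by have [] := heavy_not_full_unit (conj (accumulation_heavy (svalP p)) fp).
- by move=> [x ax]; exact: accumulation_inhabited.
Qed.

End CountableSpace.

(** * Countable index sets and the order of Delta *)

Lemma countable_omega_card T (A : set T) : countable A ->
  exists m, A #= [set: omega_card m].
Proof.
have [[n An]|Ainf] := pselect (finite_set A); last first.
  by exists None; apply: Cantor_Bernstein => //; exact/infiniteP.
by exists (Some n); apply: card_eq_trans An card_II.
Qed.

Lemma omega_card_countable m : countable [set: omega_card m].
Proof.
case: m => [n|] /=; last exact: card_lexx.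
by apply/card_leTT; exists (@nat_of_ord n); exact: ord_inj.
Qed.

(** Places the $\lambda$ indices and then the $\mu$ indices consecutively on an initial segment of
    the naturals of length $\lambda+\mu$. It serves to compare pairs in [Delta] and later to label
    branches. *)
Definition delta_pos (p : Delta) (x : 'I_p.1 + omega_card p.2) : nat :=
  match x with
  | inl i => i
  | inr j => p.1 + match p.2 as m return omega_card m -> nat with
                   | Some k => @nat_of_ord k | None => id end j
  end.

Lemma delta_pos_inj p : injective (@delta_pos p).
Proof.
case: p => l [m|] /= [i|j] [i'|j'] /= e.
- by congr inl; exact: ord_inj.
- by have := ltn_ord i; rewrite e /= ltnNge leq_addr.
- by have := ltn_ord i'; rewrite -e /= ltnNge leq_addr.
- by congr inr; apply: ord_inj; apply: (@addnI l).
- by congr inl; exact: ord_inj.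
- by have := ltn_ord i; rewrite e /= ltnNge leq_addr.
- by have := ltn_ord i'; rewrite -e /= ltnNge leq_addr.
- by congr inr; apply: (@addnI l).
Qed.

Lemma delta_pos_range p n :
  (exists x, @delta_pos p x = n) <-> (Some n.+1 <= omega_add p.1 p.2 :> omega_succ)%O.
Proof.
case: p => l m; split=> [[x <-]|].
  case: m x => [m|] // [i|j] /=.
    by apply: (@leq_trans l); [exact: ltn_ord|exact: leq_addr].
  by rewrite -addnS; apply: leq_add => //; exact: ltn_ord.
case: (ltnP n l) => [nl _|ln]; first by exists (inl (Ordinal nl)).
case: m => [m|] /=; last by exists (inr (n - l)); rewrite /= subnKC.
move=> nlm; have nm : (n - l < m)%N by rewrite ltn_subLR.
by exists (inr (Ordinal nm)); rewrite /= subnKC.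
Qed.

(** [Some n.+1 <= x] says that [n] is an element of the ordinal [x], so the order is read as
    inclusion. *)
Lemma omega_succ_leP (x y : omega_succ) :
  (x <= y)%O <-> forall n, (Some n.+1 <= x :> omega_succ)%O -> (Some n.+1 <= y :> omega_succ)%O.
Proof.
split=> [xy n nx|h]; first exact: Order.POrderTheory.le_trans xy.
case: y h => [y|] h; last by case: x {h}.
case: x h => [[|x]|] h //; first by apply: (h x); rewrite Order.POrderTheory.lexx.
by have := h y isT; rewrite /Order.le /= ltnn.
Qed.

(** Indices with the same position are matched: the second inequality puts one initial segment
    inside the other, the first keeps the leading block inside the leading block. *)
Lemma Delta_ge_inj p q : Delta_ge p q ->
  exists2 h : 'I_q.1 + omega_card q.2 -> 'I_p.1 + omega_card p.2,
    injective h & forall i', exists i, h (inl i') = inl i.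
Proof.
move=> [qp /omega_succ_leP le].
have /choice[h hP] (x : 'I_q.1 + omega_card q.2) : exists y, @delta_pos p y = delta_pos x.
  by apply/delta_pos_range/le/delta_pos_range; exists x.
exists h => [x y hxy|i']; first by apply: delta_pos_inj; rewrite -!hP hxy.
case e : (h (inl i')) => [i|j]; first by exists i.
have := hP (inl i'); rewrite e /= => e'.
by have := leq_trans (ltn_ord i') qp; rewrite -e' ltnNge leq_addr.
Qed.

Lemma card_leI_ord m n : ([set: 'I_m] #<= [set: 'I_n]) = (m <= n)%N.
Proof. by rewrite -card_le_II (card_le_eql card_II) (card_le_eqr card_II). Qed.

Lemma delta_pos_card p n : (Some n <= omega_add p.1 p.2 :> omega_succ)%O <->
  [set: 'I_n] #<= [set: 'I_p.1 + omega_card p.2].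
Proof.
split=> [np|].
  have /choice[h hP] (i : 'I_n) : exists y, @delta_pos p y = i.
    apply/delta_pos_range; apply: Order.POrderTheory.le_trans np; exact: ltn_ord.
  by apply/card_leTT; exists h => i j hij; apply: ord_inj; rewrite -!hP hij.
case: p => l [m|] //= h; suff : [set: 'I_n] #<= [set: 'I_(l + m)] by rewrite card_leI_ord.
apply: card_le_trans h _; apply/card_leTT; exists (@unsplit l m).
exact: can_inj (@unsplitK l m).
Qed.

(** Conversely, counting the components $P(\omega)$ gives the inequality for $\lambda$, and counting
    all components gives the one for $\lambda+\mu$. *)
Lemma Delta_geP p q : Delta_ge p q <->
  tukey_ge (trel_sum (@cform 'I_p.1 (omega_card p.2)))
    (trel_sum (@cform 'I_q.1 (omega_card q.2))).
Proof.
split=> [/Delta_ge_inj[h hinj hI]|pq]; first exact: cform_ge hI.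
split.
  rewrite -card_leI_ord; apply: cform_ge_sum_le (omega_card_countable p.2) _.
  apply: tukey_ge_trans pq _.
  apply: (@trel_sum_ge _ _ (@cform 'I_q.1 (omega_card q.2)) _ inl) => [i j []//|i|i].
    exact: tukey_ge_refl.
  by apply: trelP_inhabited; exists 0.
apply/omega_succ_leP => n /delta_pos_card nq; apply/delta_pos_card.
exact: card_le_trans nq (cform_ge_card pq).
Qed.

(** * Existence of spaces *)

Import Order.TTheory GRing.Theory Num.Theory.

Lemma natSinv_lt (R : realType) (e : R) : (0 < e)%R -> exists n, (n.+1%:R^-1 < e)%R.
Proof.
by move=> e0; have [N _ /(_ N)/(_ (leqnn _)) ?] := near_infty_natSinv_lt (PosNum e0); exists N.
Qed.

Lemma natSinv_gt0 (R : realType) n : (0 < n.+1%:R^-1 :> R)%R.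
Proof. by rewrite invr_gt0 ltr0n. Qed.

Lemma metric_nbhsP (R : realType) (Y : metricType R) (y : Y) U :
  nbhs y U <-> exists n, forall z, (mdist y z < n.+1%:R^-1 :> R)%R -> U z.
Proof.
split=> [/nbhs_ballP[e /= e0 yU]|[n yU]].
  have [n ne] := natSinv_lt e0; exists n => z yz; apply: yU.
  by rewrite ballEmdist /=; exact: lt_trans ne.
apply/nbhs_ballP; exists (n.+1%:R^-1)%R; first exact: natSinv_gt0.
by move=> z; rewrite ballEmdist; exact: yU.
Qed.

Section SeparableMetrizable.
Variables (R : realType) (X : topologicalType).

Lemma metrizable_hausdorff : metrizable R X -> hausdorff_space X.
Proof.
move=> [Y [f [g [fK gK fcont gcont]]]] p q pq; apply: (can_inj fK).
apply: metric_hausdorff => A C /fcont nA /fcont nC.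
by have [z [Az Cz]] := pq _ _ nA nC; exists (f z).
Qed.

Lemma sep_metrizable_base : separable X -> metrizable R X ->
  exists B : nat -> set X, countable_base B.
Proof.
move=> [D /countable_injP[i iinj] Ddense] [Y [f [g [fK gK fcont gcont]]]].
pose C (a n : nat) : set X := [set x | exists d, [/\ D d, i d = a &
  (mdist (f d) (f x) < n.+1%:R^-1 :> R)%R]].
have Copen a n : open (C a n).
  rewrite openE => x [d [Dd da dx]].
  have e0 : (0 < n.+1%:R^-1 - mdist (f d) (f x) :> R)%R by rewrite subr_gt0.
  have [m me] := natSinv_lt e0.
  have xn : nbhs x (f @^-1` [set z | (mdist (f x) z < m.+1%:R^-1 :> R)%R]).
    by apply: fcont; apply/metric_nbhsP; exists m.
  apply: filterS xn => z /= xz; exists d; split=> //.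
  apply: (le_lt_trans (metric_triangle (f d) (f x) (f z))).
  by rewrite -ltrBrDl; exact: lt_trans me.
exists (fun k => if unpickle k is Some (a, n) then C a n else set0); split.
  by move=> k; case: unpickle => [[a n]|]; [exact: Copen|exact: open0].
move=> x U xU; have : nbhs (f x) (g @^-1` U) by apply: gcont; rewrite fK.
move=> /metric_nbhsP[n nU].
pose e : R := (n.+1%:R^-1 / 2)%R.
have [m me] : exists m, (m.+1%:R^-1 < e)%R.
  by apply: natSinv_lt; rewrite divr_gt0 ?natSinv_gt0.
pose W := f @^-1` [set z | (mdist (f x) z < m.+1%:R^-1 :> R)%R].
have xW : nbhs x W by apply: fcont; apply/metric_nbhsP; exists m.
have [d [/interior_subset xd Dd]] : W° `&` D !=set0.
  apply: Ddense; last exact: open_interior.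
  by exists x; apply: nbhs_singleton; exact: nbhs_interior.
exists (pickle (i d, m)); rewrite pickleK.
  by exists d; split=> //; rewrite metric_sym.
move=> y [d' [Dd' dd' dy]].
have {}dd' : d' = d by apply: iinj; rewrite ?in_setE.
subst d'; have : (g @^-1` U) (f y); last by rewrite /= fK.
apply: nU; apply: (le_lt_trans (metric_triangle (f x) (f d) (f y))).
rewrite [ltRHS]splitr; apply: ltrD; exact: lt_trans me.
Qed.

End SeparableMetrizable.

(* [T] seen through [c] as a subspace of the Baire space. *)
Definition seq_space (R : realType) (T : Type) (c : T -> nat -> nat)
  (cinj : injective c) : Type := T.

Section SequenceSpace.
Variables (R : realType) (T : Type) (c : T -> nat -> nat).
Hypothesis cinj : injective c.

Local Notation S := (seq_space R cinj).

HB.instance Definition _ := gen_eqMixin S.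
HB.instance Definition _ := gen_choiceMixin S.

Definition agree (n : nat) (x y : T) : Prop := forall i, (i < n)%N -> c x i = c y i.

Definition first_diff (x y : T) (n : nat) : Prop := agree n x y /\ c x n <> c y n.

Lemma first_diff_exists x y : x <> y -> exists n, first_diff x y n.
Proof.
move=> xy; have [n cn] : exists n, c x n != c y n.
  apply: contrapT => /forallNP h; apply/xy/cinj/funext => n.
  by have /negP := h n; rewrite negbK => /eqP.
have ex : exists n, c x n != c y n by exists n.
exists (ex_minn ex); case: ex_minnP => m cm mmin; split; last exact/eqP.
by move=> i im; apply/eqP; apply: contraTT im => /mmin; rewrite -leqNgt.
Qed.

Definition seq_dist (x y : T) : R :=
  if pselect (x = y) is right xy then ((projT1 (cid (first_diff_exists xy))).+1%:R^-1)%R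
  else 0%R.

Lemma seq_distP x y n : (seq_dist x y <= n.+1%:R^-1)%R <-> agree n x y.
Proof.
rewrite /seq_dist; case: pselect => [->|xy]; first by split=> // _; exact/ltW/natSinv_gt0.
case: cid => d [ag nd] /=; rewrite lef_pV2 ?posrE ?ltr0n // ler_nat ltnS.
split=> [nd'|agn]; first by move=> i im; apply: ag; exact: leq_trans nd'.
by rewrite leqNgt; apply/negP => dn; apply: nd; exact: agn.
Qed.

Lemma seq_dist_ge0 x y : (0 <= seq_dist x y)%R.
Proof. by rewrite /seq_dist; case: pselect => // xy; exact/ltW/natSinv_gt0. Qed.

Lemma seq_distxx x : seq_dist x x = 0%R.
Proof. by rewrite /seq_dist; case: pselect. Qed.

Lemma seq_dist_eq0 x y : seq_dist x y = 0%R -> x = y.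
Proof.
rewrite /seq_dist; case: pselect => // xy e.
by have := natSinv_gt0 R (projT1 (cid (first_diff_exists xy))); rewrite e ltxx.
Qed.

Lemma first_diff_dist x y n : first_diff x y n -> seq_dist x y = (n.+1%:R^-1)%R.
Proof.
move=> [ag nd]; rewrite /seq_dist; case: pselect => [xy|xy]; first by rewrite xy in nd.
case: cid => d [ag' nd'] /=; congr ((_.+1%:R)^-1)%R.
by case: (ltngtP d n) => // [/ag//|/ag'].
Qed.

Lemma seq_dist_sym x y : seq_dist x y = seq_dist y x.
Proof.
have [->//|xy] := pselect (x = y).
have [n [ag nd]] := first_diff_exists xy.
rewrite (@first_diff_dist x y n) //; apply/esym/first_diff_dist.
by split; [move=> i /ag|exact: nesym].
Qed.

(** If [x] and [z] first differ at [n], then [y] differs from one of them at some coordinate up to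
    [n]. *)
Lemma seq_dist_triangle y x z : (seq_dist x z <= seq_dist x y + seq_dist y z)%R.
Proof.
have [->|xz] := pselect (x = z); first by rewrite seq_distxx addr_ge0 ?seq_dist_ge0.
have [n nd] := first_diff_exists xz; rewrite (first_diff_dist nd).
have far u v : ~ agree n.+1 u v -> (n.+1%:R^-1 <= seq_dist u v)%R.
  move=> nag; have uv : u <> v by move=> uv; apply: nag; rewrite uv.
  have [m md] := first_diff_exists uv; rewrite (first_diff_dist md).
  rewrite lef_pV2 ?posrE ?ltr0n // ler_nat ltnS leqNgt; apply/negP => nm.
  by apply: nag => i im; apply: md.1; exact: leq_trans nm.
have [axy|/far xy] := pselect (agree n.+1 x y); last first.
  by apply: le_trans xy _; rewrite lerDl seq_dist_ge0.
have [ayz|/far yz] := pselect (agree n.+1 y z); last first.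
  by apply: le_trans yz _; rewrite lerDr seq_dist_ge0.
by case: nd.2; rewrite axy // ayz.
Qed.

HB.instance Definition _ := isMetric.Build R S
  seq_distxx seq_dist_eq0 seq_dist_sym seq_dist_triangle.

Lemma seq_space_nbhsP (x : S) (U : set S) :
  nbhs x U <-> exists n, forall y : S, agree n x y -> U y.
Proof.
split=> [/metric_nbhsP[n nU]|[n nU]].
  exists n.+1 => y /seq_distP xy; apply: nU; apply: le_lt_trans xy _.
  by rewrite ltf_pV2 ?posrE ?ltr0n // ltr_nat.
by apply/metric_nbhsP; exists n => y xy; apply/nU/seq_distP/ltW.
Qed.

(** One point is picked over each finite sequence that begins some code. *)
Lemma seq_space_separable : separable S.
Proof.
pose P (s : seq nat) : set S := [set y | forall i, (i < size s)%N -> c y i = nth 0 s i].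
pose D : set S := [set y | exists s (h : P s !=set0), y = projT1 (cid h)].
exists D.
  apply: (@card_le_rel _ _ _ _ (fun y k => exists s (h : P s !=set0), k = pickle s /\ y = projT1 (cid h))).
    by move=> y [s [h ->]]; exists (pickle s) => //; exists s, h.
  move=> x y k _ _ _ [s [h [-> ->]]] [t [h' [/(pcan_inj pickleK) st ->]]].
  by subst t; congr (projT1 (cid _)); exact: Prop_irrelevance.
move=> O [x Ox] oO; have /seq_space_nbhsP[n nO] : nbhs x O by exact: open_nbhs_nbhs.
have h : P (mkseq (c x) n) !=set0.
  by exists x => i; rewrite size_mkseq => im; rewrite nth_mkseq.
exists (projT1 (cid h)); split; last by exists (mkseq (c x) n), h.
apply: nO => i im; have := projT2 (cid h) i; rewrite size_mkseq => /(_ im) ->.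
by rewrite nth_mkseq.
Qed.

Lemma seq_space_metrizable : metrizable R S.
Proof. by exists S, id, id; split=> // x; exact: cvg_id. Qed.

Lemma seq_space_sep_metrizable K : [set: T] #= [set: K] -> sep_metrizable_of_card R K S.
Proof.
by move=> TK; split=> //; [exact: seq_space_separable|exact: seq_space_metrizable].
Qed.

End SequenceSpace.

Section TopologicalCharacterization.
Variables (X : topologicalType) (B : nat -> set X) (K : Type).
Hypothesis Bbase : countable_base B.

(** The right-hand side does not mention [B], so a concrete space can be analysed through its own
    neighbourhoods, whichever base is given. *)
Lemma full_ptsP x : full_pts B K x <->
  forall U, nbhs x U -> exists2 W, nbhs x W & [set: K] #<= U `\` W.
Proof.
split=> [xf U /(base_nbhs_base Bbase)[n nU]|h n].
  have [m Km] := xf n; exists (base_nbhs B x m); first exact: base_nbhs_nbhs.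
  by apply: card_le_trans Km (subset_card_le _) => y [Vy nVy]; split=> //; exact: nU.
have [W /(base_nbhs_base Bbase)[m mW] KW] := h _ (base_nbhs_nbhs Bbase x n).
by exists m; apply: card_le_trans KW (subset_card_le _) => y [Vy nWy]; split=> // /mW.
Qed.

Lemma heavy_ptsP x : heavy_pts B K x <-> forall U, nbhs x U -> [set: K] #<= U.
Proof.
split=> [xh U /(base_nbhs_base Bbase)[n nU]|h n]; last by apply: h; exact: base_nbhs_nbhs.
exact: card_le_trans (xh n) (subset_card_le nU).
Qed.

End TopologicalCharacterization.

(** * Subspaces of the Baire space built on the tree of finite sequences *)

Section TreeSpace.
Variables (R : realType) (K : Type) (Kn : nat -> Type).
Hypotheses (Kinf : infinite_set [set: K]) (Kinc : cardinals_increasing_to K Kn).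
Variable kn : forall n, Kn n -> nat -> nat.
Hypothesis kn_inj : forall n, injective (@kn n).
Variables (E : Type) (e : E -> nat -> nat).
Hypotheses (e_inj : injective e) (EK : [set: E] #<= [set: K]).
Variable W : set (seq nat * {n & Kn n}).

(* The points of [E] are branches of the tree of finite sequences; a copy of the
   part [W s] of the disjoint sum of the [Kn n] is attached at the node [s]. *)
Definition tree_pt : Type := (E + {p | W p})%type.

(** A branch is written with all values shifted by 1. A point attached at the node [s] writes [s]
    shifted by 1, then 0 as an end marker, then the index [n] of its summand, then the code of its
    element of [Kn n]. The first 0 thus separates attached points from branches and gives the length
    of [s]. *)
Definition tree_code (x : tree_pt) (i : nat) : nat :=
  match x with
  | inl x => (e x i).+1
  | inr p =>
    let: (s, z) := sval p in
    if (i < size s)%N then (nth 0 s i).+1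
    else if i - size s is j.+1 then
      (if j is l.+1 then kn (projT2 z) l else projT1 z)
    else 0
  end.

Lemma tree_code_stop p : tree_code (inr p) (size (sval p).1) = 0.
Proof. by rewrite /tree_code; case: (sval p) => s z /=; rewrite ltnn subnn. Qed.

Lemma tree_code_node p i : (i < size (sval p).1)%N ->
  tree_code (inr p) i = (nth 0 (sval p).1 i).+1.
Proof. by rewrite /tree_code; case: (sval p) => s z /= ->. Qed.

Lemma tree_code_rest p i : tree_code (inr p) (size (sval p).1 + i.+1) =
  if i is l.+1 then kn (projT2 (sval p).2) l else projT1 (sval p).2.
Proof.
rewrite /tree_code; case: (sval p) => s z /=.
by rewrite ltnNge leq_addr /= addKn.
Qed.

(** The two extra coordinates contain the end marker and the index of the summand. *)
Lemma agree_node p q : agree tree_code (size (sval p).1).+2 (inr p) (inr q) ->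
  (sval p).1 = (sval q).1 /\ projT1 (sval p).2 = projT1 (sval q).2.
Proof.
move=> h; have ss : size (sval p).1 = size (sval q).1.
  case: (ltngtP (size (sval p).1) (size (sval q).1)) => // lt.
    have := h (size (sval p).1); rewrite tree_code_stop tree_code_node //.
    by move=> /(_ (leqnSn _)).
  have := h (size (sval q).1); rewrite tree_code_stop tree_code_node //.
  by move=> /(_ (leq_trans lt (leq_trans (leqnSn _) (leqnSn _)))).
split.
  apply: (@eq_from_nth _ 0) => // i ip.
  have := h i; rewrite !tree_code_node -?ss // => /(_ (leq_trans ip (leq_trans (leqnSn _) (leqnSn _)))).
  by case.
have := h (size (sval p).1 + 1); rewrite {4}ss !tree_code_rest; apply.
by rewrite addn1.
Qed.

Lemma tree_code_inj : injective tree_code.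
Proof.
move=> [x|p] [y|q] h.
- by congr inl; apply: e_inj; apply/funext => i; have [] := congr1 (@^~ i) h.
- by have := tree_code_stop q; rewrite -h.
- by have := tree_code_stop p; rewrite h.
have [s1 n1] : (sval p).1 = (sval q).1 /\ projT1 (sval p).2 = projT1 (sval q).2.
  by apply: agree_node => i _; rewrite h.
have r i : kn (projT2 (sval p).2) i = kn (projT2 (sval q).2) i.
  by rewrite -(tree_code_rest p i.+1) -(tree_code_rest q i.+1) h s1.
have s2 : (sval p).2 = (sval q).2.
  case: (sval p).2 n1 r => n k; case: (sval q).2 => n' k' /= nn; subst n' => r.
  by congr existT; apply: kn_inj; apply/funext.
congr inr; case: p q {h n1 r} s1 s2 => [[s z] Wp] [[s' z'] Wq] /= s1 s2.
by subst s' z'; exact: eq_exist.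
Qed.

Definition tree_space := seq_space R tree_code_inj.

Lemma agree_inl n x y : agree tree_code n (inl x) (inl y) <-> forall i, (i < n)%N -> e x i = e y i.
Proof. by split=> h i /h => [[]|/= ->]. Qed.

Lemma agree_inr n x (p : {p | W p}) : agree tree_code n (inl x) (inr p) <->
  (n <= size (sval p).1)%N /\ forall i, (i < n)%N -> e x i = nth 0 (sval p).1 i.
Proof.
split=> [h|[ns h] i im].
  have ns : (n <= size (sval p).1)%N.
    rewrite leqNgt; apply/negP => /h; rewrite /tree_code.
    by case: (sval p) => s z /=; rewrite ltnn subnn.
  split=> // i im; have := h _ im; rewrite /tree_code; case: (sval p) ns => s z /= ns.
  by rewrite (leq_trans im ns) => -[].
have := h _ im; rewrite /tree_code; case: (sval p) ns {h} => s z /= ns ->.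
by rewrite (leq_trans im ns).
Qed.

Lemma card_K_sigma : [set: K] #<= [set: {n & Kn n}].
Proof.
have [_ _] := Kinc; apply => n; apply/card_leTT; exists (existT Kn n).
exact: (@existT_inj nat Kn n).
Qed.

(** The full disjoint sum at the root alone supplies [K] points; above, there are only countably
    many nodes. *)
Lemma card_tree_space : (forall z, W ([::], z)) -> [set: tree_pt] #= [set: K].
Proof.
move=> W0; apply: Cantor_Bernstein; last first.
  apply: card_le_trans card_K_sigma _; apply/card_leTT.
  by exists (fun z => inr (exist _ ([::], z) (W0 z))) => z z' [].
apply: card_sumT_le => //; rewrite (card_le_eql (card_eq_sig _)).
have /card_leTT[g ginj] : [set: {n & Kn n}] #<= [set: K].
  by apply: card_sigT_le => // n; exact: (Kn_le Kinc).
apply: card_le_trans (card_setM_nat Kinf).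
apply: (@card_le_rel _ _ _ _ (fun p u => u = (g p.2, pickle p.1))).
  by move=> p _; exists (g p.2, pickle p.1).
by move=> [s z] [s' z'] u _ _ _ /= -> [/ginj -> /(pcan_inj pickleK) ->].
Qed.

(** Agreement up to the index of the summand leaves only the copy of one [Kn n] at one node. *)
Lemma node_not_heavy p (B : nat -> set tree_space) :
  countable_base B -> ~ heavy_pts (X := tree_space) B K (inr p).
Proof.
move=> Bbase /(heavy_ptsP K Bbase); set n := (size (sval p).1).+2.
move=> /(_ [set y | agree tree_code n (inr p) y]) h.
apply: (Kn_small Kinc (n := projT1 (sval p).2)).
apply: card_le_trans (h _) _.
  by apply/seq_space_nbhsP; exists n.
apply: (@card_le_rel _ _ _ _ (fun y k => exists q, [/\ y = inr q,
   (sval q).1 = (sval p).1 & (sval q).2 = existT _ _ k])).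
  move=> [x|q] /= ag.
    by have := ag (size (sval p).1) (leqnSn _); rewrite tree_code_stop.
  have [s1 n1] := agree_node ag.
  case: q ag s1 n1 => [[s [m k]] Wq] /= ag s1 n1; subst m.
  by exists k => //; exists (exist _ (s, existT _ _ k) Wq).
move=> y y' k _ _ _ [q [-> s1 z1]] [q' [-> s1' z1']]; congr inr.
case: q s1 z1 => [[s z] Wq] /= s1 z1; case: q' s1' z1' => [[s' z'] Wq'] /= s1' z1'.
by subst s s' z z'; exact: eq_exist.
Qed.

Lemma branch_fullP x (B : nat -> set tree_space) : countable_base B ->
  full_pts (X := tree_space) B K (inl x) <-> forall n, exists m,
    [set: K] #<= [set y | agree tree_code n (inl x) y /\ ~ agree tree_code m (inl x) y].
Proof.
move=> Bbase; rewrite (full_ptsP K Bbase); split=> [h n|h U /seq_space_nbhsP[n nU]].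
  have [|V /seq_space_nbhsP[m mV] KV] := h [set y | agree tree_code n (inl x) y].
    by apply/seq_space_nbhsP; exists n.
  exists m; apply: card_le_trans KV (subset_card_le _) => y [ny nV]; split=> //.
  by move=> /mV.
have [m Km] := h n; exists [set y | agree tree_code m (inl x) y].
  by apply/seq_space_nbhsP; exists m.
by apply: card_le_trans Km (subset_card_le _) => y [ny nm]; split=> //; exact: nU.
Qed.

Lemma branch_heavyP x (B : nat -> set tree_space) : countable_base B ->
  heavy_pts (X := tree_space) B K (inl x) <-> forall n,
    [set: K] #<= [set y | agree tree_code n (inl x) y].
Proof.
move=> Bbase; rewrite (heavy_ptsP K Bbase); split=> [h n|h U /seq_space_nbhsP[n nU]].
  by apply: h; apply/seq_space_nbhsP; exists n.
exact: card_le_trans (h n) (subset_card_le nU).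
Qed.

(** The points attached at the initial part of length [n] agree with the branch on exactly [n]
    coordinates, since the end marker 0 is never a shifted value. There are [K] of them for every
    [n]. *)
Lemma branch_full x (B : nat -> set tree_space) : countable_base B ->
  (forall n z, W (mkseq (e x) n, z)) -> full_pts (X := tree_space) B K (inl x).
Proof.
move=> Bbase Wx; apply/branch_fullP => // n; exists n.+1.
apply: card_le_trans card_K_sigma _.
apply: (@card_le_rel _ _ _ _ (fun z y => y = inr (exist _ (mkseq (e x) n, z) (Wx n z)))).
  move=> z _; exists (inr (exist _ (mkseq (e x) n, z) (Wx n z))) => //; split.
    by apply/agree_inr; rewrite /= size_mkseq; split=> // i im; rewrite nth_mkseq.
  by move=> /agree_inr[]; rewrite /= size_mkseq ltnn.
by move=> z z' y _ _ _ -> [].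
Qed.

End TreeSpace.

(** A real is coded by the characteristic function of the rationals below it. *)
Lemma card_real_baire (R : realType) : [set: R] #<= [set: nat -> nat].
Proof.
apply/card_leTT.
exists (fun x n => if unpickle n is Some q then nat_of_bool (ratr q < x)%R else 0).
have lt_neq (x y : R) : (x < y)%R -> exists q : rat, (ratr q < x)%R <> (ratr q < y)%R.
  move=> /rat_in_itvoo[q]; rewrite in_itv /= => /andP[xq qy].
  by exists q; rewrite qy lt_gtF.
move=> x y h; apply/eqP; case: ltgtP => // /lt_neq[q]; case;
  by have := congr1 (@^~ (pickle q)) h; rewrite pickleK; do 2!case: (_ < _)%R.
Qed.

Lemma mkseq_const (T : Type) (a : T) n : mkseq (fun=> a) n = nseq n a.
Proof.
apply: (@eq_from_nth _ a) => [|i]; rewrite size_mkseq ?size_nseq // => im.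
by rewrite nth_mkseq // nth_nseq im.
Qed.

(** * Spaces with prescribed numbers of full and of other heavy points *)

Section Existence.
Variables (R : realType) (K : Type) (Kn : nat -> Type).
Hypotheses (Kinf : infinite_set [set: K]) (Kinc : cardinals_increasing_to K Kn).
Hypothesis KR : [set: K] #<= [set: R].

Lemma Kn_baire : exists kn : forall n, Kn n -> nat -> nat, forall n, injective (@kn n).
Proof.
have H n : exists f : Kn n -> nat -> nat, injective f.
  apply/card_leTT; apply: card_le_trans (Kn_le Kinc n) _.
  exact: card_le_trans KR (card_real_baire R).
by exists (fun n => projT1 (cid (H n))) => n; exact: projT2 (cid (H n)).
Qed.

(** With the whole sum attached at every node, each branch in [E] is full and no attached point is
    heavy. *)
Lemma exists_space_full (E : Type) : [set: E] #<= [set: K] ->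
  exists2 X : topologicalType, sep_metrizable_of_card R K X &
    forall B : nat -> set X, countable_base B ->
      full_pts B K #= [set: E] /\ heavy_pts B K `\` full_pts B K = set0.
Proof.
move=> EK; have [kn kninj] := Kn_baire.
have /card_leTT[e einj] := card_le_trans EK (card_le_trans KR (card_real_baire R)).
pose X := tree_space R kninj einj setT.
exists X.
  by apply: seq_space_sep_metrizable; exact: card_tree_space.
move=> B Bbase.
have fulli x : full_pts B K (inl x : X) by exact: branch_full.
have heavyE y : heavy_pts B K y -> exists x, y = inl x.
  by case: y => [x|q]; [exists x|move=> /(node_not_heavy Kinc Bbase)].
split; last first.
  by apply/seteqP; split=> // y [/heavyE[x ->]]; case; exact: fulli.
have -> : full_pts B K = inl @` [set: E].
  apply/seteqP; split=> y; first by move=> /full_pts_heavy/heavyE[x ->]; exists x.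
  by move=> [x _ <-].
by apply: inj_card_eq => x y _ _ [].
Qed.

(** The branches are constant sequences with distinct values. Along the first $\lambda$ of them the
    whole sum is attached at every node, which makes them full. Along the other $\mu$, only [Kn n]
    is attached at the node of length [n]: neighbourhoods then have size [K], but differences of
    neighbourhoods do not. *)
Lemma exists_space_delta (p : Delta) :
  exists2 X : topologicalType, sep_metrizable_of_card R K X &
    forall B : nat -> set X, countable_base B ->
      full_pts B K #= [set: 'I_p.1] /\
      heavy_pts B K `\` full_pts B K #= [set: omega_card p.2].
Proof.
have [kn kninj] := Kn_baire.
pose E : Type := ('I_p.1 + omega_card p.2)%type.
pose pos : E -> nat := @delta_pos p.
have posinj : injective pos := @delta_pos_inj p.
pose e (x : E) (_ : nat) := pos x.
have einj : injective e by move=> x y /(congr1 (@^~ 0)) /posinj.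
have natK : [set: nat] #<= [set: K] by exact/infiniteP.
have EK : [set: E] #<= [set: K].
  by apply: card_le_trans natK; apply/card_leTT; exists pos.
(* The first alternative attaches the whole sum at the root, for the sake of the cardinality of the
   space. *)
pose W : set (seq nat * {n & Kn n}) := [set q | q.1 = [::] \/
  exists x : E, q.1 = nseq (size q.1) (pos x) /\
    if x is inr _ then projT1 q.2 = size q.1 else True].
pose X := tree_space R kninj einj W.
exists X.
  by apply: seq_space_sep_metrizable; apply: card_tree_space => // z; left.
move=> B Bbase.
have heavyE y : heavy_pts B K y -> exists x, y = inl x.
  by case: y => [x|q]; [exists x|move=> /(node_not_heavy Kinc Bbase)].
have full_l i : full_pts B K (inl (inl i) : X).
  apply: branch_full => // n z; right; exists (inl i); rewrite /= size_mkseq; split=> //.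
  exact: mkseq_const.
have heavy_r j : heavy_pts B K (inl (inr j) : X).
  apply/branch_heavyP => // n; set A := [set y | _].
  have [_ _ /(_ A)] := Kinc; rewrite (card_le_eqr (card_setT A)); apply=> k.
  rewrite (card_le_eqr (card_setT A)).
  (* The node must have length at least [n] to lie in the neighbourhood, and at least [k] to carry a
     copy of [Kn k]. *)
  apply: card_le_trans (Kn_mono Kinc (leq_maxl k n)) _; set m := maxn k n.
  have Wm (z : Kn m) : W (nseq m (pos (inr j)), existT Kn m z).
    by right; exists (inr j); rewrite /= size_nseq.
  apply: (@card_le_rel _ _ _ _ (fun z y => y = inr (exist _ _ (Wm z)))); last first.
    by move=> z z' y _ _ _ -> [] /(@existT_inj nat Kn).
  move=> z _; exists (inr (exist _ _ (Wm z))) => //.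
  apply/agree_inr; rewrite /= size_nseq leq_maxr; split=> // i im.
  by rewrite nth_nseq (leq_trans im (leq_maxr _ _)).
have nfull_r j : ~ full_pts B K (inl (inr j) : X).
  (* Agreement on one coordinate already excludes the root and everything on other branches. *)
  move=> /branch_fullP-/(_ Bbase)/(_ 1)[m].
  (* [F r] is what the branch [j] carries at length [r]. A point that fails to agree up to [m] sits
     at some [r < m], and [K] does not inject into finitely many [Kn r] together. *)
  pose F r : set X := [set y | exists k q, y = inr q /\ sval q = (nseq r (pos (inr j)), existT Kn r k)].
  have Fle r : F r #<= [set: Kn r].
    apply: (@card_le_rel _ _ _ _ (fun y k =>
      exists q, y = inr q /\ sval q = (nseq r (pos (inr j)), existT Kn r k))).
      by move=> y [k [q yq]]; exists k => //; exists q.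
    move=> y y' k _ _ _ [q [-> qk]] [q' [-> qk']]; congr inr.
    by case: q q' qk qk' => [q Wq] [q' Wq'] /= qk qk'; subst q q'; exact: eq_exist.
  move=> Km; have : [set: K] #<= \bigcup_(r in `I_m) F r.
    apply: card_le_trans Km (subset_card_le _) => -[y|q] [a1 am].
      case: am; have e1 : pos (inr j) = pos y by have := (agree_inl kn e W 1 (inr j) y).1 a1 0 isT.
      by apply/agree_inl => i _.
    have [s1 n1] := (agree_inr kn e 1 (inr j) q).1 a1.
    have Wq := svalP q; case: Wq => [q0|[x [qx xP]]]; first by rewrite q0 in s1.
    have jx : inr j = x.
      by apply: posinj; have := n1 0 isT; rewrite {1}qx nth_nseq s1.
    subst x.
    exists (size (sval q).1) => /=.
      rewrite ltnNge; apply/negP => mq; apply: am; apply/agree_inr; split=> // i im.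
      by rewrite {1}qx nth_nseq (leq_trans im mq).
    case: q {a1 am s1 n1} qx xP => [[s [n k]] Wq] /= qx xP; subst n.
    by exists k, (exist _ (s, existT Kn (size s) k) Wq); split=> //=; rewrite -qx.
  apply: not_card_le_bigcup_lt => // r rm /card_le_trans/(_ (Fle r)).
  exact: (Kn_small Kinc).
split.
  have -> : full_pts B K = (inl \o inl) @` [set: 'I_p.1].
    apply/seteqP; split=> y; last by move=> [i _ <-]; exact: full_l.
    move=> /[dup]/full_pts_heavy/heavyE[[i|j] -> fy]; first by exists i.
    by have := nfull_r j.
  by apply: inj_card_eq => x y _ _ [].
have -> : heavy_pts B K `\` full_pts B K = (inl \o inr) @` [set: omega_card p.2].
  apply/seteqP; split=> y; last by move=> [j _ <-]; split; [exact: heavy_r|exact: nfull_r].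
  by move=> [/heavyE[[i|j] -> fy]]; [have := full_l i|exists j].
by apply: inj_card_eq => x y _ _ [].
Qed.

End Existence.

(** With ['I_n] in the role of $\kappa_n$ the tree construction also yields the countable spaces. *)
Lemma cardinals_increasing_ord : cardinals_increasing_to nat ordinal.
Proof.
split=> [n|n|T le].
- by split; rewrite card_leI_ord // ltnn.
- split; first by apply/card_leTT; exists (@nat_of_ord n); exact: ord_inj.
  by move=> /card_le_finite/(_ finite_finset); exact: nat_setT_infinite.
- apply/infiniteP => -[n /card_eqPle[Tn _]].
  have := card_le_trans (le n.+1) Tn.
  by rewrite -(card_le_eql card_II) card_le_II ltnn.
Qed.

(** * Countable cofinality *)

Section WellOrder.
Variables (A : Type) (le : rel A).
Hypothesis wo : wochoice.well_order le.

Lemma well_order_min (P : A -> Prop) : (exists x, P x) ->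
  exists2 m, P m & forall x, P x -> le m x.
Proof.
move=> [x Px]; have [|m [[mP mle] _]] := wo (A := [pred x | `[< P x >]]).
  by exists x; exact/asboolP.
exists m; first by move: mP => /asboolP.
by move=> y Py; apply: mle; exact/asboolP.
Qed.

Lemma well_order_refl x : le x x.
Proof. by have [m -> ->//] := @well_order_min (fun y => y = x) (ex_intro _ x erefl). Qed.

Lemma well_order_total x y : le x y \/ le y x.
Proof.
have [|m mxy mle] := @well_order_min (fun z => z = x \/ z = y); first by exists x; left.
by case: mxy => e; rewrite -e; [left|right]; apply: mle; [right|left].
Qed.

Lemma well_order_anti x y : le x y -> le y x -> x = y.
Proof.
move=> xy yx; have [|m [_ uniq]] := wo (A := [pred z | `[< z = x \/ z = y >]]).
  by exists x; apply/asboolP; left.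
have mx : m = x.
  apply: uniq; split; first by apply/asboolP; left.
  by move=> z /asboolP[->//|->//]; exact: well_order_refl.
have my : m = y.
  apply: uniq; split; first by apply/asboolP; right.
  by move=> z /asboolP[->//|->//]; exact: well_order_refl.
by rewrite -mx.
Qed.

Lemma well_order_trans y x z : le x y -> le y z -> le x z.
Proof.
move=> xy yz.
have [|m mxyz mle] := @well_order_min (fun u => [\/ u = x, u = y | u = z]); first by exists x; constructor 1.
case: mxyz => e; rewrite e in mle.
- by apply: mle; constructor 3.
- by have -> : x = y by apply: (well_order_anti xy); apply: mle; constructor 1.
- by have -> : z = y by apply: well_order_anti => //; apply: mle; constructor 2.
Qed.

Definition segment (x : A) : set A := [set y | le y x /\ y <> x].

Lemma segment_trans x y z : segment y x -> segment z y -> segment z x.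
Proof.
move=> [xy nxy] [yz nyz]; split; first exact: well_order_trans yz.
by move=> xz; subst z; apply: nxy; exact: well_order_anti.
Qed.

Lemma not_le_segment x y : ~ le x y -> segment x y.
Proof.
move=> nxy; have [//|yx] := well_order_total x y.
by split=> // e; apply: nxy; rewrite e; exact: well_order_refl.
Qed.

(* Zorn's lemma applied to the injections of initial segments into [S]. *)
Lemma segment_embed T (S : set T) : (forall x, ~ (S #<= segment x)) -> [set: A] #<= S.
Proof.
move=> Sx.
pose P (G : set (A * T)) := [/\ forall x y, G (x, y) -> S y,
  (forall x y y', G (x, y) -> G (x, y') -> y = y'),
  (forall x x' y, G (x, y) -> G (x', y) -> x = x') &
  (forall x y z, G (x, y) -> le z x -> exists w, G (z, w))].
have [F FP totF|G [[GS Gf Gi Gd] Gmax]] := @Zorn_bigcup _ P.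
  split.
  - by move=> x y [G /FP[h _ _ _]]; exact: h.
  - move=> x y y' [G FG Gxy] [G' FG' Gxy'].
    have [s|s] := totF _ _ FG FG'.
    + by have [_ f _ _] := FP _ FG'; apply: f Gxy'; exact: s.
    + by have [_ f _ _] := FP _ FG; apply: f Gxy _; exact: s.
  - move=> x x' y [G FG Gxy] [G' FG' Gxy'].
    have [s|s] := totF _ _ FG FG'.
    + by have [_ _ f _] := FP _ FG'; apply: f Gxy'; exact: s.
    + by have [_ _ f _] := FP _ FG; apply: f Gxy _; exact: s.
  - move=> x y z [G FG Gxy] zx; have [_ _ _ f] := FP _ FG.
    by have [w Gw] := f _ _ _ Gxy zx; exists w, G.
have [Gtot|/existsNP nGtot] := pselect (forall x, exists y, G (x, y)).
  apply: (@card_le_rel _ _ _ _ (fun x y => G (x, y))).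
    by move=> x _; have [y Gxy] := Gtot x; exists y => //; exact: GS Gxy.
  by move=> x x' y _ _ _; exact: Gi.
have [x nGx xmin] := well_order_min nGtot.
have Gseg u y : G (u, y) -> segment x u.
  move=> Gu; apply: not_le_segment => xu; apply: nGx; exact: Gd Gu xu.
(* If [G] reached all of [S], its inverse would inject [S] into the segment below [x]. *)
have [y [Sy nGy]] : exists y, S y /\ forall u, ~ G (u, y).
  apply: contrapT => nex; apply: (Sx x).
  apply: (@card_le_rel _ _ _ _ (fun y u => G (u, y))); last by move=> y y' u _ _ _; exact: Gf.
  move=> y Sy; have [u Gu] : exists u, G (u, y).
    by apply: contrapT => h; apply: nex; exists y; split=> // u Gu; apply: h; exists u.
  by exists u => //; exact: Gseg Gu.
case: (Gmax (G `|` [set (x, y)])).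
  split; first by left.
  by move=> /(_ (x, y)) s; apply: nGx; exists y; apply: s; right.
split.
- by move=> u v [/GS//|/pair_equal_spec[_ ->]].
- move=> u v v' [G1|/pair_equal_spec[eu ev]] [G2|/pair_equal_spec[eu' ev']].
  + exact: Gf G1 G2.
  + by case: nGx; exists v; rewrite -eu'.
  + by case: nGx; exists v'; rewrite -eu.
  + by rewrite ev.
- move=> u u' v [G1|/pair_equal_spec[eu ev]] [G2|/pair_equal_spec[eu' ev']].
  + exact: Gi G1 G2.
  + by case: (nGy u); rewrite -ev'.
  + by case: (nGy u'); rewrite -ev.
  + by rewrite eu.
- move=> u v z [G1|/pair_equal_spec[-> _]] zu.
    by have [w Gw] := Gd _ _ _ G1 zu; exists w; left.
  have [->|zx] := pselect (z = x); first by exists y; right.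
  have [w Gw] : exists w, G (z, w).
    by apply: contrapT => /xmin xz; apply: zx; exact: well_order_anti.
  by exists w; left.
Qed.

End WellOrder.

(** If some proper segment of a well-order has size [K], the order of the least such segment is
    transported to [K]; by minimality its own segments are smaller. *)
Lemma initial_well_order_exists (K : Type) : exists le : rel K, initial_well_order le.
Proof.
have [R wo] : exists R : rel K, wochoice.well_order R.
  by have [R wo] := wochoice.well_ordering_principle {classic K}; exists R.
have [init|/existsNP[x0 nx0]] := pselect (forall x, card_lt (segment R x) [set: K]).
  by exists R.
have [x Kx xmin] := @well_order_min _ _ wo (fun x => [set: K] #<= segment R x)
  (ex_intro _ x0 (contrapT (fun h => nx0 (conj (card_leT _) h)))).
have /card_bijP[f fbij] : [set: K] #= segment R x.
  by apply: Cantor_Bernstein => //; exact: card_leT.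
pose g (k : K) : K := val (f (SigSub (mem_set (I : [set: K] k)))).
have gx k : segment R x (g k) by exact: set_valP.
have ginj : injective g by move=> k l /val_inj/(bij_inj fbij)/(congr1 val).
have gonto y : segment R x y -> exists k, g k = y.
  move=> xy; have [h fh hf] := fbij; exists (val (h (SigSub (mem_set xy)))); rewrite /g.
  transitivity (val (f (h (SigSub (mem_set xy))))); last by rewrite hf.
  by congr (val (f _)); exact: val_inj.
exists (fun a b => R (g a) (g b)); split.
  apply: wochoice.antisymmetric_well_order.
    by move=> a b /andP[ab ba]; apply: ginj; exact: (well_order_anti wo).
  move=> Q [a Qa].
  have [_ [b Qb <-] bmin] := @well_order_min _ _ wo (fun y => exists2 b, b \in Q & g b = y)
    (ex_intro _ (g a) (ex_intro2 _ _ a Qa erefl)).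
  by exists b; split=> // c Qc; apply: bmin; exists c.
move=> a; split; first exact: card_leT.
move=> Ka; have [_] := gx a; apply; apply: (well_order_anti wo); first exact: (gx a).1.
apply: xmin; apply: card_le_trans Ka _.
apply: (@card_le_rel _ _ _ _ (fun b y => y = g b)).
  by move=> b [Rba ba]; exists (g b) => //; split=> // /ginj.
by move=> b c y _ _ _ -> /ginj.
Qed.

(** If every piece [F n] were smaller than [K], it would inject into a proper segment, below some
    [x n]. The sequence [x] is then cofinal, for a common strict upper bound [y] would make the
    union no larger than the segment of [y], or countable; so the cofinality would be $\omega$. *)
Lemma not_has_cof_bigcup (K : Type) : infinite_set [set: K] -> ~ has_cof K nat ->
  forall T (F : nat -> set T), [set: K] #<= \bigcup_n F n -> exists n, [set: K] #<= F n.
Proof.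
move=> Kinf ncof T F KF; apply: contrapT => /forallNP nF; apply: ncof.
have [le [wo init]] := initial_well_order_exists K.
(* A finite cofinal set would cover [K] by finitely many closed initial segments, each smaller than
   [K]. *)
have cofinf C : cofinal le C -> [set: nat] #<= C.
  move=> Ccof; apply/infiniteP => Cfin.
  have [x0 _] := infinite_setN0 Kinf; have [c0 Cc0 _] := Ccof x0.
  have [n /card_eqPle[Cn _]] := Cfin.
  have [f fn finj] := card_le_fun Cn (ex_intro _ c0 Cc0).
  pose G i := [set y | exists2 c, C c & f c = i /\ le y c].
  have KG : [set: K] #<= \bigcup_(i in `I_n) G i.
    apply: subset_card_le => y _; have [c Cc yc] := Ccof y.
    by exists (f c); [exact: fn|exists c].
  apply: (not_card_le_bigcup_lt Kinf _ KG) => i _ KGi.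
  have [[c Cc fc]|nc] := pselect (exists2 c, C c & f c = i); last first.
    apply: Kinf; apply: card_le_finite KGi (sub_finite_set _ (finite_set0 _)).
    by move=> y [c Cc [fc _]]; case: nc; exists c.
  apply: (not_card_le_setU Kinf (init c).2 (B := [set c])).
    by move=> /card_le_finite/(_ (finite_set1 _)).
  apply: card_le_trans KGi (subset_card_le _) => y [c' Cc' [fc' yc']].
  have {Cc' fc'} cc : c' = c by apply: finj; rewrite ?in_setE // fc'.
  by subst c'; have [->|yc] := pselect (y = c); [right|left].
exists le; split=> //.
have [Kn|Kunc] := pselect ([set: K] #<= [set: nat]).
  exists setT; first by move=> x; exists x => //; exact: well_order_refl.
  by apply: Cantor_Bernstein => //; exact/infiniteP.
have /choice[x xP] n : exists x, F n #<= segment le x.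
  apply: contrapT => /forallNP h; apply: (nF n); exact: (segment_embed wo).
have xcof : cofinal le (range x).
  apply: contrapT => /existsNP[y yP]; have ltx n : segment le y (x n).
    apply: not_le_segment => // yx; apply: yP; exists (x n) => //; exists n.
  have Fy n : F n #<= segment le y.
    apply: card_le_trans (xP n) (subset_card_le _) => z xz.
    exact: (segment_trans wo xz (ltx n)).
  have [yfin|yinf] := pselect (finite_set (segment le y)).
    apply: Kunc; apply: card_le_trans KF _; apply: bigcup_countable => // n _.
    by apply: finite_set_countable; exact: card_le_finite (Fy n) yfin.
  by have [_] := init y; apply; apply: card_le_trans KF (card_le_bigcup yinf Fy).
exists (range x) => //; apply: Cantor_Bernstein; last exact: cofinf.
exact: card_image_le.
Qed.

(** * The classification *)

Lemma sep_metrizable_spec (R : realType) (K : Type) (X : topologicalType) :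
  sep_metrizable_of_card R K X ->
  [/\ hausdorff_space X, exists B : nat -> set X, countable_base B,
      [set: X] #<= [set: K] & [set: K] #<= [set: X]].
Proof.
move=> [sX mX /card_eqPle[XK KX]]; split=> //; first exact: metrizable_hausdorff mX.
exact: sep_metrizable_base mX.
Qed.

(** * Strict growth of the type with the cardinality *)

Section Comparison.
Variables (R : realType) (mu nu : Type) (M N : topologicalType).
Hypotheses (mu_inf : infinite_set [set: mu]) (mu_nu : card_lt [set: mu] [set: nu]).
Hypotheses (Mmu : sep_metrizable_of_card R mu M) (Nnu : sep_metrizable_of_card R nu N).

(** [E] collects the points of [N] all of whose neighbourhoods exceed [mu]; the other points number
    at most [mu], so [E] does not inject into [mu]. Each point of [E] contributes at least $P(\mu)$,
    hence seq(N) lies above $P(\mu)\times(\mu,=)$ and so above seq(M). A morphism the other way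
    would inject [E] into the points of [M]. *)
Lemma seqT_lt : tukey_lt (seqT M) (seqT N).
Proof.
have [M2 [BM BMbase] Mmu' _] := sep_metrizable_spec Mmu.
have [N2 [B Bbase] _ nuN] := sep_metrizable_spec Nnu.
pose E := [set x | forall n, ~ (base_nbhs B x n #<= [set: mu])].
have nE : ~ (E #<= [set: mu]).
  move=> Emu; apply: mu_nu.2; apply: card_le_trans nuN _.
  apply: card_le_trans (card_le_setU mu_inf Emu (light_pts_le Bbase mu_inf)).
  apply: subset_card_le => x _; have [xE|/existsNP[n /contrapT xn]] := pselect (E x); first by left.
  by right; exists n.
have E_large x : E x -> forall k, exists2 n, (k <= n)%N & [set: mu] #<= shell B x n.
  by move=> Ex; exact: shell_infinitely_large.
have Eacc x : E x -> accumulation B x.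
  move=> Ex k; have [n kn mun] := E_large x Ex k.
  have [y [Vy nVy]] : shell B x n !=set0.
    by apply: infinite_setN0 => /(card_le_finite mun).
  exists y; first exact: base_nbhs_sub kn _ Vy.
  by apply: (@shell_neq _ B _ n); split.
have NE : tukey_ge (seqT N) (trel_sum (fun _ : {x | E x} => trelP mu)).
  apply: tukey_ge_trans (seqT_ge_local_sum N2 Bbase) _.
  apply: (@trel_sum_ge _ _ _ _ (fun p => exist _ (sval p) (Eacc _ (svalP p)))).
  - by move=> [x Ex] [y Ey] [] /= xy; exact: eq_exist.
  - move=> [x Ex]; apply: trelQ_geP => k; have [n kn mun] := E_large x Ex k.
    by exists n => //; rewrite -shells_geP.
  - by move=> _; exact/trelP_inhabited/infinite_setN0.
split.
  apply: tukey_ge_trans NE _; apply: tukey_ge_trans (sum_trelP_ge_seqT M2 BMbase Mmu').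
  have /card_leTT[h hinj] : [set: mu] #<= [set: {x | E x}].
    by rewrite (card_le_eqr (card_eq_sig _)); have [] := card_le_total [set: mu] E.
  apply: (trel_sum_ge hinj) => [_|_]; first exact: tukey_ge_refl.
  exact/trelP_inhabited/infinite_setN0.
move=> MN; apply: nE.
have := tukey_ge_trans (local_sum_ge M2 BMbase) (tukey_ge_trans MN NE).
move=> /trel_sum_ge_card h; rewrite -(card_le_eql (card_eq_sig _)).
apply: card_le_trans (h _ _) _.
- by move=> p x y; exact: fin_seqs_common.
- by move=> _; exact/trelP_inhabited/infinite_setN0.
- by rewrite (card_le_eql (card_eq_sig _)); exact: card_le_trans (card_leT _) Mmu'.
Qed.

End Comparison.

(** * The countable case *)

Section Countable.
Variable R : realType.

Lemma nat_real : [set: nat] #<= [set: R].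
Proof. by apply/card_leTT; exists (fun n => n%:R)%R => m n /eqP; rewrite eqr_nat => /eqP. Qed.

(** Infinitely many full points give the top class; otherwise the numbers of full and of other heavy
    points form a pair in [Delta]. *)
Lemma sep_metrizable_countable X : sep_metrizable_of_card R nat X ->
  tukey_eq (seqT X) (trel_sum (fun _ : nat => trelP nat)) \/
  exists p : Delta, tukey_eq (seqT X) (trel_sum (@cform 'I_p.1 (omega_card p.2))).
Proof.
move=> /sep_metrizable_spec[X2 [B Bbase] Xnat natX].
have [full|/finite_setPn[l fl]] := pselect ([set: nat] #<= full_pts B nat).
  left; apply: tukey_eq_trans (seqT_full X2 Bbase nat_setT_infinite Xnat full) _.
  exact: trel_prod_eqE.
have [|m bm] := @countable_omega_card _ (heavy_pts B nat `\` full_pts B nat).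
  exact: card_le_trans (card_leT _) Xnat.
right; exists (l, m); apply: (seqT_countable X2 Bbase Xnat) => //.
exact: card_eq_trans fl card_II.
Qed.

Lemma countable_case : exists (M : Delta -> topologicalType) (N : topologicalType),
     (forall p, sep_metrizable_of_card R nat (M p)) /\
     sep_metrizable_of_card R nat N /\
     (forall C, seq_classes R nat C <->
        (exists p, C = tukey_class (seqT (M p))) \/ C = tukey_class (seqT N)) /\
     (forall p, ~ tukey_eq (seqT N) (seqT (M p))) /\
     (forall p, tukey_eq (seqT (M p))
        (trel_le_infty * trel_eq 'I_p.1 + trel_eq (omega_card p.2))%trel) /\
     tukey_eq (seqT N) (trel_le_infty * trel_eq nat)%trel /\
     (forall p, tukey_ge (seqT N) (seqT (M p))) /\
     (forall p q, Delta_ge p q <-> tukey_ge (seqT (M p)) (seqT (M q))).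
Proof.
have exM := exists_space_delta nat_setT_infinite cardinals_increasing_ord nat_real.
pose M p := projT1 (cid2 (exM p)).
have Mmet p : sep_metrizable_of_card R nat (M p) by rewrite /M; case: cid2.
have Mform p : tukey_eq (seqT (M p)) (trel_sum (@cform 'I_p.1 (omega_card p.2))).
  have [X2 [B Bbase] Xnat _] := sep_metrizable_spec (Mmet p).
  have [full heavy] : full_pts B nat #= [set: 'I_p.1] /\
      heavy_pts B nat `\` full_pts B nat #= [set: omega_card p.2].
    by move: B Bbase; rewrite /M; case: cid2.
  exact: (seqT_countable X2 Bbase Xnat full heavy).
have [N Nmet NP] := exists_space_full nat_setT_infinite cardinals_increasing_ord nat_real (card_lexx [set: nat]).
have Nform : tukey_eq (seqT N) (trel_sum (fun _ : nat => trelP nat)).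
  have [X2 [B Bbase] Xnat _] := sep_metrizable_spec Nmet.
  have [/card_eqPle[_ full] _] := NP _ Bbase.
  apply: tukey_eq_trans (seqT_full X2 Bbase nat_setT_infinite Xnat full) _.
  exact: trel_prod_eqE.
exists M, N; split; first exact: Mmet.
split; first exact: Nmet.
split.
  move=> C; split=> [[X Xmet ->]|[[p ->]|->]]; last by exists N.
    have [XN|[p Xp]] := sep_metrizable_countable Xmet.
      by right; apply: tukey_class_eq; apply: tukey_eq_trans XN _; exact: tukey_eq_sym.
    by left; exists p; apply: tukey_class_eq; apply: tukey_eq_trans Xp _; exact: tukey_eq_sym.
  by exists (M p).
split.
  (* Infinitely many components $P(\omega)$ would have to be matched with the finitely many of
     [M p]. *)
  move=> p [_ MN].
  have := tukey_ge_trans (tukey_ge_trans (Mform p).2 MN) Nform.1.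
  move=> /(cform_ge_sum_le (omega_card_countable p.2))/card_le_finite.
  by move=> /(_ finite_finset)/nat_setT_infinite.
split; first by move=> p; apply: tukey_eq_trans (Mform p) _; exact/tukey_eq_sym/cformE.
split.
  apply: tukey_eq_trans Nform _; apply: tukey_eq_sym.
  apply: tukey_eq_trans (trel_prod_eqE _ _) _; apply: (@trel_sum_eq _ _ _ _ id).
  - by exists id.
  - by move=> _; exact: trel_le_inftyE.
  - by move=> _; apply: trelP_inhabited; exists 0.
  - by move=> _; exists; exact: id.
split.
  move=> p; apply: tukey_ge_trans Nform.1 _.
  have [X2 [B Bbase] Xnat _] := sep_metrizable_spec (Mmet p).
  exact: (sum_trelP_ge_seqT X2 Bbase Xnat).
move=> p q; split=> [/Delta_geP pq|pq].
  apply: tukey_ge_trans (Mform p).1 _.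
  by apply: tukey_ge_trans pq _; exact: (Mform q).2.
apply/Delta_geP; apply: tukey_ge_trans (Mform p).2 _.
by apply: tukey_ge_trans pq _; exact: (Mform q).1.
Qed.

End Countable.

(** * Cardinals whose cofinality is not omega *)

Section Regular.
Variables (R : realType) (K : Type).
Hypotheses (Kinf : infinite_set [set: K]) (KR : [set: K] #<= [set: R]).
Hypothesis ncof : ~ has_cof K nat.

(** Every space of size [K] has [K] full points, hence the top type; any [K] points of the Baire
    space show that the class is realized. *)
Lemma regular_case C : seq_classes R K C <-> C = tukey_class (trelP K * trel_eq K)%trel.
Proof.
have cls X : sep_metrizable_of_card R K X ->
    tukey_class (seqT X) = tukey_class (trelP K * trel_eq K)%trel.
  move=> /sep_metrizable_spec[X2 [B Bbase] XK KX].
  apply/tukey_class_eq/(seqT_full X2 Bbase Kinf XK).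
  by apply: full_pts_regular => //; exact: not_has_cof_bigcup.
split=> [[X Xmet ->]|->]; first exact: cls.
have /card_leTT[c cinj] := card_le_trans KR (card_real_baire R).
exists (seq_space R cinj); first exact/seq_space_sep_metrizable/card_eqxx.
by rewrite cls //; exact/seq_space_sep_metrizable/card_eqxx.
Qed.

End Regular.

(** * Uncountable cardinals of countable cofinality *)

Section SingularCountable.
Variables (R : realType) (K : Type) (A : Type) (le : rel A) (alpha : A)
  (aleph : A -> Type) (Kn : nat -> Type).
Hypotheses (wo : wochoice.well_order le) (alpha_max : forall b, le b alpha).
Hypotheses (alephP : aleph_family le aleph) (Kalpha : [set: K] #= [set: aleph alpha]).
Hypotheses (Kunc : card_lt [set: nat] [set: K]) (KR : [set: K] #<= [set: R]).
Hypothesis Kinc : cardinals_increasing_to K Kn.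

Let Kinf : infinite_set [set: K] := (infiniteP _).2 Kunc.1.

Lemma aleph_inf b : infinite_set [set: aleph b].
Proof. by have [] := alephP b. Qed.

Lemma aleph_mono b c : le c b -> [set: aleph c] #<= [set: aleph b].
Proof.
move=> cb; have [->|nbc] := pselect (c = b); first exact: card_lexx.
by have [_ /(_ c cb nbc)[]] := alephP b.
Qed.

Lemma aleph_le b : [set: aleph b] #<= [set: K].
Proof. by rewrite (card_le_eqr Kalpha); apply: aleph_mono; exact: alpha_max. Qed.

Lemma aleph_small b : b <> alpha -> ~ ([set: K] #<= [set: aleph b]).
Proof.
by move=> nb; rewrite (card_le_eql Kalpha); have [_ /(_ b (alpha_max b) nb)[]] := alephP alpha.
Qed.

(** For the least [b] with [S] bounded by [aleph b], the set [S] exceeds all earlier alephs, so the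
    minimality of [aleph b] gives equality. *)
Lemma aleph_exists T (S : set T) : infinite_set S -> ~ ([set: K] #<= S) ->
  exists2 b, b <> alpha & S #= [set: aleph b].
Proof.
move=> Sinf Ssmall.
have [|b bS bmin] := @well_order_min _ _ wo (fun b => S #<= [set: aleph b]).
  exists alpha; rewrite -(card_le_eqr Kalpha).
  by have [//|/Ssmall] := card_le_total S [set: K].
have Sb : S #= [set: aleph b].
  apply: Cantor_Bernstein => //; have [_ _ /(_ S)] := alephP b.
  rewrite (card_le_eqr (card_setT S)); apply; first by rewrite (eq_finite_set (card_setT S)).
  move=> c cb nc; have nSc : ~ (S #<= [set: aleph c]).
    by move=> /bmin bc; apply: nc; exact: (well_order_anti wo).
  rewrite /card_lt (card_le_eqr (card_setT S)) (card_le_eql (card_setT S)); split=> //.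
  by have [|] := card_le_total S [set: aleph c].
by exists b => // balpha; apply: Ssmall; rewrite (card_le_eql Kalpha) -balpha; case/card_eqPle: Sb.
Qed.

(** Infinitely many components $P(\kappa)$ absorb countably many $Q(\kappa)$. So once there are
    infinitely many full points only their number matters, and the types of the $N_\beta$ carry no
    $Q(\kappa)$. *)
Lemma form_absorb I J : infinite_set [set: I] -> countable [set: J] ->
  tukey_ge (trel_sum (@tform K Kn I void)) (trel_sum (@tform K Kn I J)).
Proof.
move=> Iinf Jc; have /card_leTT[h hinj] : [set: I + J] #<= [set: I].
  apply: card_sumT_le => //; apply: card_le_trans Jc _; exact/infiniteP.
by apply: (@form_ge _ _ Kinf Kinc _ _ _ _ (inl \o h)) => [x y [/hinj]|i] //; exists (h (inl i)).
Qed.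

(** The cases are those of the number of full points: at least [K], infinite but smaller, or
    finite. *)
Lemma sep_metrizable_singular X : sep_metrizable_of_card R K X ->
  [\/ tukey_eq (seqT X) (trelP K * trel_eq K)%trel,
     exists2 b, b <> alpha & tukey_eq (seqT X) (trel_sum (@tform K Kn (aleph b) void)) |
     exists p : Delta, tukey_eq (seqT X) (trel_sum (@tform K Kn 'I_p.1 (omega_card p.2)))].
Proof.
move=> Xmet; have [X2 [B Bbase] XK KX] := sep_metrizable_spec Xmet.
have [full|nfull] := pselect ([set: K] #<= full_pts B K).
  by constructor 1; exact: (seqT_full X2 Bbase Kinf XK full).
have [m bm] := countable_omega_card (heavy_not_full_countable X2 Bbase K).
have XKe : [set: X] #= [set: K] by have [_ _] := Xmet.
have [[l fl]|finf] := pselect (finite_set (full_pts B K)).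
  constructor 3; exists (l, m).
  by apply: (seqT_cof_omega X2 Bbase Kinf Kinc Kunc.2 XKe nfull _ bm); exact: card_eq_trans fl card_II.
constructor 2; have [b balpha fb] := aleph_exists finf nfull; exists b => //.
apply: tukey_eq_trans (seqT_cof_omega X2 Bbase Kinf Kinc Kunc.2 XKe nfull fb bm) _.
split; last by apply: form_absorb; [exact: aleph_inf|exact: omega_card_countable].
apply: (@form_ge _ _ Kinf Kinc _ _ _ _ 
    (fun x : aleph b + void => 
      match x with inl i => inl i | inr v => match v with end end)).
  by move=> [x|[]] [y|[]] // [->].
by move=> i; exists i.
Qed.

(** [N b] is the tree space with [aleph b] full points and no other heavy points. For [b = alpha]
    this number is that of [K], so the top type results; for the other [b] the normal form
    applies. *)
Lemma singular_case : exists (M : Delta -> topologicalType) (N : A -> topologicalType),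
       (forall p, sep_metrizable_of_card R K (M p)) /\
       (forall b, sep_metrizable_of_card R K (N b)) /\
       (forall C, seq_classes R K C <->
          (exists p, C = tukey_class (seqT (M p))) \/
          (exists b, C = tukey_class (seqT (N b)))) /\
       (forall p, tukey_eq (seqT (M p))
          (trelP K * trel_eq 'I_p.1 + trelQ Kn * trel_eq (omega_card p.2) + trelS Kn)%trel) /\
       (forall b, b <> alpha ->
          tukey_eq (seqT (N b)) (trelP K * trel_eq (aleph b) + trelS Kn)%trel) /\
       tukey_eq (seqT (N alpha)) (trelP K * trel_eq K)%trel /\
       (forall b c, le c b -> tukey_ge (seqT (N b)) (seqT (N c))) /\
       (forall b0, (forall b, le b0 b) ->
          forall p, tukey_ge (seqT (N b0)) (seqT (M p))) /\
       (forall p q, Delta_ge p q -> tukey_ge (seqT (M p)) (seqT (M q))).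
Proof.
have exM := exists_space_delta Kinf Kinc KR.
have exN b := exists_space_full Kinf Kinc KR (aleph_le b).
pose M p := projT1 (cid2 (exM p)).
pose N b := projT1 (cid2 (exN b)).
have Mmet p : sep_metrizable_of_card R K (M p) by rewrite /M; case: cid2.
have Nmet b : sep_metrizable_of_card R K (N b) by rewrite /N; case: cid2.
have Mform p : tukey_eq (seqT (M p)) (trel_sum (@tform K Kn 'I_p.1 (omega_card p.2))).
  have [X2 [B Bbase] _ _] := sep_metrizable_spec (Mmet p).
  have [full heavy] : full_pts B K #= [set: 'I_p.1] /\
      heavy_pts B K `\` full_pts B K #= [set: omega_card p.2].
    by move: B Bbase; rewrite /M; case: cid2.
  have XKe : [set: M p] #= [set: K] by have [_ _] := Mmet p.
  apply: (seqT_cof_omega X2 Bbase Kinf Kinc Kunc.2 XKe _ full heavy).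
  by rewrite (card_le_eqr full) => /card_le_finite/(_ finite_finset)/Kinf.
have NP b (B : nat -> set (N b)) : countable_base B ->
    full_pts B K #= [set: aleph b] /\ heavy_pts B K `\` full_pts B K = set0.
  by move: B; rewrite /N; case: cid2.
have Nform b : b <> alpha -> tukey_eq (seqT (N b)) (trel_sum (@tform K Kn (aleph b) void)).
  move=> nb; have [X2 [B Bbase] _ _] := sep_metrizable_spec (Nmet b).
  have [full heavy] := NP b B Bbase.
  have XKe : [set: N b] #= [set: K] by have [_ _] := Nmet b.
  apply: (seqT_cof_omega X2 Bbase Kinf Kinc Kunc.2 XKe _ full).
    by rewrite (card_le_eqr full); exact: aleph_small.
  have -> : [set: void] = set0 by apply/seteqP; split=> -[].
  by rewrite heavy card_eq00.
have Nalpha : tukey_eq (seqT (N alpha)) (trelP K * trel_eq K)%trel.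
  have [X2 [B Bbase] XK _] := sep_metrizable_spec (Nmet alpha).
  have [full _] := NP alpha B Bbase.
  by apply: (seqT_full X2 Bbase Kinf XK); rewrite (card_le_eqr full); case/card_eqPle: Kalpha.
have Nalpha_ge X : sep_metrizable_of_card R K X -> tukey_ge (seqT (N alpha)) (seqT X).
  move=> /sep_metrizable_spec[X2 [B Bbase] XK _].
  apply: tukey_ge_trans Nalpha.1 _; apply: tukey_ge_trans (trel_prod_eqE _ _).1 _.
  exact: (sum_trelP_ge_seqT X2 Bbase XK).
exists M, N; split; first exact: Mmet.
split; first exact: Nmet.
split.
  move=> C; split=> [[X Xmet ->]|[[p ->]|[b ->]]]; [|by exists (M p)|by exists (N b)].
  have [XN|[b nb Xb]|[p Xp]] := sep_metrizable_singular Xmet.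
  - by right; exists alpha; apply: tukey_class_eq; apply: tukey_eq_trans XN _; exact: tukey_eq_sym.
  - right; exists b; apply: tukey_class_eq; apply: tukey_eq_trans Xb _.
    by apply: tukey_eq_sym; exact: Nform.
  - by left; exists p; apply: tukey_class_eq; apply: tukey_eq_trans Xp _; exact: tukey_eq_sym.
split; first by move=> p; apply: tukey_eq_trans (Mform p) _; exact/tukey_eq_sym/formE.
split; first by move=> b nb; apply: tukey_eq_trans (Nform b nb) _; exact/tukey_eq_sym/form_noQ_E.
split; first exact: Nalpha.
split.
  move=> b c cb; have [->|nb] := pselect (b = alpha); first exact: Nalpha_ge.
  have nc : c <> alpha.
    by move=> ca; subst c; apply: nb; apply: (well_order_anti wo) => //; exact: alpha_max.
  apply: tukey_ge_trans (Nform b nb).1 _; apply: tukey_ge_trans (Nform c nc).2.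
  have /card_leTT[h hinj] := aleph_mono cb.
  apply: (@form_ge _ _ Kinf Kinc _ _ _ _ 
    (fun x : aleph c + void => 
      match x with inl i => inl (h i) | inr v => match v with end end)).
    by move=> [x|[]] [y|[]] // [/hinj ->].
  by move=> i; exists (h i).
split.
  move=> b _ p; have [->|nb] := pselect (b = alpha); first exact: Nalpha_ge.
  apply: tukey_ge_trans (Nform b nb).1 _; apply: tukey_ge_trans (Mform p).2.
  have /card_leTT[h hinj] : [set: 'I_p.1 + omega_card p.2] #<= [set: aleph b].
    apply: card_sumT_le; first exact: aleph_inf.
      by apply: finite_card_le; [exact: finite_finset|exact: aleph_inf].
    apply: card_le_trans (omega_card_countable _) _; apply/infiniteP; exact: aleph_inf.
  by apply: (@form_ge _ _ Kinf Kinc _ _ _ _ (inl \o h)) => [x y [/hinj]|i] //; exists (h (inl i)).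
move=> p q /Delta_ge_inj[h hinj hI].
apply: tukey_ge_trans (Mform p).1 _; apply: tukey_ge_trans (Mform q).2.
exact: (form_ge Kinf Kinc hinj hI).
Qed.

End SingularCountable.

Theorem theorem4p12 (R : realType) :
  (forall (mu nu : Type) (M N : topologicalType),
     infinite_set [set: mu] -> [set: nu] #<= [set: R] ->
     card_lt [set: mu] [set: nu] ->
     sep_metrizable_of_card R mu M -> sep_metrizable_of_card R nu N ->
     tukey_lt (seqT M) (seqT N))
  /\
  (exists (M : Delta -> topologicalType) (N : topologicalType),
     (forall p, sep_metrizable_of_card R nat (M p)) /\
     sep_metrizable_of_card R nat N /\
     (forall C, seq_classes R nat C <->
        (exists p, C = tukey_class (seqT (M p))) \/ C = tukey_class (seqT N)) /\
     (forall p, ~ tukey_eq (seqT N) (seqT (M p))) /\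
     (forall p, tukey_eq (seqT (M p))
        (trel_le_infty * trel_eq 'I_p.1 + trel_eq (omega_card p.2))%trel) /\
     tukey_eq (seqT N) (trel_le_infty * trel_eq nat)%trel /\
     (forall p, tukey_ge (seqT N) (seqT (M p))) /\
     (forall p q, Delta_ge p q <-> tukey_ge (seqT (M p)) (seqT (M q))))
  /\
  (forall kappa : Type,
     infinite_set [set: kappa] -> [set: kappa] #<= [set: R] ->
     ~ has_cof kappa nat ->
     forall C, seq_classes R kappa C <->
       C = tukey_class (trelP kappa * trel_eq kappa)%trel)
  /\
  (forall (kappa : Type)
     (* [A] is the ordinal alpha + 1 *)
     (A : Type) (le : rel A) (alpha : A) (aleph : A -> Type)
     (kappa_ : nat -> Type),
     wochoice.well_order le -> (forall b, le b alpha) ->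
     aleph_family le aleph -> [set: kappa] #= [set: aleph alpha] ->
     card_lt [set: nat] [set: kappa] -> [set: kappa] #<= [set: R] ->
     has_cof kappa nat -> cardinals_increasing_to kappa kappa_ ->
     exists (M : Delta -> topologicalType) (N : A -> topologicalType),
       (forall p, sep_metrizable_of_card R kappa (M p)) /\
       (forall b, sep_metrizable_of_card R kappa (N b)) /\
       (forall C, seq_classes R kappa C <->
          (exists p, C = tukey_class (seqT (M p))) \/
          (exists b, C = tukey_class (seqT (N b)))) /\
       (forall p, tukey_eq (seqT (M p))
          (trelP kappa * trel_eq 'I_p.1
           + trelQ kappa_ * trel_eq (omega_card p.2)
           + trelS kappa_)%trel) /\
       (forall b, b <> alpha ->
          tukey_eq (seqT (N b))
            (trelP kappa * trel_eq (aleph b) + trelS kappa_)%trel) /\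
       tukey_eq (seqT (N alpha)) (trelP kappa * trel_eq kappa)%trel /\
       (forall b c, le c b -> tukey_ge (seqT (N b)) (seqT (N c))) /\
       (forall b0, (forall b, le b0 b) ->
          forall p, tukey_ge (seqT (N b0)) (seqT (M p))) /\
       (forall p q, Delta_ge p q -> tukey_ge (seqT (M p)) (seqT (M q)))).
Proof.
split; first by move=> mu nu M N muinf _ munu Mmu Nnu; exact: seqT_lt muinf munu Mmu Nnu.
split; first exact: countable_case.
split; first by move=> kappa kinf kR ncof C; exact: regular_case.
move=> kappa A le alpha aleph kappa_ wo amax alephP kalpha kunc kR _ kinc.
exact: singular_case wo amax alephP kalpha kunc kR kinc.
Qed.
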